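(* Let $N$ and $H$ be torsion-free and countable discrete groups with $N$ Abelian. Additionally, suppose that $H$ is amenable and let $G$ be a central extension of $H$ by $N$. If $C^*(H)$ contains no non-trivial projections, then the same is true for $C^*(G)$.
   Context: A central extension of $H$ by $N$ is a group $G$ fitting into a short exact sequence $1\to N\to G\to H\to 1$ such that (the image of) $N$ is contained in the center of $G$. For a discrete group $G$, $C^*(G)$ denotes the full group C$^*$-algebra, i.e. the universal enveloping C$^*$-algebra of the normed $*$-algebra $\mathbb{C}[G]$ equipped with convolution, the involution $\big(\sum_g f_g\delta_g\big)^*=\sum_g\overline{f_g}\,\delta_{g^{-1}}$ and the norm $\|f\|_1=\sum_g|f_g|$. A projection is an element $p$ with $p=p^*=p^2$; it is trivial if it is $0$ or the identity. *)

(* Defs.v *)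
From HB Require Import structures.
From mathcomp Require Import all_boot all_order all_algebra.
From mathcomp Require Import finmap complex.
From mathcomp.multinomials Require Import monalg.
From mathcomp Require Import all_classical all_reals all_analysis.

Set Implicit Arguments.
Unset Strict Implicit.
Unset Printing Implicit Defensive.

Import Order.TTheory GRing.Theory Num.Theory.
Import numFieldNormedType.Exports.

Local Open Scope ring_scope.

Definition torsion_free (G : groupType) : Prop :=
  forall (x : G) (n : nat), (0 < n)%N -> (x ^+ n = 1)%g -> (x = 1)%g.

(* 1 -> N --i--> G --q--> H -> 1 is exact and i maps N into the center of G. *)
Record central_extension (N G H : groupType)
    (i : {multiplicative N -> G}) (q : {multiplicative G -> H}) : Prop := {
  central_ext_inj : injective i;
  central_ext_exact : forall g : G, (q g = 1)%g <-> exists n : N, i n = g;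
  central_ext_surj : forall h : H, exists g : G, q g = h;
  central_ext_central : forall (n : N) (g : G), (i n * g = g * i n)%g
}.

(* Only the values of a mean on bounded functions are meaningful. *)
Record invariant_mean (R : realType) (H : groupType) (m : (H -> R) -> R) :
    Prop := {
  mean_linear : forall (a : R) (f g : H -> R),
    bounded_fun f -> bounded_fun g ->
    m (fun x => a * f x + g x) = a * m f + m g;
  mean_ge0 : forall f : H -> R,
    bounded_fun f -> (forall x, 0 <= f x) -> 0 <= m f;
  mean1 : m (fun=> 1) = 1;
  mean_invariant : forall (h : H) (f : H -> R),
    bounded_fun f -> m (fun x => f (h * x)%g) = m f
}.

Definition amenable (R : realType) (H : groupType) : Prop :=
  exists m : (H -> R) -> R, invariant_mean m.

HB.mixin Record hasStar (C : numClosedFieldType) A of GRing.Algebra C A := {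
  star : A -> A;
  starK : involutive star;
  starD : {morph star : x y / x + y};
  starZ : forall (c : C) (x : A), star (c *: x) = Num.conj c *: star x;
  starM : forall x y : A, star (x * y) = star y * star x
}.

#[short(type="starAlgType")]
HB.structure Definition StarAlgebra (C : numClosedFieldType) :=
  {A of GRing.Algebra C A & hasStar C A}.

(* The norm is not inherited from normedModType because Hierarchy Builder     *)
(* cannot join rings and normed modules below numDomainType. As there, it is  *)
(* C-valued, and its nonnegativity follows from anormD and anormZ.            *)
HB.mixin Record isNormedStar (C : numClosedFieldType) A of StarAlgebra C A := {
  anorm : A -> C;
  anormD : forall x y : A, anorm (x + y) <= anorm x + anorm y;
  anormZ : forall (c : C) (x : A), anorm (c *: x) = `|c| * anorm x;
  anorm0_eq0 : forall x : A, anorm x = 0 -> x = 0;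
  anormM : forall x y : A, anorm (x * y) <= anorm x * anorm y;
  anorm_star : forall x : A, anorm (star x) = anorm x
}.

#[short(type="normedStarAlgType")]
HB.structure Definition NormedStarAlgebra (C : numClosedFieldType) :=
  {A of StarAlgebra C A & isNormedStar C A}.

Definition anorm_cauchy (C : numClosedFieldType) (A : normedStarAlgType C)
    (u : nat -> A) : Prop :=
  forall e : C, 0 < e -> exists n0 : nat, forall m n : nat,
    (n0 <= m)%N -> (n0 <= n)%N -> anorm (u m - u n) < e.

Definition anorm_cvg (C : numClosedFieldType) (A : normedStarAlgType C)
    (u : nat -> A) (l : A) : Prop :=
  forall e : C, 0 < e -> exists n0 : nat, forall n : nat,
    (n0 <= n)%N -> anorm (u n - l) < e.

HB.mixin Record isCStar (C : numClosedFieldType) A of NormedStarAlgebra C A := {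
  anorm_complete : forall u : nat -> A,
    anorm_cauchy u -> exists l : A, anorm_cvg u l;
  anorm_starM : forall x : A, anorm (star x * x) = anorm x ^+ 2
}.

#[short(type="cstarAlgType")]
HB.structure Definition CStarAlgebra (C : numClosedFieldType) :=
  {A of NormedStarAlgebra C A & isCStar C A}.

Definition star_morphism (C : numClosedFieldType) (A B : starAlgType C)
    (f : A -> B) : Prop := {morph f : x / star x}.

Definition contractive (C : numClosedFieldType) (A B : normedStarAlgType C)
    (f : A -> B) : Prop := forall x, anorm (f x) <= anorm x.

(* E, with iota, is the universal enveloping C*-algebra of A. As A is unital, *)
(* so is E, and *-algebras and *-homomorphisms are unital throughout. Any     *)
(* *-homomorphism between C*-algebras is contractive, so that this is not     *)
(* required of F.                                                             *)
Record is_enveloping (C : numClosedFieldType) (A : normedStarAlgType C)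
    (E : cstarAlgType C) (iota : {lrmorphism A -> E}) : Prop := {
  env_star : star_morphism iota;
  env_contractive : contractive iota;
  env_ex : forall (B : cstarAlgType C) (f : {lrmorphism A -> B}),
    star_morphism f -> contractive f ->
    exists F : {lrmorphism E -> B}, star_morphism F /\ F \o iota =1 f;
  env_uniq : forall (B : cstarAlgType C) (F1 F2 : {lrmorphism E -> B}),
    star_morphism F1 -> star_morphism F2 ->
    F1 \o iota =1 F2 \o iota -> F1 =1 F2
}.

Definition projection (C : numClosedFieldType) (A : starAlgType C)
    (p : A) : Prop := star p = p /\ p * p = p.

Definition no_nontrivial_projections (C : numClosedFieldType)
    (A : starAlgType C) : Prop :=
  forall p : A, projection p -> p = 0 \/ p = 1.

(* {malg C[G]} is the C-vector space of finitely supported functions G -> C;  *)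
(* << c *g x >> is c \delta_x and f@_x is the coefficient of f at x.          *)
Definition group_algebra (C : numClosedFieldType) (G : groupType) : Type :=
  {malg C[G]}.

Section GroupAlgebra.
Context (C : numClosedFieldType) (G : groupType).
Local Notation CG := (group_algebra C G).

HB.instance Definition _ := GRing.Lmodule.copy CG {malg C[G]}.

Implicit Types (f g h : CG) (x y : G) (c : C).

Local Notation delta c x := (mkmalgU x c : CG).

Definition ga_one : CG := delta 1 1%g.

Definition ga_mul f g : CG :=
  \sum_(x <- msupp f) \sum_(y <- msupp g) delta (f@_x * g@_y) (x * y)%g.

Definition ga_star f : CG :=
  \sum_(x <- msupp f) delta (Num.conj f@_x) (x^-1)%g.

Definition ga_norm f : C := \sum_(x <- msupp f) `|f@_x|.

Lemma ga_expand f : f = \sum_(x <- msupp f) delta f@_x x.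
Proof. exact: (@monalgE G C f). Qed.

Lemma ga_mulw (d1 d2 : {fset G}) f g :
  (msupp f `<=` d1)%fset -> (msupp g `<=` d2)%fset ->
  ga_mul f g = \sum_(x <- d1) \sum_(y <- d2) delta (f@_x * g@_y) (x * y)%g.
Proof.
move=> le1 le2; rewrite /ga_mul (big_fset_incl _ le1) /=.
  apply/eq_bigr => x _; apply/big_fset_incl => // y _ /mcoeff_outdom ->.
  by rewrite mulr0 monalgU0.
move=> x _ /mcoeff_outdom fx.
by rewrite big1 // => y _; rewrite fx mul0r monalgU0.
Qed.

Lemma ga_mul0 : left_zero 0 ga_mul.
Proof. by move=> f; rewrite /ga_mul msupp0 big_seq_fset0. Qed.

Lemma ga_mulr0 : right_zero 0 ga_mul.
Proof.
by move=> f; rewrite /ga_mul big1 // => x _; rewrite msupp0 big_seq_fset0.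
Qed.

Lemma ga_mulDl : left_distributive ga_mul +%R.
Proof.
move=> f g h; rewrite (@ga_mulw (msupp f `|` msupp g)%fset (msupp h)) //.
- rewrite (@ga_mulw (msupp f `|` msupp g)%fset (msupp h) f) ?fsubsetUl //.
  rewrite (@ga_mulw (msupp f `|` msupp g)%fset (msupp h) g) ?fsubsetUr //.
  rewrite -big_split /=; apply/eq_bigr => x _.
  rewrite -big_split /=; apply/eq_bigr => y _.
  by rewrite mcoeffD mulrDl monalgUD.
- exact: msuppD_le.
Qed.

Lemma ga_mulDr : right_distributive ga_mul +%R.
Proof.
move=> h f g; rewrite (@ga_mulw (msupp h) (msupp f `|` msupp g)%fset) //.
- rewrite (@ga_mulw (msupp h) (msupp f `|` msupp g)%fset _ f) ?fsubsetUl //.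
  rewrite (@ga_mulw (msupp h) (msupp f `|` msupp g)%fset _ g) ?fsubsetUr //.
  rewrite -big_split /=; apply/eq_bigr => x _.
  rewrite -big_split /=; apply/eq_bigr => y _.
  by rewrite mcoeffD mulrDr monalgUD.
- exact: msuppD_le.
Qed.

Lemma ga_mulUU c1 c2 x y :
  ga_mul (delta c1 x) (delta c2 y) = delta (c1 * c2) (x * y)%g.
Proof.
by rewrite (ga_mulw msuppU_le msuppU_le) !big_seq_fset1 !mcoeffUU.
Qed.

Lemma ga_mul_suml I (r : seq I) (F : I -> CG) g :
  ga_mul (\sum_(i <- r) F i) g = \sum_(i <- r) ga_mul (F i) g.
Proof.
exact: (big_morph (ga_mul^~ g) (fun _ _ => ga_mulDl _ _ _) (ga_mul0 _)).
Qed.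

Lemma ga_mul_sumr I (r : seq I) (F : I -> CG) g :
  ga_mul g (\sum_(i <- r) F i) = \sum_(i <- r) ga_mul g (F i).
Proof.
exact: (big_morph (ga_mul g) (fun _ _ => ga_mulDr _ _ _) (ga_mulr0 _)).
Qed.

Lemma ga_mulA : associative ga_mul.
Proof.
move=> f g h; rewrite (ga_expand f) !ga_mul_suml; apply/eq_bigr => x _.
rewrite (ga_expand g) ga_mul_suml !ga_mul_sumr ga_mul_suml.
apply/eq_bigr => y _; rewrite (ga_expand h) !ga_mul_sumr.
by apply/eq_bigr => z _; rewrite !ga_mulUU mulrA mulgA.
Qed.

Lemma ga_mul1 : left_id ga_one ga_mul.
Proof.
move=> f; rewrite {1}(ga_expand f) ga_mul_sumr [RHS]ga_expand.
by apply/eq_bigr => x _; rewrite ga_mulUU mul1r mul1g.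
Qed.

Lemma ga_mulr1 : right_id ga_one ga_mul.
Proof.
move=> f; rewrite {1}(ga_expand f) ga_mul_suml [RHS]ga_expand.
by apply/eq_bigr => x _; rewrite ga_mulUU mulr1 mulg1.
Qed.

Lemma ga_one_neq0 : ga_one != 0.
Proof.
by apply/eqP => /malgP /(_ 1%g) /eqP; rewrite mcoeffUU mcoeff0 oner_eq0.
Qed.

HB.instance Definition _ := GRing.Zmodule_isNzRing.Build CG
  ga_mulA ga_mul1 ga_mulr1 ga_mulDl ga_mulDr ga_one_neq0.

Lemma ga_scaleU c a x : c *: delta a x = delta (c * a) x.
Proof. by apply/malgP => y; rewrite mcoeffZ !mcoeffU mulrnAr. Qed.

Lemma ga_scaleAl c f g : c *: (f * g) = c *: f * g.
Proof.
change (c *: ga_mul f g = ga_mul (c *: f) g).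
rewrite (ga_expand f) ga_mul_suml !scaler_sumr ga_mul_suml.
apply/eq_bigr => x _; rewrite (ga_expand g) !ga_mul_sumr scaler_sumr.
by apply/eq_bigr => y _; rewrite ga_scaleU !ga_mulUU ga_scaleU mulrA.
Qed.

Lemma ga_scaleAr c f g : c *: (f * g) = f * (c *: g).
Proof.
change (c *: ga_mul f g = ga_mul f (c *: g)).
rewrite (ga_expand f) !ga_mul_suml scaler_sumr.
apply/eq_bigr => x _; rewrite (ga_expand g) ga_mul_sumr !scaler_sumr ga_mul_sumr.
by apply/eq_bigr => y _; rewrite ga_scaleU !ga_mulUU ga_scaleU mulrCA.
Qed.

HB.instance Definition _ :=
  GRing.LSemiModule_isLSemiAlgebra.Build C CG ga_scaleAl.
HB.instance Definition _ :=
  GRing.LSemiAlgebra_isSemiAlgebra.Build C CG ga_scaleAr.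

Lemma ga_normw (d : {fset G}) f :
  (msupp f `<=` d)%fset -> ga_norm f = \sum_(x <- d) `|f@_x|.
Proof.
move=> le; apply/big_fset_incl => // x _ /mcoeff_outdom ->.
by rewrite normr0.
Qed.

Lemma ga_normD f g : ga_norm (f + g) <= ga_norm f + ga_norm g.
Proof.
rewrite (@ga_normw (msupp f `|` msupp g)%fset) ?msuppD_le //.
rewrite (@ga_normw (msupp f `|` msupp g)%fset f) ?fsubsetUl //.
rewrite (@ga_normw (msupp f `|` msupp g)%fset g) ?fsubsetUr //.
rewrite -big_split /=; apply: ler_sum => x _.
by rewrite mcoeffD ler_normD.
Qed.

Lemma ga_normZ c f : ga_norm (c *: f) = `|c| * ga_norm f.
Proof.
rewrite (@ga_normw (msupp f)) ?msuppZ_le // /ga_norm mulr_sumr.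
by apply/eq_bigr => x _; rewrite mcoeffZ normrM.
Qed.

Lemma ga_norm0_eq0 f : ga_norm f = 0 -> f = 0.
Proof.
move=> f0; apply/malgP => x; rewrite mcoeff0.
have [xf|/mcoeff_outdom //] := boolP (x \in msupp f).
move/eqP: f0; rewrite /ga_norm (big_fsetD1 x) //= paddr_eq0 //.
  by rewrite normr_eq0 => /andP[/eqP].
exact: sumr_ge0.
Qed.

Lemma ga_normU c x : ga_norm (delta c x) = `|c|.
Proof. by rewrite (ga_normw msuppU_le) big_seq_fset1 mcoeffUU. Qed.

Lemma ga_norm_sum I (r : seq I) (F : I -> CG) :
  ga_norm (\sum_(i <- r) F i) <= \sum_(i <- r) ga_norm (F i).
Proof.
elim/big_rec2: _ => [|i c f _ le_fc].
  by rewrite /ga_norm msupp0 big_seq_fset0.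
by rewrite (le_trans (ga_normD _ _)) // lerD2l.
Qed.

Lemma ga_normM f g : ga_norm (f * g) <= ga_norm f * ga_norm g.
Proof.
apply: (le_trans (ga_norm_sum _ _)).
rewrite [leRHS]big_distrlr /=; apply: ler_sum => x _.
apply: (le_trans (ga_norm_sum _ _)); apply: ler_sum => y _.
by rewrite ga_normU normrM.
Qed.

Lemma ga_starE f x : (ga_star f)@_x = Num.conj (f@_(x^-1)%g).
Proof.
rewrite /ga_star raddf_sum /=.
have [xf|xNf] := boolP ((x^-1)%g \in msupp f).
  rewrite (big_fsetD1 _ xf) /= mcoeffU invgK eqxx mulr1n big1_fset ?addr0 //.
  move=> y; rewrite in_fsetD1 => /andP[yx _] _.
  rewrite mcoeffU; case: eqP => // yVx.
  by rewrite -yVx invgK eqxx in yx.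
rewrite (mcoeff_outdom xNf) rmorph0 big1_fset // => y yf _.
rewrite mcoeffU; case: eqP => // yx; move: xNf.
by rewrite -yx invgK yf.
Qed.

Lemma ga_starK : involutive ga_star.
Proof. by move=> f; apply/malgP => x; rewrite !ga_starE invgK conjCK. Qed.

Lemma ga_starD : {morph ga_star : f g / f + g}.
Proof.
by move=> f g; apply/malgP => x; rewrite mcoeffD !ga_starE mcoeffD rmorphD.
Qed.

Lemma ga_starZ c f : ga_star (c *: f) = Num.conj c *: ga_star f.
Proof.
by apply/malgP => x; rewrite mcoeffZ !ga_starE mcoeffZ rmorphM.
Qed.

Lemma ga_starU c x : ga_star (delta c x) = delta (Num.conj c) (x^-1)%g.
Proof.
apply/malgP => y; rewrite ga_starE !mcoeffU -(inj_eq invg_inj) invgK.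
by case: (_ == y); rewrite ?rmorph0.
Qed.

Lemma ga_star0 : ga_star 0 = 0.
Proof. by rewrite /ga_star msupp0 big_seq_fset0. Qed.

Lemma ga_starM f g : ga_star (f * g) = ga_star g * ga_star f.
Proof.
have sumS I (r : seq I) (F : I -> CG) :
    ga_star (\sum_(i <- r) F i) = \sum_(i <- r) ga_star (F i).
  exact: (big_morph ga_star ga_starD ga_star0).
rewrite (ga_expand f) (ga_expand g).
rewrite mulr_suml !sumS mulr_sumr; apply/eq_bigr => x _.
rewrite mulr_sumr sumS mulr_suml; apply/eq_bigr => y _.
rewrite [delta _ _ * _]ga_mulUU !ga_starU [RHS]ga_mulUU.
by rewrite rmorphM mulrC invgM.
Qed.

Lemma ga_norm_star f : ga_norm (ga_star f) = ga_norm f.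
Proof.
have le_star g : ga_norm (ga_star g) <= ga_norm g.
  apply: (le_trans (ga_norm_sum _ _)); apply: ler_sum => x _.
  by rewrite ga_normU norm_conjC.
by apply/eqP; rewrite eq_le le_star -{1}[f]ga_starK le_star.
Qed.

HB.instance Definition _ := hasStar.Build C CG
  ga_starK ga_starD ga_starZ ga_starM.
HB.instance Definition _ := isNormedStar.Build C CG
  ga_normD ga_normZ ga_norm0_eq0 ga_normM ga_norm_star.

End GroupAlgebra.

Definition is_full_group_cstar (C : numClosedFieldType) (G : groupType)
    (E : cstarAlgType C) (iota : {lrmorphism group_algebra C G -> E}) : Prop :=
  is_enveloping iota.

(* Main.v *)
Require Import Defs.
From HB Require Import structures.
From mathcomp Require Import all_boot all_order all_algebra.
From mathcomp Require Import generic_quotient finmap complex.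
From mathcomp.multinomials Require Import monalg.
From mathcomp Require Import all_classical all_reals all_analysis.
From mathcomp Require Import ring lra.

(* It is enough to show that a projection p in the kernel of P : C*(G) -> C*(H)
   vanishes, for then so does 1 - p if P p = 1. Let T be the expectation of
   C*(G) onto C*(N), which fixes delta_g for g in N and kills it otherwise. Then
   c = T p is central, 0 <= c <= 1, and d = 1 - c satisfies ||d^k c|| <= 1 / k.
   As H is amenable, p is approximated by
     M p = sum_(k, l) xi_k xi_l s_k T (s_k^-1 p s_l) s_l^-1
   for finitely supported unit vectors xi of l^2(H) and a section s of G -> H,
   and the Cauchy-Schwarz inequality for T bounds d^m times a summand by a
   multiple of ||d^(2m) c||^(1/2). Hence ||d^m p|| <= 1/2 for some m; put
   b = d^m. Then ||b^j c|| <= ||b^j p|| <= 2^-j, so that b^j converges to a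
   projection e in C*(N) with e p = 0. The dual of the torsion-free group N is
   connected, so that e = 0 or e = 1. If e = 1, then p = 0. The case e = 0 is
   excluded by P (b^j) = 1, which holds as P c is the image of P p = 0 under the
   canonical trace of C*(H).
   The maps T and M are obtained by compressing operators on the Hilbert
   C*(G)-module l^2(H, C*(G)), so that neither states nor the GNS construction
   are needed. *)

Set Implicit Arguments.
Unset Strict Implicit.
Unset Printing Implicit Defensive.

Import Order.TTheory GRing.Theory Num.Theory.
Import numFieldNormedType.Exports.

Local Open Scope ring_scope.
Local Open Scope complex_scope.

Import Normc.

(** The bound ||d^k c|| <= 1 / k reflects that (1 - x)^k x <= 1 / k on [0, 1]; it is not summable
    and does not by itself make the powers of d converge in norm. The gain comes from idempotence:
    once a single b satisfies ||b p|| <= 1 / 2, centrality gives b^j p = (b p)^j, hence geometric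
    decay, and 1 - b = c (1 + d + ... + d^(m-1)) turns this into convergence of b^j. Morally e is
    the spectral projection of c at 0. Smallness of T (d^k p) says nothing about d^k p unless T is
    faithful in a quantitative way; amenability supplies this, as M p is a finite sum of terms
    controlled by T alone. The sum is fixed before m is chosen, since its total weight enters the
    choice of m. Positivity is defined by a norm inequality and square roots come from an explicit
    iteration, which together take the place of the spectrum and of continuous functional calculus.
    Connectedness of the dual is used through homomorphisms phi : N -> R: the characters exp(i pi t
    phi) join the trivial one to one that takes the value -1 at a given n <> 1. *)

Section StarTheory.
Context (C : numClosedFieldType) (A : starAlgType C).
Implicit Types x y : A.

Lemma star0 : star (0 : A) = 0.
Proof. by apply: (addrI (star (0 : A))); rewrite -starD !addr0. Qed.

Lemma starN x : star (- x) = - star x.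
Proof. by apply: (addrI (star x)); rewrite -starD !subrr star0. Qed.

Lemma starB x y : star (x - y) = star x - star y.
Proof. by rewrite starD starN. Qed.

Lemma star1 : star (1 : A) = 1.
Proof. by have := starM (star (1 : A)) 1; rewrite mulr1 starK mulr1. Qed.

Lemma star_sum I (r : seq I) (P : pred I) (F : I -> A) :
  star (\sum_(i <- r | P i) F i) = \sum_(i <- r | P i) star (F i).
Proof. exact: (big_morph star (@starD _ A) star0). Qed.

Lemma starX x n : star (x ^+ n) = star x ^+ n.
Proof. by elim: n => [|n IH]; rewrite ?expr0 ?star1 // exprS starM IH -exprSr. Qed.

End StarTheory.

(** * Norms and convergence *)

Section Norm.
Context (R : realType) (A : normedStarAlgType R[i]).
Implicit Types (x y : A) (c : R[i]) (r : R).

(** [anorm] takes values in [R[i]], where the order is only partial; its real part loses nothing, by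
    [anormE], and lies in an ordered field. *)
Definition nm x : R := complex.Re (anorm x).

Lemma anorm0 : anorm (0 : A) = 0.
Proof. by rewrite -(scale0r (0 : A)) anormZ normr0 mul0r. Qed.

Lemma anormN x : anorm (- x) = anorm x.
Proof. by rewrite -scaleN1r anormZ normrN1 mul1r. Qed.

Lemma anorm_ge0 x : 0 <= anorm x.
Proof.
have := anormD x (- x); rewrite subrr anorm0 anormN -mulr2n.
by rewrite pmulrn_lge0.
Qed.

Lemma anormE x : anorm x = (nm x)%:C.
Proof. by rewrite /nm RRe_real // ger0_real // anorm_ge0. Qed.

Lemma nm_ge0 x : 0 <= nm x.
Proof. by rewrite -ler0c -anormE anorm_ge0. Qed.

Lemma nm0 : nm 0 = 0.
Proof. by rewrite /nm anorm0. Qed.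

Lemma nmN x : nm (- x) = nm x.
Proof. by rewrite /nm anormN. Qed.

Lemma nmD x y : nm (x + y) <= nm x + nm y.
Proof. by rewrite -lecR rmorphD /= -!anormE anormD. Qed.

Lemma nmB x y : nm (x - y) <= nm x + nm y.
Proof. by rewrite -(nmN y) nmD. Qed.

Lemma nm_subC x y : nm (x - y) = nm (y - x).
Proof. by rewrite -nmN opprB. Qed.

Lemma nm_dist x y z : nm (x - z) <= nm (x - y) + nm (y - z).
Proof. by rewrite (le_trans _ (nmD _ _)) // addrA subrK. Qed.

Lemma nmZ c x : nm (c *: x) = normc c * nm x.
Proof.
by apply: (@complexI R); rewrite rmorphM /= -!anormE anormZ.
Qed.

Lemma normcR r : normc (r%:C) = `|r|.
Proof. by rewrite /= expr0n /= addr0 sqrtr_sqr. Qed.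

Lemma nmZr r x : nm (r%:C *: x) = `|r| * nm x.
Proof. by rewrite nmZ normcR. Qed.

Lemma nmM x y : nm (x * y) <= nm x * nm y.
Proof. by rewrite -lecR rmorphM /= -!anormE anormM. Qed.

Lemma nm_star x : nm (star x) = nm x.
Proof. by rewrite /nm anorm_star. Qed.

Lemma nm0_eq0 x : nm x = 0 -> x = 0.
Proof. by move=> x0; apply: anorm0_eq0; rewrite anormE x0. Qed.

Lemma nm_le0 x : nm x <= 0 -> x = 0.
Proof. by move=> x0; apply: nm0_eq0; apply/eqP; rewrite eq_le x0 nm_ge0. Qed.

Lemma nm_small x : (forall e, 0 < e -> nm x <= e) -> x = 0.
Proof.
move=> h; apply: nm_le0; apply/ler_addgt0Pr => e e0; rewrite add0r; exact: h.
Qed.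

Lemma nm_sum I (s : seq I) (P : pred I) (F : I -> A) :
  nm (\sum_(i <- s | P i) F i) <= \sum_(i <- s | P i) nm (F i).
Proof.
elim/big_rec2: _ => [|i a b _ le_ab]; first by rewrite nm0.
by rewrite (le_trans (nmD _ _)) // lerD2l.
Qed.

Lemma nmX x n : nm (x ^+ n.+1) <= nm x ^+ n.+1.
Proof.
elim: n => [|n IH]; first by rewrite !expr1.
rewrite exprS [leRHS]exprS; apply: (le_trans (nmM _ _)).
by apply: ler_wpM2l => //; exact: nm_ge0.
Qed.

(** Non-strict inequalities and real tolerances suit linear arithmetic over [R]; [conv_anorm]
    identifies this notion with [anorm_cvg]. *)
Definition conv (u : nat -> A) (l : A) := forall e : R, 0 < e ->
  exists n0, forall n, (n0 <= n)%N -> nm (u n - l) <= e.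

Lemma conv_uniq u l1 l2 : conv u l1 -> conv u l2 -> l1 = l2.
Proof.
move=> h1 h2; apply/eqP; rewrite -subr_eq0; apply/eqP/nm_small => e e0.
have e20 : 0 < e / 2 by rewrite divr_gt0.
have [n1 hn1] := h1 _ e20; have [n2 hn2] := h2 _ e20.
pose n := maxn n1 n2.
have := hn1 n (leq_maxl _ _); have := hn2 n (leq_maxr _ _).
have := nm_dist l1 (u n) l2; rewrite (nm_subC l1 (u n)); lra.
Qed.

Lemma conv_eq u v l : u =1 v -> conv u l -> conv v l.
Proof.
by move=> uv h e /h[n0 hn]; exists n0 => n; rewrite -uv => /hn.
Qed.

Lemma conv_cst l : conv (fun=> l) l.
Proof. by move=> e e0; exists 0%N => n _; rewrite subrr nm0 ltW. Qed.

Lemma convD u v l m : conv u l -> conv v m -> conv (fun n => u n + v n) (l + m).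
Proof.
move=> hu hv e e0; have e20 : 0 < e / 2 by rewrite divr_gt0.
have [n1 hn1] := hu _ e20; have [n2 hn2] := hv _ e20.
exists (maxn n1 n2) => n; rewrite geq_max => /andP[/hn1 h1 /hn2 h2].
rewrite opprD addrACA; have := nmD (u n - l) (v n - m); lra.
Qed.

(** Written with [complex.Re (anorm _)] because [nm] is tied to [A] inside the section; [conv_map]
    restates it. *)
Lemma conv_lip (B : normedStarAlgType R[i]) u l (f : A -> B) (K : R)
  : conv u l -> (forall x y, complex.Re (anorm (f x - f y)) <= K * nm (x - y)) ->
  forall e, 0 < e -> exists n0, forall n, (n0 <= n)%N ->
    complex.Re (anorm (f (u n) - f l)) <= e.
Proof.
move=> hu hf e e0.
have K0 : 0 < `|K| + 1 by rewrite ltr_wpDl.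
have [n0 hn] := hu (e / (`|K| + 1)) (divr_gt0 e0 K0).
exists n0 => n /hn; rewrite ler_pdivlMr // => h.
apply: (le_trans (hf _ _)); apply: le_trans h; rewrite mulrC.
by rewrite ler_wpM2l ?nm_ge0 // (le_trans (ler_norm _)) // lerDl.
Qed.

Lemma nm_conv_le u l r : conv u l -> (forall n, nm (u n) <= r) -> nm l <= r.
Proof.
move=> hu hr; apply/ler_addgt0Pr => e e0; have [n0 hn] := hu _ e0.
have := hn _ (leqnn _); have := hr n0; have := nmB (u n0) (u n0 - l).
rewrite opprB addrC subrK; lra.
Qed.

End Norm.

Lemma conv_map (R : realType) (A B : normedStarAlgType R[i]) (u : nat -> A) l
  (f : A -> B) (K : R) :
  conv u l -> (forall x y, nm (f x - f y) <= K * nm (x - y)) ->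
  conv (fun n => f (u n)) (f l).
Proof. by move=> hu hf e e0; apply: (conv_lip hu hf). Qed.

Section NormConv.
Context (R : realType) (A : normedStarAlgType R[i]).
Implicit Types (x y : A) (c : R[i]) (r : R) (u v : nat -> A).

Lemma convZ c u l : conv u l -> conv (fun n => c *: u n) (c *: l).
Proof.
move=> hu; apply: (conv_map (K := normc c) hu) => x y.
by rewrite -scalerBr nmZ.
Qed.

Lemma convN u l : conv u l -> conv (fun n => - u n) (- l).
Proof.
move=> /(convZ (-1)); rewrite scaleN1r; apply: conv_eq => n.
by rewrite scaleN1r.
Qed.

Lemma convMl x u l : conv u l -> conv (fun n => x * u n) (x * l).
Proof.
move=> hu; apply: (conv_map (f := *%R x) (K := nm x) hu) => y z /=.
by rewrite -mulrBr nmM.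
Qed.

Lemma convMr x u l : conv u l -> conv (fun n => u n * x) (l * x).
Proof.
move=> hu; apply: (conv_map (f := *%R^~ x) (K := nm x) hu) => y z /=.
by rewrite -mulrBl [leRHS]mulrC nmM.
Qed.

Lemma conv_star u l : conv u l -> conv (fun n => star (u n)) (star l).
Proof.
move=> hu; apply: (conv_map (K := 1) hu) => y z.
by rewrite -starB nm_star mul1r.
Qed.

Lemma conv_bound u l : conv u l ->
  exists K, forall n, nm (u n) <= K.
Proof.
move=> /(_ 1 ltr01)[n0 hn].
exists (nm l + 1 + \sum_(i < n0) nm (u i)) => n.
have [h|h] := ltnP n n0.
  rewrite (bigD1 (Ordinal h)) //=.
  have : 0 <= \sum_(i < n0 | i != Ordinal h) nm (u i).
    by apply: sumr_ge0 => i _; exact: nm_ge0.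
  have := nm_ge0 l; lra.
have : 0 <= \sum_(i < n0) nm (u i) by apply: sumr_ge0 => i _; exact: nm_ge0.
have := hn _ h; have := nmD (u n - l) l; rewrite subrK; lra.
Qed.

Lemma convM u v l m : conv u l -> conv v m -> conv (fun n => u n * v n) (l * m).
Proof.
move=> hu hv; have [K hK] := conv_bound hu.
have h1 : conv (fun n => u n * m) (l * m) by exact: convMr.
have h2 : conv (fun n => u n * (v n - m)) 0.
  move=> e e0; have K0 : 0 < `|K| + 1 by rewrite ltr_wpDl.
  have [n0 hn] := hv _ (divr_gt0 e0 K0).
  exists n0 => n /hn; rewrite ler_pdivlMr // subr0 mulrC => h.
  apply: (le_trans (nmM _ _)); apply: le_trans h.
  rewrite ler_wpM2r ?nm_ge0 // (le_trans (hK n)) // (le_trans (ler_norm _)) //.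
  by rewrite lerDl.
have := convD h1 h2; rewrite addr0; apply: conv_eq => n.
by rewrite mulrBr addrC subrK.
Qed.

Definition nm_cauchy u := forall e : R, 0 < e ->
  exists n0, forall m n, (n0 <= m)%N -> (n0 <= n)%N -> nm (u m - u n) <= e.

Lemma cauchy_anorm u : nm_cauchy u <-> anorm_cauchy u.
Proof.
split=> h e e0.
  have : e \is Num.real by rewrite ger0_real // ltW.
  move/RRe_real => eE; rewrite -eE in e0 *.
  have e0' : 0 < complex.Re e / 2 by rewrite divr_gt0 // -ltcR.
  have [n0 hn] := h _ e0'; exists n0 => m n hm hn'.
  rewrite anormE ltcR (le_lt_trans (hn _ _ hm hn')) //; lra.
have e0' : 0 < e%:C by rewrite ltcR.
have [n0 hn] := h _ e0'; exists n0 => m n hm hn'.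
by have := hn _ _ hm hn'; rewrite anormE ltcR => /ltW.
Qed.

Lemma conv_anorm u l : conv u l <-> anorm_cvg u l.
Proof.
split=> h e e0.
  have : e \is Num.real by rewrite ger0_real // ltW.
  move/RRe_real => eE; rewrite -eE in e0 *.
  have e0' : 0 < complex.Re e / 2 by rewrite divr_gt0 // -ltcR.
  have [n0 hn] := h _ e0'; exists n0 => n hn'.
  rewrite anormE ltcR (le_lt_trans (hn _ hn')) //; lra.
have e0' : 0 < e%:C by rewrite ltcR.
have [n0 hn] := h _ e0'; exists n0 => n hn'.
by have := hn _ hn'; rewrite anormE ltcR => /ltW.
Qed.

End NormConv.

Section CStar.
Context (R : realType) (A : cstarAlgType R[i]).
Implicit Types (x y : A) (c : R[i]) (r : R) (u v : nat -> A).

Lemma nm_starM x : nm (star x * x) = nm x ^+ 2.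
Proof.
by apply: (@complexI R); rewrite rmorphXn /= -!anormE anorm_starM.
Qed.

Lemma nm_Mstar x : nm (x * star x) = nm x ^+ 2.
Proof. by rewrite -{1}(starK x) nm_starM nm_star. Qed.

Lemma nm1 : nm (1 : A) = 1.
Proof.
have := nm_starM 1; rewrite star1 mulr1 expr2 => h.
have : nm (1 : A) * (nm (1 : A) - 1) = 0 by rewrite mulrBr -h; ring.
move/eqP; rewrite mulf_eq0 subr_eq0 => /orP[]/eqP // /nm0_eq0 /eqP.
by rewrite oner_eq0.
Qed.

Lemma nm_scal r : nm (r%:C *: (1 : A)) = `|r|.
Proof. by rewrite nmZr nm1 mulr1. Qed.

Lemma nmX_le x n : nm (x ^+ n) <= nm x ^+ n.
Proof. by case: n => [|n]; rewrite ?expr0 ?nm1 // nmX. Qed.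

Lemma nm_complete u : nm_cauchy u -> exists l, conv u l.
Proof. by move=> /cauchy_anorm /anorm_complete[l /conv_anorm hl]; exists l. Qed.

Definition sa x := star x = x.

Lemma unitary_nm x : star x * x = 1 -> nm x = 1.
Proof.
move=> h; have := nm_starM x; rewrite h nm1 => /esym/eqP.
by rewrite sqrf_eq1 => /orP[]/eqP // h1; have := nm_ge0 x; rewrite h1 ler0N1.
Qed.

End CStar.

(** The increments of [a] dominate norms, so [a] is nondecreasing; being bounded, it comes within e
    / 2 of its supremum, and from there on [u] moves by at most e / 2. *)
Lemma dominated_cauchy (R : realType) (A : normedStarAlgType R[i])
    (u : nat -> A) (a : nat -> R) (K : R) :
  (forall n, a n <= K) -> (forall n, nm (u n.+1 - u n) <= a n.+1 - a n) ->
  nm_cauchy u.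
Proof.
move=> aK ua.
have amn k n : nm (u (n + k)%N - u n) <= a (n + k)%N - a n.
  elim: k => [|k IH]; first by rewrite addn0 !subrr nm0.
  rewrite addnS; have := nm_dist (u (n + k).+1) (u (n + k)%N) (u n).
  have := ua (n + k)%N; lra.
have ale k n : a n <= a (n + k)%N.
  by rewrite -subr_ge0 (le_trans (nm_ge0 _) (amn _ _)).
have hs : has_sup (range a).
  by split; [exists (a 0%N), 0%N | exists K => _ [n _ <-]].
move=> e e0; have e20 : 0 < e / 2 by rewrite divr_gt0.
have [_ [n0 _ <-] hn0] := sup_adherent e20 hs.
have near k : nm (u (n0 + k)%N - u n0) <= e / 2.
  rewrite (le_trans (amn _ _)) //.
  have : a (n0 + k)%N <= sup (range a) by apply: sup_upper_bound => //; exists (n0 + k)%N.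
  lra.
exists n0 => m n /subnKC <- /subnKC <-.
have := nm_dist (u (n0 + (m - n0))%N) (u n0) (u (n0 + (n - n0))%N).
rewrite (nm_subC (u n0)); have := near (m - n0)%N; have := near (n - n0)%N; lra.
Qed.

(** * Positive elements *)

Section SquareRoot.
Context (R : realType) (A : cstarAlgType R[i]).
Implicit Types (x y : A) (c : R[i]) (r t : R).

Lemma saD x y : sa x -> sa y -> sa (x + y).
Proof. by rewrite /sa starD => -> ->. Qed.

Lemma saN x : sa x -> sa (- x).
Proof. by rewrite /sa starN => ->. Qed.

Lemma saB x y : sa x -> sa y -> sa (x - y).
Proof. by move=> xs ys; apply: saD => //; exact: saN. Qed.

Lemma sa1 : sa (1 : A).
Proof. exact: star1. Qed.

Lemma sa0 : sa (0 : A).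
Proof. exact: star0. Qed.

Lemma saZ r x : sa x -> sa (r%:C *: x).
Proof. by rewrite /sa starZ => ->; rewrite conj_Creal // complex_real. Qed.

Lemma saX x n : sa x -> sa (x ^+ n).
Proof. by rewrite /sa starX => ->. Qed.

Lemma saM x y : sa x -> sa y -> GRing.comm x y -> sa (x * y).
Proof. by rewrite /sa starM => -> -> ->. Qed.

Lemma sa_starM x : sa (star x * x).
Proof. by rewrite /sa starM starK. Qed.

Lemma sa_conv (u : nat -> A) l : conv u l -> (forall n, sa (u n)) -> sa l.
Proof.
move=> hu us; apply: (@conv_uniq _ _ u) => //.
by apply: conv_eq (conv_star hu) => n; rewrite us.
Qed.

Lemma commrZ c x y : GRing.comm x y -> GRing.comm x (c *: y).
Proof. by move=> xy; rewrite /GRing.comm -scalerAr -scalerAl xy. Qed.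

Lemma comm_conv (u : nat -> A) l x :
  conv u l -> (forall n, GRing.comm x (u n)) -> GRing.comm x l.
Proof.
move=> hu hx; apply: (@conv_uniq _ _ (fun n => x * u n)).
  exact: convMl.
by apply: conv_eq (convMr x hu) => n; rewrite hx.
Qed.

Fixpoint sqrt_seq (B : algType R[i]) (x : B) n : B :=
  if n is m.+1 then (2^-1)%:C *: (x + sqrt_seq x m * sqrt_seq x m) else 0.

Fixpoint sqrt_bound n : R :=
  if n is m.+1 then 2^-1 * (1 + sqrt_bound m * sqrt_bound m) else 0.

Lemma sqrt_bound01 n : 0 <= sqrt_bound n <= 1.
Proof.
elim: n => [|n /andP[h0 h1]] /=; first by rewrite lexx ler01.
have : 0 <= sqrt_bound n * sqrt_bound n <= 1.
  by rewrite mulr_ge0 //= mulr_ile1.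
by move: (_ * sqrt_bound n) => b /andP[? ?]; apply/andP; split; lra.
Qed.

(* The fixed point y = (x + y^2) / 2 satisfies (1 - y)^2 = 1 - x; the         *)
(* iteration is dominated by the same iteration for the scalar x = 1.         *)
Lemma sqrt_1B x : sa x -> nm x <= 1 -> exists s, [/\ sa s, s * s = 1 - x,
  forall z, GRing.comm z x -> GRing.comm z s & nm (1 - s) <= 1].
Proof.
move=> xs x1; pose y := sqrt_seq x.
have ys n : sa (y n).
  elim: n => [|n IH] /=; first exact: sa0.
  by apply/saZ/saD => //; apply: saM.
have yc z n : GRing.comm z x -> GRing.comm z (y n).
  move=> zx; elim: n => [|n IH] /=; first exact: commr0.
  by apply/commrZ/commrD => //; exact: commrM.
have yy m n : GRing.comm (y m) (y n).
  by apply: (yc); apply: commr_sym; apply: (yc); exact: commr_refl.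
have yn n : nm (y n) <= sqrt_bound n.
  elim: n => [|n IH] /=; first by rewrite nm0.
  rewrite nmZr ger0_norm ?invr_ge0 // ler_wpM2l ?invr_ge0 //.
  rewrite (le_trans (nmD _ _)) // lerD // (le_trans (nmM _ _)) //.
  by apply: ler_pM => //; exact: nm_ge0.
have yd n : nm (y n.+1 - y n) <= sqrt_bound n.+1 - sqrt_bound n.
  elim: n => [|n IH].
    rewrite /y /= !mulr0 !subr0 !addr0 nmZr ger0_norm ?invr_ge0 //.
    by rewrite ler_wpM2l ?invr_ge0.
  (* A difference of squares, since the terms commute; the scalar iteration has the same form, so
     the domination is inherited. *)
  have -> : y n.+2 - y n.+1 =
      (2^-1)%:C *: ((y n.+1 - y n) * (y n.+1 + y n)).
    rewrite [in LHS]/y [in LHS]/= -!/(sqrt_seq x _) -/y -[X in _ - X]/(y n.+1).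
    rewrite -scalerBr opprD addrACA subrr add0r mulrDr !mulrBl.
    rewrite (yy n n.+1) addrA subrK //.
  have -> : sqrt_bound n.+2 - sqrt_bound n.+1 = 2^-1 *
      ((sqrt_bound n.+1 - sqrt_bound n) * (sqrt_bound n.+1 + sqrt_bound n)).
    by move=> /=; field.
  rewrite nmZr ger0_norm ?invr_ge0 // ler_wpM2l ?invr_ge0 //.
  rewrite (le_trans (nmM _ _)) // ler_pM ?nm_ge0 //.
  by rewrite (le_trans (nmD _ _)) // lerD.
have [l hl] : exists l, conv y l.
  apply/nm_complete/(dominated_cauchy (a := sqrt_bound) (K := 1)) => // n.
  by have /andP[] := sqrt_bound01 n.
have lE : l + l = x + l * l.
  have h1 : conv (fun n => y n.+1) l.
    by move=> e /hl[n0 hn]; exists n0 => n hn'; apply/hn/leqW.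
  have h2 : conv (fun n => y n.+1) ((2^-1)%:C *: (x + l * l)).
    by apply/convZ/convD; [exact: conv_cst | exact: convM].
  rewrite {1 2}(conv_uniq h1 h2) -scalerDl -rmorphD /=.
  have -> : 2^-1 + 2^-1 = 1 :> R by lra.
  by rewrite scale1r.
exists (1 - l); split.
- by apply: saB; [exact: sa1 | exact: sa_conv hl ys].
- have -> : x = l + l - l * l by rewrite lE addrK.
  rewrite mulrBl mul1r mulrBr mulr1 !opprB -addrA; congr (_ + _).
  by rewrite addrCA opprD.
- move=> z zx; apply: commrB; first exact: commr1.
  by apply: comm_conv hl _ => n; exact: yc.
- rewrite opprB addrCA subrr addr0.
  apply: nm_conv_le hl _ => n; apply: le_trans (yn n) _.
  by have /andP[] := sqrt_bound01 n.
Qed.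

End SquareRoot.

Section Positive.
Context (R : realType) (A : cstarAlgType R[i]).
Implicit Types (x y h s : A) (r t : R).

(* Among self-adjoint elements this says that the spectrum lies in [0, 2t].   *)
Definition pos x := sa x /\ exists2 t : R, 0 <= t & nm (t%:C%:A - x) <= t.

Lemma scale2r x : x + x = (2 : R)%:C *: x.
Proof. by rewrite rmorphD /= scalerDl scale1r. Qed.

Lemma sa_scal t : sa (t%:C%:A : A).
Proof. exact/saZ/sa1. Qed.

Lemma comm_scal t x : GRing.comm x (t%:C%:A).
Proof. by apply: commrZ; exact: commr1. Qed.

Lemma circleE h s : sa h -> sa s -> GRing.comm h s ->
  star (h + 'i%R *: s) * (h + 'i%R *: s) = h * h + s * s.
Proof.
move=> hs ss hc; rewrite starD starZ hs ss conjCi mulrDl !mulrDr.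
rewrite -!scalerAl -!scalerAr hc !scalerA mulNr -(expr2 'i%R) sqrCi opprK scale1r.
by rewrite scaleNr addrA addrK.
Qed.

(** The element u = h + i s satisfies u^* u = h^2 + s^2 = t, hence ||u||^2 = t, and 2 h = u + u^*
    gives ||h|| <= ||u||. This does the work of the spectral radius formula below. *)
Lemma circle_nm h s t : sa h -> sa s -> GRing.comm h s -> 0 <= t ->
  h * h + s * s = t%:C%:A -> nm h ^+ 2 <= t.
Proof.
move=> hs ss hc t0 E; set u := h + 'i%R *: s.
have u2 : nm u ^+ 2 = t.
  by rewrite -nm_starM circleE // E nm_scal ger0_norm.
rewrite -u2; apply: lerXn2r; rewrite ?nnegrE ?nm_ge0 //.
have hE : h + h = u + star u.
  by rewrite /u starD starZ hs ss conjCi scaleNr addrACA subrr addr0.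
have := nmD u (star u); rewrite -hE nm_star scale2r nmZr normr_nat; lra.
Qed.

(** After scaling to norm 1, 1 - h^2 has a square root s commuting with h, and [circle_nm] applied
    to s gives ||s^2|| <= 1. *)
Lemma sqr_nm h : sa h -> nm ((nm h ^+ 2)%:C%:A - h * h) <= nm h ^+ 2.
Proof.
move=> hs; have [h0|hN0] := eqVneq (nm h) 0.
  by rewrite h0 (nm0_eq0 h0) expr0n /= scale0r mul0r subr0 nm0.
have hgt : 0 < nm h by rewrite lt_def hN0 nm_ge0.
pose g := (nm h)^-1%:C *: h.
have gs : sa g by exact: saZ.
have g1 : nm g = 1 by rewrite nmZr ger0_norm ?invr_ge0 ?nm_ge0 // mulVf.
have ggs : sa (g * g) by apply: saM.
have [|s [ss sE sc _]] := sqrt_1B ggs.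
  by rewrite (le_trans (nmM _ _)) // g1 mulr1.
have gsC : GRing.comm g s by apply: (sc); exact: commrM.
have := circle_nm ss gs (commr_sym gsC) ler01.
rewrite sE subrK scale1r => /(_ erefl) s1.
have -> : (nm h ^+ 2)%:C%:A - h * h = (nm h ^+ 2)%:C *: (s * s).
  rewrite sE scalerBr; congr (_ - _).
  rewrite /g -scalerAl -scalerAr !scalerA -!rmorphM /=.
  have -> : nm h ^+ 2 * (nm h)^-1 / nm h = 1 by field.
  by rewrite scale1r.
rewrite nmZr ger0_norm ?exprn_ge0 ?nm_ge0 // ler_piMr ?exprn_ge0 ?nm_ge0 //.
by rewrite (le_trans (nmM _ _)).
Qed.

Lemma pos_sqr h : sa h -> pos (h * h).
Proof.
move=> hs; split; first exact: saM.
by exists (nm h ^+ 2); [rewrite exprn_ge0 ?nm_ge0 | exact: sqr_nm].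
Qed.

Lemma pos_ge_nm x t t' : nm (t%:C%:A - x) <= t -> t <= t' ->
  nm (t'%:C%:A - x) <= t'.
Proof.
move=> h tt.
have -> : t'%:C%:A - x = (t' - t)%:C%:A + (t%:C%:A - x).
  by rewrite rmorphB /= scalerBl addrA subrK.
rewrite (le_trans (nmD _ _)) // nm_scal ger0_norm ?subr_ge0 //; lra.
Qed.

Lemma pos0 : pos 0.
Proof. by split; [exact: sa0 | exists 0; rewrite ?scale0r ?subrr ?nm0]. Qed.

Lemma posD x y : pos x -> pos y -> pos (x + y).
Proof.
move=> [xs [t t0 ht]] [ys [r r0 hr]]; split; first exact: saD.
exists (t + r); first exact: addr_ge0.
rewrite rmorphD /= scalerDl opprD addrACA (le_trans (nmD _ _)) //.
exact: lerD.
Qed.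

Lemma posZ r x : 0 <= r -> pos x -> pos (r%:C *: x).
Proof.
move=> r0 [xs [t t0 ht]]; split; first exact: saZ.
exists (r * t); first exact: mulr_ge0.
by rewrite rmorphM /= -scalerA -scalerBr nmZr ger0_norm // ler_wpM2l.
Qed.

Lemma pos_sqrt x : pos x -> exists s, [/\ sa s, s * s = x, pos s &
  forall z, GRing.comm z x -> GRing.comm z s].
Proof.
move=> [xs [t t0 ht]]; have [tE|tN0] := eqVneq t 0.
  have -> : x = 0.
    by apply: nm_le0; move: ht; rewrite tE scale0r add0r nmN.
  exists 0; split; [exact: sa0 | exact: mul0r | exact: pos0 | move=> z _].
  exact: commr0.
have tgt : 0 < t by rewrite lt_def tN0.
pose y := 1 - t^-1%:C *: x.
have ys : sa y by apply: saB; [exact: sa1 | exact: saZ].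
have y1 : nm y <= 1.
  have -> : y = t^-1%:C *: (t%:C%:A - x).
    by rewrite scalerBr scalerA -rmorphM /= mulVf // scale1r.
  by rewrite nmZr ger0_norm ?invr_ge0 // mulrC ler_pdivrMr // mul1r.
have [s [ss sE sc s1]] := sqrt_1B ys y1.
exists ((Num.sqrt t)%:C *: s); split.
- exact: saZ.
- rewrite -scalerAl -scalerAr scalerA -rmorphM /= -expr2 sqr_sqrtr // sE.
  by rewrite opprB addrC subrK scalerA -rmorphM /= divff // scale1r.
- apply: posZ; first exact: sqrtr_ge0.
  by split => //; exists 1; rewrite ?scale1r.
- move=> z zx; apply/commrZ/sc/commrB; first exact: commr1.
  exact: commrZ.
Qed.

Lemma nm_sqr h : sa h -> nm (h * h) = nm h ^+ 2.
Proof. by move=> hs; rewrite -nm_starM hs. Qed.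

(** As x is a square, the bound t in [pos] can be taken to be ||x||. Bounds along a convergent
    sequence are then uniform, which makes [pos] closed under limits. *)
Lemma pos_nm x : pos x -> nm ((nm x)%:C%:A - x) <= nm x.
Proof.
by move=> /pos_sqrt[s [ss <- _ _]]; rewrite nm_sqr //; exact: sqr_nm.
Qed.

Lemma pos_conv (u : nat -> A) l : conv u l -> (forall n, pos (u n)) -> pos l.
Proof.
move=> hu up; split; first by apply: sa_conv hu _ => n; case: (up n).
have [K hK] := conv_bound hu.
exists K; first exact: le_trans (nm_ge0 _) (hK 0%N).
apply: (@nm_conv_le _ _ (fun n => K%:C%:A - u n)).
  by apply: convD; [exact: conv_cst | exact: convN].
by move=> n; apply: pos_ge_nm (pos_nm (up n)) (hK n).
Qed.

(** Commuting square roots of x and t - x lie on a circle of squared radius t, so [circle_nm]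
    applies. *)
Lemma pos_ge1B x t : 0 <= t -> pos x -> pos (t%:C%:A - x) -> nm x <= t.
Proof.
move=> t0 /pos_sqrt[h [hs hE _ _]] /pos_sqrt[s [ss sE _ sc]].
rewrite -hE nm_sqr //; apply: (@circle_nm _ s) => //.
  apply: sc; apply: commrB; first exact: comm_scal.
  by rewrite -hE; exact: commrM.
by rewrite sE hE addrC subrK.
Qed.

Lemma pos_scalB x : sa x -> pos ((nm x)%:C%:A - x).
Proof.
move=> xs; split; first by apply: saB => //; exact: sa_scal.
by exists (nm x); rewrite ?nm_ge0 // opprB addrC subrK.
Qed.

Lemma pos_le_nm x y : pos x -> pos (y - x) -> nm x <= nm y.
Proof.
move=> xp yxp; apply: pos_ge1B => //; first exact: nm_ge0.
have ys : sa y by rewrite -(subrK x y); apply: saD; [case: yxp | case: xp].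
have -> : (nm y)%:C%:A - x = ((nm y)%:C%:A - y) + (y - x).
  by rewrite addrA subrK.
by apply: posD => //; exact: pos_scalB.
Qed.

Lemma starM_eq0 x : star x * x = 0 -> x = 0.
Proof.
move=> h; apply/nm0_eq0/eqP; have := nm_starM x.
by rewrite h nm0 => /esym/eqP; rewrite expf_eq0.
Qed.

Lemma sa_sqr_eq0 h : sa h -> h * h = 0 -> h = 0.
Proof. by move=> hs h0; apply: starM_eq0; rewrite hs. Qed.

Lemma sqrD_sub_sqrB x y :
  (x + y) * (x + y) - (x - y) * (x - y) = (x * y + y * x) + (x * y + y * x).
Proof.
have sqD (z w : A) : (z + w) * (z + w) = (z * z + w * w) + (z * w + w * z).
  by rewrite mulrDl !mulrDr [w * z + _]addrC addrACA.
rewrite !sqD mulrN !mulNr opprK mulrN -opprD opprB.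
by rewrite addrC addrA subrK.
Qed.

(* Were y = - c^* c positive, so would be z = c c^*, and comparing the norms  *)
(* of (|z| - z) c = c (|z| + y) would force |z| = 0.                          *)
Lemma neg_starM_eq0 (c : A) : pos (- (star c * c)) -> c = 0.
Proof.
have [y yE] : exists y, star c * c = - y.
  by exists (- (star c * c)); rewrite opprK.
rewrite yE opprK => yp; pose z := c * star c; pose k := nm c ^+ 2.
have [ys _] := yp.
have nz : nm z = k by rewrite nm_Mstar.
have ny : nm y = k by rewrite -nmN -yE nm_starM.
have k0 : 0 <= k by rewrite exprn_ge0 ?nm_ge0.
have zp : pos z.
  (* Twice the real part of c and, up to sign, twice its imaginary part: p^2 + q^2 = 2 (c c^* + c^*
     c) exhibits z as a sum of positive elements. *)
  pose p := c + star c; pose q := 'i%R *: (c - star c).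
  have ps : sa p by rewrite /sa starD starK addrC.
  have qs : sa q by rewrite /sa starZ starB starK conjCi scaleNr -scalerN opprB.
  have E : p * p + q * q = (2 : R)%:C *: (z - y).
    rewrite /p /q -scalerAl -scalerAr scalerA -(expr2 'i%R) sqrCi scaleN1r.
    by rewrite sqrD_sub_sqrB scale2r yE.
  have -> : z = 2^-1%:C *: (p * p + q * q) + y.
    by rewrite E scalerA -rmorphM mulVf // scale1r subrK.
  apply: posD => //; apply: posZ; first by rewrite invr_ge0.
  by apply: posD; exact: pos_sqr.
have kzn : nm (k%:C%:A - z) <= k by rewrite -nz pos_nm.
have E : (k%:C%:A - z) * c = c * (k%:C%:A + y).
  by rewrite mulrBl mulrDr -(comm_scal k c) /z -mulrA yE mulrN opprK.
have [s [ss sE _ sc]] := pos_sqrt yp.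
have kc : GRing.comm (k%:C%:A) y by exact/commr_sym/comm_scal.
(* Since y = - c^* c, the norm of v is ||c (k + y)||^2 = ||(k - z) c||^2 <= k^3. On the other hand v
   = 2 k y^2 + k^2 y + y^3 dominates 2 k y^2, whose norm is 2 k^3. *)
pose v := (k%:C%:A + y) * y * (k%:C%:A + y).
have kys : sa (k%:C%:A + y) by apply: saD => //; exact: sa_scal.
have nv : nm v <= k ^+ 3.
  have -> : nm v = nm (c * (k%:C%:A + y)) ^+ 2.
    rewrite -nm_starM starM kys -nmN /v; congr nm.
    rewrite mulrA -(mulrA _ (star c) c).
    by rewrite yE mulrN mulNr.
  rewrite -E (_ : k ^+ 3 = (k * nm c) ^+ 2); last by rewrite /k; ring.
  apply: lerXn2r; rewrite ?nnegrE ?nm_ge0 ?mulr_ge0 ?nm_ge0 //.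
  by rewrite (le_trans (nmM _ _)) // ler_wpM2r // nm_ge0.
have vE : v = (2 * k)%:C *: (y * y) + ((k ^+ 2)%:C *: y + (s * y) * (s * y)).
  have -> : s * y * (s * y) = y * y * y.
    by rewrite -mulrA (mulrA y) (sc y (commr_refl y)) !mulrA sE.
  have -> : v = k%:C *: (k%:C *: y) + k%:C *: (y * y)
      + (k%:C *: (y * y) + y * y * y).
    by rewrite /v mulrDl !mulrDr !mulrDl -!scalerAl -!scalerAr !mul1r !mulr1.
  rewrite scalerA -rmorphM /= -expr2.
  have -> : (2 * k)%:C *: (y * y) = k%:C *: (y * y) + k%:C *: (y * y).
    by rewrite scale2r scalerA -rmorphM.
  move: (_ *: y) (_ *: (y * y)) (y * y * y) => a1 a2 a3.
  by rewrite addrACA [a1 + a2]addrC -!addrA; congr (_ + _); rewrite addrCA.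
have : nm ((2 * k)%:C *: (y * y)) <= nm v.
  apply: pos_le_nm.
    by apply: posZ; [exact: mulr_ge0 | exact: pos_sqr].
  rewrite vE [_ + (_ + _)]addrC addrK; apply: posD.
    by apply: posZ => //; exact: exprn_ge0.
  by apply: pos_sqr; apply: saM => //; apply/commr_sym/sc/commr_refl.
have k20 : 0 <= 2 * k by exact: mulr_ge0.
rewrite nmZr nm_sqr // ny ger0_norm // => /le_trans/(_ nv) h.
have k30 : k ^+ 3 <= 0 by move: h; rewrite (_ : 2 * k * k ^+ 2 = 2 * k ^+ 3); [lra|ring].
have : k ^+ 3 == 0 by rewrite eq_le k30; exact: exprn_ge0.
by rewrite !expf_eq0 /= => /eqP/nm0_eq0.
Qed.

(** Let b = |x| be the root of x^2; then w = b - x is twice the negative part of x = a^* a, and w x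
    = - b w. Hence (a w)^* (a w) = w x w = - b w^2 is the negative of a square, so [neg_starM_eq0]
    gives a w = 0, and then w = 0, that is x = |x|. *)
Theorem pos_starM (a : A) : pos (star a * a).
Proof.
set x := star a * a; have xs : sa x by exact: sa_starM.
have [b [bs bE bp bc]] := pos_sqrt (pos_sqr xs).
have [r [rs rE _ rc]] := pos_sqrt bp.
have xb : GRing.comm x b by apply: bc; exact: commrM.
pose w := b - x.
have ws : sa w by exact: saB.
have wb : GRing.comm w b.
  by apply/commr_sym/commrB; [exact: commr_refl | exact: commr_sym].
have wx : GRing.comm w x.
  by apply/commr_sym/commrB; [| exact: commr_refl].
have wr : GRing.comm w r by exact: rc.
have wxE : w * x = - (b * w).
  by rewrite /w mulrBl mulrBr opprB bE.
have rw2 : star (a * w) * (a * w) = - ((r * w) * (r * w)).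
  have -> : star (a * w) * (a * w) = w * x * w by rewrite starM ws /x !mulrA.
  rewrite wxE mulNr; congr (- _).
  by rewrite -(mulrA r w) (mulrA w r) wr !mulrA rE.
have c0 : a * w = 0.
  apply: neg_starM_eq0; rewrite rw2 opprK; apply: pos_sqr.
  by apply: saM => //; exact: commr_sym.
have rw0 : r * w = 0.
  have rws : sa (r * w) by apply: saM => //; exact: commr_sym.
  by apply: sa_sqr_eq0 => //; rewrite -[_ * _]opprK -rw2 c0 mulr0 oppr0.
have bw0 : b * w = 0 by rewrite -rE -mulrA rw0 mulr0.
have w0 : w = 0.
  by apply: sa_sqr_eq0 => //; rewrite {2}/w mulrBr wxE wb bw0 oppr0 subrr.
by move/eqP: w0; rewrite subr_eq0 => /eqP <-.
Qed.

Lemma pos_conj x y : pos x -> pos (star y * x * y).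
Proof.
move=> /pos_sqrt[s [ss <- _ _]]; rewrite mulrA -mulrA -{1}ss -starM.
exact: pos_starM.
Qed.

Lemma pos_mul x y : pos x -> pos y -> GRing.comm x y -> pos (x * y).
Proof.
move=> /pos_sqrt[s [ss sE _ sc]] yp xy.
have -> : x * y = star s * y * s.
  by rewrite ss -sE -!mulrA (sc y (commr_sym xy)).
exact: pos_conj.
Qed.

End Positive.

(** The square root of ||x^* x|| - x^* x is mapped to one of ||x^* x|| - (f x)^* (f x), so the
    latter is positive. *)
Lemma star_morphism_nm (R : realType) (A B : cstarAlgType R[i])
    (f : {lrmorphism A -> B}) : star_morphism f ->
  forall x, nm (f x) <= nm x.
Proof.
move=> fs x; rewrite -(@ler_pXn2r _ 2) ?nnegrE ?nm_ge0 // -!nm_starM.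
apply: pos_ge1B; first exact: nm_ge0.
  exact: pos_starM.
have [s [ss sE _ _]] := pos_sqrt (pos_scalB (sa_starM x)).
have -> : (nm (star x * x))%:C%:A - star (f x) * f x = f s * f s.
  by rewrite -fs -!rmorphM sE rmorphB /= linearZ /= rmorph1.
by apply: pos_sqr; rewrite /sa -fs ss.
Qed.

Definition tozero (R : realType) (a : nat -> R) := forall e : R, 0 < e ->
  exists n0, forall n, (n0 <= n)%N -> a n <= e.

(** * Completion of a C*-seminorm *)

Section ToZero.
Context (R : realType).
Implicit Types a b : nat -> R.

Lemma tozero_le a b : (forall n, a n <= b n) -> tozero b -> tozero a.
Proof. by move=> ab h e /h[n0 hn]; exists n0 => n /hn; exact: le_trans. Qed.

Lemma tozeroD a b : tozero a -> tozero b -> tozero (fun n => a n + b n).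
Proof.
move=> ha hb e e0; have e20 : 0 < e / 2 by rewrite divr_gt0.
have [n1 hn1] := ha _ e20; have [n2 hn2] := hb _ e20.
exists (maxn n1 n2) => n; rewrite geq_max => /andP[/hn1 h1 /hn2 h2]; lra.
Qed.

Lemma tozeroM a b (K : R) : (forall n, 0 <= a n) -> (forall n, b n <= K) ->
  tozero a -> tozero (fun n => a n * b n).
Proof.
move=> a0 bK ha e e0; have K0 : 0 < `|K| + 1 by rewrite ltr_wpDl.
have [n0 hn] := ha _ (divr_gt0 e0 K0).
exists n0 => n /hn; rewrite ler_pdivlMr // => /(le_trans _); apply.
rewrite ler_wpM2l // (le_trans (bK n)) // (le_trans (ler_norm _)) //.
by rewrite lerDl.
Qed.

Lemma tozero_cvg a l : tozero (fun n => `|l - a n|) <->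
  ((a n @[n --> \oo]) --> l)%classic.
Proof.
split=> [h|/cvgrPdist_le h].
  apply/cvgrPdist_le => e /h[n0 hn]; near=> n; apply: hn.
  by near: n; exact: nbhs_infty_ge.
by move=> e /h[n0 _ hn]; exists n0 => n; exact: hn.
Unshelve. all: by end_near. Qed.

End ToZero.

(** A seminorm may vanish at non-zero elements; separation and completion are done at once by a
    quotient of the Cauchy sequences. [csn1] keeps the result a non-zero ring. *)
Record cstar_seminorm (R : realType) (A : starAlgType R[i]) := CstarSeminorm {
  csn :> A -> R;
  csnD : forall x y, csn (x + y) <= csn x + csn y;
  csnZ : forall (c : R[i]) x, csn (c *: x) = normc c * csn x;
  csnM : forall x y, csn (x * y) <= csn x * csn y;
  csn_star : forall x, csn (star x) = csn x;
  csn_starM : forall x, csn (star x * x) = csn x ^+ 2;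
  csn1 : csn 1 = 1
}.

Section Completion.
Context (R : realType) (A : starAlgType R[i]) (N : cstar_seminorm A).
Implicit Types (x y : A) (c : R[i]).

Lemma csn0 : N 0 = 0.
Proof. by rewrite -(scale0r 0) csnZ normc0 mul0r. Qed.

Lemma csnN x : N (- x) = N x.
Proof. by rewrite -scaleN1r csnZ normcN normc1 mul1r. Qed.

Lemma csn_ge0 x : 0 <= N x.
Proof.
have := csnD N x (- x); rewrite subrr csn0 csnN; lra.
Qed.

Lemma csn_subC x y : N (x - y) = N (y - x).
Proof. by rewrite -csnN opprB. Qed.

Lemma csn_dist x y z : N (x - z) <= N (x - y) + N (y - z).
Proof. by rewrite (le_trans _ (csnD N _ _)) // addrA subrK. Qed.

Lemma csn_abs x y : `|N x - N y| <= N (x - y).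
Proof.
have h1 := csnD N (x - y) y; have h2 := csnD N (y - x) x.
rewrite !subrK (csn_subC y) in h1 h2; rewrite ler_norml; apply/andP; split; lra.
Qed.

Definition csn_cauchy (u : nat -> A) := forall e : R, 0 < e ->
  exists n0, forall m n, (n0 <= m)%N -> (n0 <= n)%N -> N (u m - u n) <= e.

Lemma csn_cauchy_bound u : csn_cauchy u -> exists K, forall n, N (u n) <= K.
Proof.
move=> /(_ 1 ltr01)[n0 hn].
exists (N (u n0) + 1 + \sum_(i < n0) N (u i)) => n.
have s0 : 0 <= \sum_(i < n0) N (u i) by apply: sumr_ge0 => i _; exact: csn_ge0.
have [h|h] := ltnP n n0.
  rewrite (bigD1 (Ordinal h)) //=.
  have : 0 <= \sum_(i < n0 | i != Ordinal h) N (u i).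
    by apply: sumr_ge0 => i _; exact: csn_ge0.
  have := csn_ge0 (u n0); lra.
have := hn n n0 h (leqnn _); have := csnD N (u n - u n0) (u n0).
rewrite subrK; lra.
Qed.

Lemma csn_cauchyD u v : csn_cauchy u -> csn_cauchy v ->
  csn_cauchy (fun n => u n + v n).
Proof.
move=> hu hv e e0; have e20 : 0 < e / 2 by rewrite divr_gt0.
have [n1 h1] := hu _ e20; have [n2 h2] := hv _ e20.
exists (maxn n1 n2) => m n; rewrite !geq_max => /andP[m1 m2] /andP[k1 k2].
have := h1 _ _ m1 k1; have := h2 _ _ m2 k2.
have := csnD N (u m - u n) (v m - v n); rewrite opprD addrACA; lra.
Qed.

Lemma csn_cauchyM u v : csn_cauchy u -> csn_cauchy v ->
  csn_cauchy (fun n => u n * v n).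
Proof.
move=> hu hv; have [K hK] := csn_cauchy_bound hu.
have [L hL] := csn_cauchy_bound hv.
move=> e e0; pose M := `|K| + `|L| + 1.
have M0 : 0 < M by rewrite /M ltr_wpDl // addr_ge0.
have uM n : N (u n) <= M.
  by have := hK n; have := ler_norm K; have := normr_ge0 L; rewrite /M; lra.
have vM n : N (v n) <= M.
  by have := hL n; have := ler_norm L; have := normr_ge0 K; rewrite /M; lra.
have e20 : 0 < e / (2 * M) by rewrite divr_gt0 // mulr_gt0.
have [n1 h1] := hu _ e20; have [n2 h2] := hv _ e20.
exists (maxn n1 n2) => m n; rewrite !geq_max => /andP[m1 m2] /andP[k1 k2].
have -> : u m * v m - u n * v n = u m * (v m - v n) + (u m - u n) * v n.
  by rewrite mulrBr mulrBl addrA subrK.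
rewrite (le_trans (csnD N _ _)) // (_ : e = M * (e / (2 * M)) + e / (2 * M) * M).
  apply: lerD; apply: (le_trans (csnM N _ _)); apply: ler_pM;
    rewrite ?csn_ge0 //; [exact: h2 | exact: h1].
by field; rewrite gt_eqF.
Qed.

Lemma csn_cauchyZ c u : csn_cauchy u -> csn_cauchy (fun n => c *: u n).
Proof.
move=> hu e e0; have c0 : 0 < normc c + 1.
  by rewrite ltr_wpDl // -ler0c; exact: (@normr_ge0 _ _ c).
have [n0 hn] := hu _ (divr_gt0 e0 c0).
exists n0 => m n hm hn'; have := hn _ _ hm hn'.
rewrite ler_pdivlMr // -scalerBr csnZ mulrC => /(le_trans _); apply.
by rewrite ler_wpM2r ?csn_ge0 // lerDl.
Qed.

Lemma csn_cauchy_star u : csn_cauchy u -> csn_cauchy (fun n => star (u n)).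
Proof.
move=> hu e /hu[n0 hn]; exists n0 => m n hm hn'.
by rewrite -starB csn_star; exact: hn.
Qed.

Lemma csn_cauchy_cst x : csn_cauchy (fun=> x).
Proof. by move=> e e0; exists 0%N => m n _ _; rewrite subrr csn0 ltW. Qed.

Definition cseq := {u : nat -> A | `[< csn_cauchy u >]}.

Lemma cseqP (u : cseq) : csn_cauchy (val u).
Proof. exact/asboolP/(valP u). Qed.

Definition mkseq (u : nat -> A) (hu : csn_cauchy u) : cseq :=
  exist _ u (introT (asboolP _) hu).

Definition weqP (u v : cseq) := tozero (fun n => N (val u n - val v n)).
Definition weq (u v : cseq) := `[< weqP u v >].

Lemma weq_equiv : equiv_class_of weq.
Proof.
split.
- move=> u; apply/asboolP => e e0; exists 0%N => n _.
  by rewrite subrr csn0 ltW.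
- by move=> u v; apply/asbool_equiv_eq; split=> h e /h[n0 hn];
    exists n0 => n /hn; rewrite csn_subC.
- move=> v u w /asboolP uv /asboolP vw; apply/asboolP.
  apply: tozero_le (tozeroD uv vw) => n; exact: csn_dist.
Qed.

Canonical weq_rel := EquivRelPack weq_equiv.
Definition completion := {eq_quot weq_rel}%qT.
HB.instance Definition _ := Choice.on completion.
HB.instance Definition _ := Quotient.on completion.

Local Notation D := completion.
Local Notation "\pi u" := (\pi_D%qT u) (at level 10).

Lemma piP (u v : cseq) : \pi u = \pi v <-> weqP u v.
Proof. by split=> [/eqquotP/asboolP|h]; [|apply/eqquotP/asboolP]. Qed.

Definition wadd (u v : cseq) : cseq := mkseq (csn_cauchyD (cseqP u) (cseqP v)).
Definition wmul (u v : cseq) : cseq := mkseq (csn_cauchyM (cseqP u) (cseqP v)).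
Definition wscale c (u : cseq) : cseq := mkseq (csn_cauchyZ c (cseqP u)).
Definition wstar (u : cseq) : cseq := mkseq (csn_cauchy_star (cseqP u)).
Definition wcst x : cseq := mkseq (csn_cauchy_cst x).

(* Locked, lest rewriting with the rules pi_* unfold the operations.          *)
Fact ckey : unit. Proof. by []. Qed.
Definition cadd := locked_with ckey
  (fun x y : D => \pi (wadd (repr x) (repr y)) : D).
Definition cmul := locked_with ckey
  (fun x y : D => \pi (wmul (repr x) (repr y)) : D).
Definition cscale := locked_with ckey
  (fun c (x : D) => \pi (wscale c (repr x)) : D).
Definition cstar := locked_with ckey (fun x : D => \pi (wstar (repr x)) : D).
Definition cinj (x : A) : D := \pi (wcst x).

Lemma repr_pi (u : cseq) : weqP (repr (\pi u)) u.
Proof. by apply/piP; rewrite reprK. Qed.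

Lemma pi_add u v : cadd (\pi u) (\pi v) = \pi (wadd u v).
Proof.
rewrite /cadd unlock.
apply/piP/(tozero_le _ (tozeroD (repr_pi u) (repr_pi v))) => n /=.
by rewrite opprD addrACA csnD.
Qed.

Lemma pi_mul u v : cmul (\pi u) (\pi v) = \pi (wmul u v).
Proof.
rewrite /cmul unlock.
apply/piP; set u' := repr _; set v' := repr _.
have [K hK] := csn_cauchy_bound (cseqP u').
have [L hL] := csn_cauchy_bound (cseqP v).
have h1 := tozeroM (fun n => csn_ge0 _) hL (repr_pi u).
have h2 := tozeroM (fun n => csn_ge0 _) hK (repr_pi v).
apply: tozero_le (tozeroD h1 h2) => n /=.
have -> : val u' n * val v' n - val u n * val v n =
    (val u' n - val u n) * val v n + val u' n * (val v' n - val v n).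
  by rewrite mulrBr mulrBl [RHS]addrC addrA subrK.
by rewrite (le_trans (csnD N _ _)) // lerD ?csnM // mulrC csnM.
Qed.

Lemma pi_scale c u : cscale c (\pi u) = \pi (wscale c u).
Proof.
rewrite /cscale unlock.
apply/piP; have h := tozeroM (fun n => csn_ge0 _) (fun=> lexx (normc c)) (repr_pi u).
by apply: tozero_le h => n /=; rewrite -scalerBr csnZ mulrC.
Qed.

Lemma pi_star u : cstar (\pi u) = \pi (wstar u).
Proof.
rewrite /cstar unlock.
by apply/piP/(tozero_le _ (repr_pi u)) => n /=; rewrite -starB csn_star.
Qed.

Lemma pi_ext (u v : cseq) : val u =1 val v -> \pi u = \pi v.
Proof.
by move=> h; congr (\pi _); apply: val_inj; apply/funext.
Qed.

Let pi_rules := (pi_add, pi_mul, pi_scale, pi_star).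

Lemma caddA : associative cadd.
Proof.
elim/quotW=> x; elim/quotW=> y; elim/quotW=> z; rewrite !pi_rules.
by apply: pi_ext => n /=; rewrite addrA.
Qed.

Lemma caddC : commutative cadd.
Proof.
elim/quotW=> x; elim/quotW=> y; rewrite !pi_rules.
by apply: pi_ext => n /=; rewrite addrC.
Qed.

Lemma cadd0 : left_id (cinj 0) cadd.
Proof.
elim/quotW=> x; rewrite /cinj !pi_rules.
by apply: pi_ext => n /=; rewrite add0r.
Qed.

Lemma caddN : left_inverse (cinj 0) (cscale (-1)) cadd.
Proof.
elim/quotW=> x; rewrite /cinj !pi_rules.
by apply: pi_ext => n /=; rewrite scaleN1r addNr.
Qed.

HB.instance Definition _ := GRing.isZmodule.Build D caddA caddC cadd0 caddN.

Let caddE (x y : D) : x + y = cadd x y. Proof. by []. Qed.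

Lemma cmulA : associative cmul.
Proof.
elim/quotW=> x; elim/quotW=> y; elim/quotW=> z; rewrite !pi_rules.
by apply: pi_ext => n /=; rewrite mulrA.
Qed.

Lemma cmul1 : left_id (cinj 1) cmul.
Proof.
elim/quotW=> x; rewrite /cinj !pi_rules.
by apply: pi_ext => n /=; rewrite mul1r.
Qed.

Lemma cmulr1 : right_id (cinj 1) cmul.
Proof.
elim/quotW=> x; rewrite /cinj !pi_rules.
by apply: pi_ext => n /=; rewrite mulr1.
Qed.

Lemma cmulDl : left_distributive cmul cadd.
Proof.
elim/quotW=> x; elim/quotW=> y; elim/quotW=> z; rewrite !pi_rules.
by apply: pi_ext => n /=; rewrite mulrDl.
Qed.

Lemma cmulDr : right_distributive cmul cadd.
Proof.
elim/quotW=> x; elim/quotW=> y; elim/quotW=> z; rewrite !pi_rules.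
by apply: pi_ext => n /=; rewrite mulrDr.
Qed.

Lemma cone_neq0 : cinj 1 != cinj 0.
Proof.
apply/eqP => /piP /(_ (2^-1))[|n0 /(_ _ (leqnn _))] /=.
  by rewrite invr_gt0.
by rewrite subr0 csn1; lra.
Qed.

HB.instance Definition _ := GRing.Zmodule_isNzRing.Build D
  cmulA cmul1 cmulr1 cmulDl cmulDr cone_neq0.

Let cmulE (x y : D) : x * y = cmul x y. Proof. by []. Qed.

Lemma cscaleA a b (x : D) : cscale a (cscale b x) = cscale (a * b) x.
Proof.
elim/quotW: x => x; rewrite !pi_rules.
by apply: pi_ext => n /=; rewrite scalerA.
Qed.

Lemma cscale1 : left_id 1 cscale.
Proof.
elim/quotW=> x; rewrite !pi_rules.
by apply: pi_ext => n /=; rewrite scale1r.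
Qed.

Lemma cscaleDr : right_distributive cscale +%R.
Proof.
move=> c; elim/quotW=> x; elim/quotW=> y; rewrite !caddE !pi_rules.
by apply: pi_ext => n /=; rewrite scalerDr.
Qed.

Lemma cscaleDl (x : D) : {morph cscale^~ x : a b / a + b}.
Proof.
elim/quotW: x => x a b; rewrite caddE !pi_rules.
by apply: pi_ext => n /=; rewrite scalerDl.
Qed.

HB.instance Definition _ := GRing.Zmodule_isLmodule.Build R[i] D
  cscaleA cscale1 cscaleDr cscaleDl.

Let cscaleE c (x : D) : c *: x = cscale c x. Proof. by []. Qed.

Lemma cscaleAl c (x y : D) : c *: (x * y) = c *: x * y.
Proof.
elim/quotW: x => x; elim/quotW: y => y.
rewrite !cmulE !cscaleE !pi_rules.
by apply: pi_ext => n /=; rewrite scalerAl.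
Qed.

Lemma cscaleAr c (x y : D) : c *: (x * y) = x * (c *: y).
Proof.
elim/quotW: x => x; elim/quotW: y => y.
rewrite !cmulE !cscaleE !pi_rules.
by apply: pi_ext => n /=; rewrite scalerAr.
Qed.

HB.instance Definition _ :=
  GRing.LSemiModule_isLSemiAlgebra.Build R[i] D cscaleAl.
HB.instance Definition _ :=
  GRing.LSemiAlgebra_isSemiAlgebra.Build R[i] D cscaleAr.

Lemma cstarK : involutive cstar.
Proof.
elim/quotW=> x; rewrite !pi_rules.
by apply: pi_ext => n /=; rewrite starK.
Qed.

Lemma cstarD : {morph cstar : x y / x + y}.
Proof.
elim/quotW=> x; elim/quotW=> y; rewrite !caddE !pi_rules.
by apply: pi_ext => n /=; rewrite starD.
Qed.

Lemma cstarZ c (x : D) : cstar (c *: x) = Num.conj c *: cstar x.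
Proof.
elim/quotW: x => x; rewrite !cscaleE !pi_rules.
by apply: pi_ext => n /=; rewrite starZ.
Qed.

Lemma cstarM (x y : D) : cstar (x * y) = cstar y * cstar x.
Proof.
elim/quotW: x => x; elim/quotW: y => y; rewrite !cmulE !pi_rules.
by apply: pi_ext => n /=; rewrite starM.
Qed.

HB.instance Definition _ := hasStar.Build R[i] D cstarK cstarD cstarZ cstarM.

Let cstarE (x : D) : star x = cstar x. Proof. by []. Qed.

Definition wnorm (u : cseq) : R := limn (fun n => N (val u n)).

Lemma wnormP (u : cseq) : ((fun n => N (val u n)) @ \oo --> wnorm u)%classic.
Proof.
apply: cauchy_cvg; apply/cauchyP => e e0.
have e20 : 0 < e / 2 by rewrite divr_gt0.
have [n0 hn] := cseqP u e20.
exists (N (val u n0)); exists n0 => //= n hn'.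
rewrite /ball /= (le_lt_trans (csn_abs _ _)) //.
have := hn _ _ (leqnn _) hn'; lra.
Qed.

#[local] Arguments wnormP : clear implicits.

Lemma wnorm_uniq (u : cseq) l :
  ((fun n => N (val u n)) @ \oo --> l)%classic -> wnorm u = l.
Proof. exact: cvg_lim. Qed.

Lemma wnorm_eq (u v : cseq) : weqP u v -> wnorm u = wnorm v.
Proof.
move=> uv; apply: wnorm_uniq; apply/tozero_cvg.
have /tozero_cvg hv := wnormP v; apply: tozero_le (tozeroD hv uv) => n.
rewrite (le_trans (ler_distD (N (val v n)) _ _)) // lerD2l distrC.
exact: csn_abs.
Qed.

Definition cnorm (x : D) : R[i] := (wnorm (repr x))%:C.

Lemma pi_norm u : cnorm (\pi u) = (wnorm u)%:C.
Proof. by rewrite /cnorm (wnorm_eq (repr_pi u)). Qed.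

Lemma wnorm_le (u v : cseq) K :
  (exists n0, forall n, (n0 <= n)%N -> N (val u n) <= K) -> wnorm u <= K.
Proof.
move=> [n0 hn]; apply: (ler_cvg_to (wnormP u) (cvg_cst K)).
by exists n0 => // n; exact: hn.
Qed.

Lemma cnormD (x y : D) : cnorm (x + y) <= cnorm x + cnorm y.
Proof.
elim/quotW: x => x; elim/quotW: y => y.
rewrite caddE !pi_rules !pi_norm -rmorphD lecR.
apply: (ler_cvg_to (wnormP _) (cvgD (wnormP x) (wnormP y))).
by exists 0%N => // n _; exact: csnD.
Qed.

Lemma cnormZ c (x : D) : cnorm (c *: x) = `|c| * cnorm x.
Proof.
elim/quotW: x => x; rewrite !cscaleE !pi_rules !pi_norm.
have -> : `|c| = (normc c)%:C by [].
rewrite -rmorphM; congr (_%:C); apply: wnorm_uniq.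
under eq_fun do rewrite /= csnZ.
exact: (cvgM (cvg_cst _) (wnormP x)).
Qed.

Lemma cnorm0_eq0 (x : D) : cnorm x = 0 -> x = 0.
Proof.
elim/quotW: x => x; rewrite pi_norm => /complexI x0; apply/piP.
have /tozero_cvg := wnormP x; rewrite x0; apply: tozero_le => n /=.
by rewrite subr0 sub0r normrN ger0_norm ?csn_ge0.
Qed.

Lemma cnormM (x y : D) : cnorm (x * y) <= cnorm x * cnorm y.
Proof.
elim/quotW: x => x; elim/quotW: y => y.
rewrite cmulE !pi_rules !pi_norm -rmorphM lecR.
apply: (ler_cvg_to (wnormP _) (cvgM (wnormP x) (wnormP y))).
by exists 0%N => // n _; exact: csnM.
Qed.

Lemma cnorm_star (x : D) : cnorm (star x) = cnorm x.
Proof.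
elim/quotW: x => x; rewrite !cstarE !pi_rules !pi_norm.
congr (_%:C); apply: wnorm_uniq; under eq_fun do rewrite /= csn_star.
exact: wnormP.
Qed.

HB.instance Definition _ := isNormedStar.Build R[i] D
  cnormD cnormZ cnorm0_eq0 cnormM cnorm_star.

Lemma cnorm_starM (x : D) : cnorm (star x * x) = cnorm x ^+ 2.
Proof.
elim/quotW: x => x; rewrite !cstarE !cmulE.
rewrite !pi_rules !pi_norm -rmorphXn.
congr (_%:C); apply: wnorm_uniq; under eq_fun do rewrite /= csn_starM expr2.
exact: (cvgM (wnormP x) (wnormP x)).
Qed.

Lemma nm_cinj x : nm (cinj x) = N x.
Proof.
rewrite /nm -[anorm _]/(cnorm _) pi_norm /=; apply: wnorm_uniq => /=.
exact: cvg_cst.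
Qed.

Lemma cinjB x y : cinj (x - y) = cinj x - cinj y.
Proof.
rewrite -[- cinj y]scaleN1r caddE cscaleE /cinj !pi_rules.
by apply: pi_ext => n /=; rewrite scaleN1r.
Qed.

Lemma conv_cinj (u : cseq) : conv (fun n => cinj (val u n)) (\pi u : D).
Proof.
move=> e e0; have [n0 hn] := cseqP u e0; exists n0 => n hn'.
have -> : cinj (val u n) - \pi u = \pi (wadd (wcst (val u n)) (wscale (-1) u)).
  by rewrite -pi_add -pi_scale -caddE -cscaleE scaleN1r.
rewrite /nm -[anorm _]/(cnorm _) pi_norm /=; apply: wnorm_le => //.
by exists n0 => m hm /=; rewrite scaleN1r; exact: hn.
Qed.

Lemma cinj_dense (x : D) e : 0 < e -> exists a, nm (x - cinj a) <= e.
Proof.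
elim/quotW: x => u e0; have [n0 hn] := conv_cinj u e0.
by exists (val u n0); rewrite nm_subC hn.
Qed.

(** Each u n is replaced by an element of A within 1 / (n + 1); these form a Cauchy sequence, whose
    class is the limit. *)
Lemma completion_complete (u : nat -> D) :
  anorm_cauchy u -> exists l, anorm_cvg u l.
Proof.
move=> /cauchy_anorm hu.
have /choice[a ha] n : exists a, nm (u n - cinj a) <= n.+1%:R^-1.
  by apply: cinj_dense; rewrite invr_gt0.
have inv0 (e : R) : 0 < e -> exists n0, forall n, (n0 <= n)%N -> n.+1%:R^-1 <= e.
  move=> e0; have [n0 hn] := ltr_add_invr (y := 0) e0.
  exists n0 => n hn'; rewrite add0r in hn; apply: le_trans (ltW hn).
  by rewrite lef_pV2 ?posrE // ler_nat.
have hac : csn_cauchy a.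
  move=> e e0; have e30 : 0 < e / 3 by rewrite divr_gt0.
  have [n1 h1] := inv0 _ e30; have [n2 h2] := hu _ e30.
  exists (maxn n1 n2) => m n; rewrite !geq_max => /andP[m1 m2] /andP[k1 k2].
  rewrite -nm_cinj cinjB.
  have := nm_dist (cinj (a m)) (u m) (cinj (a n)).
  have := nm_dist (u m) (u n) (cinj (a n)).
  have := ha m; have := ha n; have := h1 _ m1; have := h1 _ k1.
  have := h2 _ _ m2 k2; rewrite (nm_subC (cinj (a m)) (u m)).
  move: (n.+1%:R^-1) (m.+1%:R^-1) => p q; lra.
exists (\pi (mkseq hac)); apply/conv_anorm => e e0.
have e20 : 0 < e / 2 by rewrite divr_gt0.
have [n1 h1] := inv0 _ e20; have [n2 h2] := conv_cinj (mkseq hac) e20.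
exists (maxn n1 n2) => n; rewrite geq_max => /andP[k1 k2].
have := nm_dist (u n) (cinj (a n)) (\pi (mkseq hac)).
have := ha n; have := h1 _ k1; have := h2 _ k2 => /=.
move: (n.+1%:R^-1) => q; lra.
Qed.

HB.instance Definition _ := isCStar.Build R[i] D
  completion_complete cnorm_starM.

Lemma cinj_zmod : zmod_morphism cinj. Proof. exact: cinjB. Qed.

Lemma cinj_monoid : monoid_morphism cinj.
Proof.
split=> // x y; rewrite cmulE /cinj pi_rules; exact: pi_ext.
Qed.

Lemma cinj_scalable : scalable cinj.
Proof.
move=> c x; rewrite cscaleE /cinj pi_rules; exact: pi_ext.
Qed.

HB.instance Definition _ := GRing.isZmodMorphism.Build A D cinj cinj_zmod.
HB.instance Definition _ := GRing.isMonoidMorphism.Build A D cinj cinj_monoid.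
HB.instance Definition _ := GRing.isScalable.Build R[i] A D *:%R cinj cinj_scalable.

Lemma cinj_star : star_morphism cinj.
Proof.
move=> x; rewrite cstarE /cinj pi_rules; exact: pi_ext.
Qed.

End Completion.

Theorem completion_exists (R : realType) (A : starAlgType R[i])
    (N : cstar_seminorm A) :
  exists (D : cstarAlgType R[i]) (j : {lrmorphism A -> D}),
    [/\ star_morphism j, forall x, nm (j x) = N x &
        forall x e, 0 < e -> exists a, nm (x - j a) <= e].
Proof.
exists (completion N), (@cinj _ _ N); split.
- exact: cinj_star.
- exact: nm_cinj.
- exact: cinj_dense.
Qed.

(** * Extension of bounded maps *)

Section Extension.
Context (R : realType) (A : lmodType R[i]) (D B : cstarAlgType R[i]).
Context (j : {linear A -> D}) (T : {linear A -> B}) (K : R).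
Hypothesis K_ge0 : 0 <= K.
Hypothesis dense_j : forall x e, 0 < e -> exists a, nm (x - j a) <= e.
Hypothesis bound_T : forall a, nm (T a) <= K * nm (j a).

(** The closure of the set of pairs (j a, T a). The map j need not be injective: [bound_T] is what
    makes this relation single-valued. *)
Let graph (d : D) (l : B) := forall e, 0 < e ->
  exists2 a, nm (d - j a) <= e & nm (l - T a) <= e.

Let dist_T a b : nm (T a - T b) <= K * nm (j a - j b).
Proof.
by rewrite -!linearB; exact: bound_T.
Qed.

Let graph_uniq d l l' : graph d l -> graph d l' -> l = l'.
Proof.
move=> h h'; apply/eqP; rewrite -subr_eq0; apply/eqP/nm_small => e e0.
have K0 : 0 < 2 + 2 * K by rewrite ltr_pwDl // mulr_ge0.
have [a a1 a2] := h _ (divr_gt0 e0 K0); have [b b1 b2] := h' _ (divr_gt0 e0 K0).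
pose t := e / (2 + 2 * K); rewrite -/t in a1 a2 b1 b2.
have -> : e = t + (K * (t + t) + t) by rewrite /t; field; rewrite gt_eqF.
rewrite (le_trans (nm_dist _ (T a) _)) // lerD //.
rewrite (le_trans (nm_dist _ (T b) _)) // lerD // 1?nm_subC //.
rewrite (le_trans (dist_T _ _)) // ler_wpM2l //.
by rewrite (le_trans (nm_dist _ d _)) // lerD // nm_subC.
Qed.

Let graph_ex d : exists l, graph d l.
Proof.
have /choice[a ha] n : exists a, nm (d - j a) <= n.+1%:R^-1.
  by apply: dense_j; rewrite invr_gt0.
have inv0 (e : R) : 0 < e -> exists n0, forall n, (n0 <= n)%N -> n.+1%:R^-1 <= e.
  move=> e0; have [n0 hn] := ltr_add_invr (y := 0) e0.
  exists n0 => n hn'; rewrite add0r in hn; apply: le_trans (ltW hn).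
  by rewrite lef_pV2 ?posrE // ler_nat.
have [l hl] : exists l, conv (fun n => T (a n)) l.
  apply: nm_complete => e e0; have K0 : 0 < 2 * K + 1.
    by rewrite ltr_wpDl // mulr_ge0.
  have [n0 hn] := inv0 _ (divr_gt0 e0 K0); exists n0 => m n hm hn'.
  pose t := e / (2 * K + 1).
  have t0 : 0 <= t by rewrite ltW // divr_gt0.
  have -> : e = K * (t + t) + t by rewrite /t; field; rewrite gt_eqF.
  rewrite (le_trans (dist_T _ _)) // -[leLHS]addr0 lerD // ler_wpM2l //.
  rewrite (le_trans (nm_dist _ d _)) // lerD // ?(nm_subC _ d).
    by rewrite (le_trans (ha _)) // hn.
  by rewrite (le_trans (ha _)) // hn.
exists l => e e0; have [n1 h1] := inv0 _ e0; have [n2 h2] := hl _ e0.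
exists (a (maxn n1 n2)); first by rewrite (le_trans (ha _)) // h1 // leq_maxl.
by rewrite nm_subC h2 // leq_maxr.
Qed.

Lemma dense_extension : exists T' : {linear D -> B},
  (forall a, T' (j a) = T a) /\ (forall d, nm (T' d) <= K * nm d).
Proof.
have [F hF] := choice graph_ex.
have FD d d' : F (d + d') = F d + F d'.
  apply: graph_uniq (hF _) _ => e e0; have e20 : 0 < e / 2 by rewrite divr_gt0.
  have [a a1 a2] := hF d _ e20; have [b b1 b2] := hF d' _ e20.
  have eE : e = e / 2 + e / 2 by lra.
  exists (a + b); rewrite linearD opprD addrACA eE (le_trans (nmD _ _)) ?lerD //.
have FZ c d : F (c *: d) = c *: F d.
  apply: graph_uniq (hF _) _ => e e0.
  have c0 : 0 <= normc c by rewrite -ler0c; exact: (@normr_ge0 _ _ c).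
  have c1 : 0 < normc c + 1 by rewrite ltr_wpDl.
  have [a a1 a2] := hF d _ (divr_gt0 e0 c1).
  have le_e t : 0 <= t -> t <= e / (normc c + 1) -> normc c * t <= e.
    move=> t0; rewrite ler_pdivlMr // => /(le_trans _); apply.
    by rewrite mulrDr mulr1 mulrC lerDl.
  by exists (c *: a); rewrite linearZ -scalerBr nmZ le_e ?nm_ge0.
have lin : linear F by move=> c d d'; rewrite FD FZ.
pose mL := GRing.isLinear.Build R[i] D B *:%R F lin.
pose FL : {linear D -> B} := HB.pack F mL.
have Fj a : F (j a) = T a.
  apply: graph_uniq (hF _) _ => e e0.
  by exists a; rewrite subrr nm0 ltW.
exists FL; split=> // d /=.
apply/ler_addgt0Pr => e e0.
have K0 : 0 < 1 + K by rewrite ltr_pwDl.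
have [a] := hF d _ (divr_gt0 e0 K0); set t := e / _ => a1 a2.
have -> : e = K * t + t by rewrite /t; field; rewrite gt_eqF.
rewrite addrA -mulrDr -(subrK (T a) (F d)) addrC (le_trans (nmD _ _)) // lerD //.
rewrite (le_trans (bound_T _)) // ler_wpM2l //.
rewrite -[j a](subrK d) addrC (le_trans (nmD _ _)) // lerD //.
by rewrite nm_subC.
Qed.

End Extension.

(** * Norm and density of the group algebra in C*(G) *)

Section Density.
Context (R : realType) (G : groupType) (E : cstarAlgType R[i]).
Context (iota : {lrmorphism group_algebra R[i] G -> E}).
Hypothesis full : is_full_group_cstar iota.

Lemma iota_le x : nm (iota x) <= nm x.
Proof. by rewrite -lecR -!anormE; exact: env_contractive full x. Qed.

(** The completion for N is a C*-algebra receiving the group algebra contractively, so the universal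
    property factors it through E, and *-morphisms between C*-algebras are contractive. *)
Lemma full_seminorm_le (N : cstar_seminorm (group_algebra R[i] G)) :
  (forall x, N x <= nm x) -> forall x, N x <= nm (iota x).
Proof.
move=> hN x; have [D [j [js jN _]]] := completion_exists N.
have jc : contractive j by move=> y; rewrite !anormE lecR jN.
have [F [Fs Fj]] := env_ex full js jc.
by rewrite -jN -Fj /=; exact: star_morphism_nm.
Qed.

(** Density is not part of [is_enveloping] and is derived from uniqueness. Let D complete the group
    algebra for ||iota a||. The universal property yields F : E -> D, and iota extends to a
    *-morphism T : D -> E; by [env_uniq], T F is the identity. So x = T (F x), and F x is a limit of
    elements j a. *)
Lemma full_dense x e : 0 < e -> exists a, nm (x - iota a) <= e.
Proof.
have nZ c y : nm (iota (c *: y)) = normc c * nm (iota y).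
  by rewrite linearZ nmZ.
have nD y z : nm (iota (y + z)) <= nm (iota y) + nm (iota z).
  by rewrite linearD nmD.
have nMl y z : nm (iota (y * z)) <= nm (iota y) * nm (iota z).
  by rewrite rmorphM nmM.
have nS y : nm (iota (star y)) = nm (iota y).
  by rewrite (env_star full) nm_star.
have nSM y : nm (iota (star y * y)) = nm (iota y) ^+ 2.
  by rewrite rmorphM /= (env_star full) nm_starM.
have n1 : nm (iota 1) = 1 by rewrite rmorph1 nm1.
pose N := CstarSeminorm nD nZ nMl nS nSM n1.
have [D [j [js jN jd]]] := completion_exists N.
have jc : contractive j.
  by move=> y; rewrite !anormE lecR jN; exact: iota_le.
have [F [Fs Fj]] := env_ex full js jc.
have bT a : nm (iota a) <= 1 * nm (j a) by rewrite mul1r jN.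
have [T [Tj Tb]] := dense_extension ler01 jd bT.
have cvT d : exists2 u : nat -> _, conv (fun n => j (u n)) d &
    conv (fun n => iota (u n)) (T d).
  have /choice[u hu] n : exists a, nm (d - j a) <= n.+1%:R^-1.
    by apply: jd; rewrite invr_gt0.
  have cu : conv (fun n => j (u n)) d.
    move=> e0 /[dup] e0p e0_gt0; have [n0 hn] := ltr_add_invr (y := 0) e0p.
    exists n0 => n hn'; rewrite add0r in hn; rewrite nm_subC.
    apply: le_trans (hu n) _; apply: le_trans (ltW hn).
    by rewrite lef_pV2 ?posrE // ler_nat.
  exists u => //; have : conv (fun n => T (j (u n))) (T d).
    by apply: (conv_map (K := 1) cu) => y z; rewrite -linearB Tb.
  by apply: conv_eq => n; rewrite Tj.
have TM : monoid_morphism T.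
  split=> [|d d']; first by rewrite -(rmorph1 j) Tj rmorph1.
  have [u u1 u2] := cvT d; have [v v1 v2] := cvT d'.
  apply: (@conv_uniq _ _ (fun n => T (j (u n * v n)))).
    apply: (conv_map (K := 1) (u := fun n => j (u n * v n))) => [|y z].
      by apply: conv_eq (convM u1 v1) => n; rewrite rmorphM.
    by rewrite -linearB Tb.
  by apply: conv_eq (convM u2 v2) => n; rewrite Tj /= rmorphM.
have Ts : {morph T : y / star y}.
  move=> d; have [u u1 u2] := cvT d.
  apply: (@conv_uniq _ _ (fun n => T (j (star (u n))))).
    apply: (conv_map (K := 1) (u := fun n => j (star (u n)))) => [|y z].
      by apply: conv_eq (conv_star u1) => n; rewrite js.
    by rewrite -linearB Tb.
  by apply: conv_eq (conv_star u2) => n; rewrite Tj /= (env_star full).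
pose mT := GRing.isMonoidMorphism.Build D E T TM.
pose TT : {lrmorphism D -> E} := HB.pack (T : D -> E) mT
  (GRing.isLinear.Build R[i] D E *:%R T (linearP T)).
have TF1 : (TT \o F : {lrmorphism E -> E}) =1 (idfun : {lrmorphism E -> E}).
  apply: (env_uniq full) => // [y|y] /=; first by rewrite Fs Ts.
  by rewrite [F _]Fj Tj.
move=> e0; have [a ha] := jd (F x) _ e0; exists a.
have -> : x - iota a = T (F x - j a).
  by rewrite linearB Tj; congr (_ - _); rewrite -[LHS]TF1.
by rewrite (le_trans (Tb _)) // mul1r.
Qed.

End Density.

(** * Hilbert modules and multipliers *)

Section CauchySchwarz.
Context (R : realType) (E : cstarAlgType R[i]) (I : Type).
Implicit Types (a b : I -> E) (d : seq I).

Definition ipd d a b : E := \sum_(h <- d) star (a h) * b h.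

Lemma ipd_pos d a : pos (ipd d a a).
Proof.
rewrite /ipd; elim/big_ind: _ => [|x y|h _].
- exact: pos0.
- exact: posD.
- exact: pos_starM.
Qed.

Lemma ipd_star d a b : star (ipd d a b) = ipd d b a.
Proof.
by rewrite /ipd star_sum; apply: eq_bigr => h _; rewrite starM starK.
Qed.

(** With P = <a, a>, Q = <b, b>, t = <b, a> and r > ||Q||, the sum of <r a - b t, r a - b t> and t^*
    (r - Q) t is positive and equals r^2 P - r t^* t. Hence ||t^* t|| <= r ||P||, and r may tend to
    ||Q||. Taking r strictly larger allows the division by r. *)
Lemma ipd_cs d a b :
  nm (ipd d a b) ^+ 2 <= nm (ipd d a a) * nm (ipd d b b).
Proof.
set P := ipd d a a; set Q := ipd d b b; set t := ipd d b a.
have tE : ipd d a b = star t by rewrite ipd_star.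
have Qs : sa Q by case: (ipd_pos d b).
suff main r : nm Q < r -> nm (star t * t) <= r * nm P.
  rewrite tE nm_star -nm_starM mulrC; apply/ler_addgt0Pr => e e0.
  have P0 : 0 < nm P + 1 by rewrite ltr_wpDl // nm_ge0.
  have /main : nm Q < nm Q + e / (nm P + 1) by rewrite ltrDl divr_gt0.
  move=> /le_trans; apply; rewrite mulrDl lerD2l // mulrAC ler_pdivrMr //.
  by rewrite ler_pM2l //; lra.
move=> Qr; have r0 : 0 < r by exact: le_lt_trans (nm_ge0 _) Qr.
pose c h := r%:C *: a h - b h * t.
have cE : ipd d c c = (r ^+ 2)%:C *: P - r%:C *: (star t * t)
     - (r%:C *: (star t * t) - star t * Q * t).
  have e1 : star t * t = \sum_(h <- d) star (a h) * (b h * t).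
    by rewrite -tE mulr_suml; apply: eq_bigr => h _; rewrite mulrA.
  have e2 : star t * t = \sum_(h <- d) star t * star (b h) * a h.
    by rewrite {2}/t mulr_sumr; apply: eq_bigr => h _; rewrite mulrA.
  have e3 : star t * Q * t = \sum_(h <- d) star t * star (b h) * (b h * t).
    rewrite /Q /ipd [star t * _]mulr_sumr mulr_suml.
    by apply: eq_bigr => h _; rewrite !mulrA.
  rewrite {1}e1 e2 e3 /P /ipd !scaler_sumr -!sumrB.
  apply: eq_bigr => h _; rewrite /c starB starZ starM mulrBl !mulrBr.
  rewrite conj_Creal ?complex_real // -!scalerAl -!scalerAr scalerA -rmorphM.
  by rewrite -expr2.
have rQ : pos (r%:C%:A - Q).
  have -> : r%:C%:A - Q = (r - nm Q)%:C%:A + ((nm Q)%:C%:A - Q).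
    by rewrite rmorphB /= scalerBl addrA subrK.
  apply: posD; last exact: pos_scalB.
  apply: posZ; first by rewrite subr_ge0 ltW.
  by rewrite -[1]mulr1 -[X in X * _]star1; exact: pos_starM.
have := posD (ipd_pos d c) (pos_conj t rQ); rewrite cE.
rewrite mulrBr mulrBl -scalerAr mulr1 -scalerAl subrK => h.
have := pos_le_nm (posZ (ltW r0) (pos_starM t)) h.
rewrite !nmZr normrX (gtr0_norm r0) expr2 -mulrA.
by rewrite ler_pM2l.
Qed.

End CauchySchwarz.

Definition finsupp (I : choiceType) (V : zmodType) (F : I -> V) :=
  exists d : {fset I}, forall h, h \notin d -> F h = 0.

Section FiniteSupport.
Context (I : choiceType) (V : zmodType).
Implicit Types F : I -> V.

Lemma finsupp2 F F' : finsupp F -> finsupp F' -> exists d : {fset I},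
  (forall h, h \notin d -> F h = 0) /\ (forall h, h \notin d -> F' h = 0).
Proof.
move=> [d hd] [d' hd']; exists (d `|` d')%fset.
by split=> h; rewrite in_fsetU negb_or => /andP[h1 h2]; rewrite ?hd ?hd'.
Qed.

Lemma finsupp0 : finsupp (0 : I -> V).
Proof. by exists fset0. Qed.

Lemma finsuppD F F' : finsupp F -> finsupp F' -> finsupp (F + F').
Proof.
move=> h h'; have [d [d1 d2]] := finsupp2 h h'; exists d => k kd /=.
by rewrite fctE d1 ?d2 ?addr0.
Qed.

Lemma finsupp_sum (J : Type) (s : seq J) (F : J -> I -> V) :
  (forall j, finsupp (F j)) -> finsupp (\sum_(j <- s) F j).
Proof.
by move=> h; elim/big_ind: _ => //; [exact: finsupp0 | exact: finsuppD].
Qed.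

End FiniteSupport.

Section HilbertModule.
Context (R : realType) (E : cstarAlgType R[i]) (H : choiceType).
Implicit Types (a b : H -> E) (c : R[i]).

(** A finitary sum makes this total without a completed module: finitely supported vectors suffice
    to define operator norms. *)
Definition ip a b : E := \sum_(h \in @classical_sets.setT H) (star (a h) * b h).

Definition mn a : R := Num.sqrt (nm (ip a a)).

Lemma ipE (d : {fset H}) a b :
  (forall h, h \notin d -> b h = 0) -> ip a b = ipd d a b.
Proof. by move=> hd; apply: fsbigTE => h hh; rewrite hd // mulr0. Qed.

Lemma ip_star a b : finsupp a -> finsupp b -> star (ip a b) = ip b a.
Proof.
move=> fa fb; have [d [d1 d2]] := finsupp2 fa fb.
by rewrite !(ipE (d := d)) // ipd_star.
Qed.

Lemma ip_pos a : finsupp a -> pos (ip a a).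
Proof. by move=> [d hd]; rewrite (ipE (d := d)) //; exact: ipd_pos. Qed.

Lemma ipDr a b b' : finsupp b -> finsupp b' -> ip a (b + b') = ip a b + ip a b'.
Proof.
move=> fb fb'; have [d [d1 d2]] := finsupp2 fb fb'.
rewrite !(ipE (d := d)) //; last by move=> h hd; rewrite fctE d1 ?d2 ?addr0.
by rewrite /ipd -big_split /=; apply: eq_bigr => h _; rewrite mulrDr.
Qed.

Lemma ipZr a b c : finsupp b -> ip a (c *: b) = c *: ip a b.
Proof.
move=> [d hd]; rewrite !(ipE (d := d)) //; last first.
  by move=> h hh; rewrite fctE hd // scaler0.
by rewrite /ipd scaler_sumr; apply: eq_bigr => h _; rewrite scalerAr.
Qed.

Lemma ip0r a : ip a 0 = 0.
Proof. by rewrite (ipE (d := fset0)) // /ipd big_seq_fset0. Qed.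

Lemma finsuppZ c a : finsupp a -> finsupp (c *: a).
Proof. by move=> [d hd]; exists d => h hh; rewrite fctE hd // scaler0. Qed.

Lemma ip_cs a b : finsupp a -> finsupp b ->
  nm (ip a b) ^+ 2 <= nm (ip a a) * nm (ip b b).
Proof.
move=> fa fb; have [d [d1 d2]] := finsupp2 fa fb.
by rewrite !(ipE (d := d)) //; exact: ipd_cs.
Qed.

Lemma mn_ge0 a : 0 <= mn a.
Proof. exact: sqrtr_ge0. Qed.

Lemma sqr_mn a : mn a ^+ 2 = nm (ip a a).
Proof. by rewrite sqr_sqrtr // nm_ge0. Qed.

Lemma nm_ip a b : finsupp a -> finsupp b -> nm (ip a b) <= mn a * mn b.
Proof.
move=> fa fb; rewrite -(@ler_pXn2r _ 2) ?nnegrE ?nm_ge0 ?mulr_ge0 ?mn_ge0 //.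
by rewrite exprMn !sqr_mn ip_cs.
Qed.

Lemma mnZ c a : finsupp a -> mn (c *: a) = normc c * mn a.
Proof.
move=> fa; have c0 : 0 <= normc c by rewrite -ler0c; exact: (@normr_ge0 _ _ c).
have fca := finsuppZ c fa.
rewrite /mn -[in RHS](ger0_norm c0) -sqrtr_sqr -sqrtrM ?sqr_ge0 //.
congr (Num.sqrt _).
rewrite ipZr // -[ip _ a]starK ip_star // ipZr // starZ ip_star // scalerA nmZ.
congr (_ * _); rewrite normcM expr2; congr (_ * _); apply: (@complexI R).
exact: (norm_conjC c).
Qed.

Lemma mnD a b : finsupp a -> finsupp b -> mn (a + b) <= mn a + mn b.
Proof.
move=> fa fb; have fab := finsuppD fa fb.
have ab0 : 0 <= mn a + mn b by rewrite addr_ge0 ?mn_ge0.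
rewrite -(@ler_pXn2r _ 2) ?nnegrE ?mn_ge0 // sqr_mn ipDr //.
have e x : finsupp x -> ip (a + b) x = star (ip x a + ip x b).
  by move=> fx; rewrite -ipDr // ip_star.
rewrite !e // !starD !ip_star //.
have := nmD (ip a a + ip b a) (ip a b + ip b b).
have := nmD (ip a a) (ip b a); have := nmD (ip a b) (ip b b).
have := nm_ip fa fb; have := nm_ip fb fa; rewrite -!sqr_mn.
have -> : (mn a + mn b) ^+ 2 = mn a ^+ 2 + mn b * mn a + (mn a * mn b + mn b ^+ 2).
  by ring.
lra.
Qed.

Lemma mn0 : mn 0 = 0.
Proof. by rewrite /mn ip0r nm0 sqrtr0. Qed.

Lemma mn_sum (J : Type) (s : seq J) (F : J -> H -> E) :
  (forall j, finsupp (F j)) -> mn (\sum_(j <- s) F j) <= \sum_(j <- s) mn (F j).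
Proof.
move=> h; elim: s => [|j s IH]; first by rewrite !big_nil mn0.
rewrite !big_cons (le_trans (mnD (h j) (finsupp_sum _ h))) // lerD2l.
exact: IH.
Qed.

End HilbertModule.

Section GroupAlgebraInd.
Context (C : numClosedFieldType) (G : groupType).

Definition gterm (c : C) (g : G) : group_algebra C G := mkmalgU g c.
Definition gdelta := gterm 1.

Lemma gtermZ c g : gterm c g = c *: gdelta g.
Proof. by rewrite /gdelta /gterm ga_scaleU mulr1. Qed.

Lemma gtermM c c' g g' : gterm c g * gterm c' g' = gterm (c * c') (g * g')%g.
Proof. exact: ga_mulUU. Qed.

Lemma gdeltaM g g' : gdelta g * gdelta g' = gdelta (g * g')%g.
Proof. by rewrite gtermM mulr1. Qed.

Lemma gdelta1 : gdelta 1%g = 1.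
Proof. by []. Qed.

Lemma gterm_star c g : star (gterm c g) = gterm (Num.conj c) (g^-1)%g.
Proof. exact: ga_starU. Qed.

Lemma gdelta_star g : star (gdelta g) = gdelta (g^-1)%g.
Proof. by rewrite gterm_star rmorph1. Qed.

Lemma ga_ind (P : group_algebra C G -> Prop) :
  (forall c g, P (gterm c g)) -> (forall f f', P f -> P f' -> P (f + f')) ->
  forall f, P f.
Proof.
move=> hd hD f; rewrite (ga_expand f); elim/big_ind: _ => // [|g _].
  by rewrite -(monalgU0 (1%g : G)); exact: (hd 0).
exact: (hd f@_g).
Qed.

End GroupAlgebraInd.
Arguments gdelta {C G}.

(** * Monomial representations of G on l^2(H, E) *)

Section MonomialRepresentation.
Context (R : realType) (G H : groupType) (E : cstarAlgType R[i]).
Context (iota : {lrmorphism group_algebra R[i] G -> E}).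
Context (q : G -> H) (u : G -> H -> R[i]).
Hypothesis full : is_full_group_cstar iota.
Hypothesis qM : {morph q : x y / (x * y)%g}.
Hypothesis u_norm : forall g h, Num.conj (u g h) * u g h = 1.
Hypothesis u_cocycle : forall g g' h, u (g * g')%g h = u g (q g' * h)%g * u g' h.
Local Notation CG := (group_algebra R[i] G).
Implicit Types (a b : H -> E) (g : G) (f : CG).

Let q1 : q 1%g = 1%g.
Proof. by apply: (mulgI (q 1%g)); rewrite -qM !mulg1. Qed.

Let qV g : q (g^-1)%g = ((q g)^-1)%g.
Proof. by apply: (mulgI (q g)); rewrite -qM !mulgV. Qed.

Let u1 h : u 1%g h = 1.
Proof.
have := u_cocycle 1%g 1%g h; rewrite mulg1 q1 mul1g => e.
have u0 : u 1%g h != 0.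
  apply: contra_eq_neq (u_norm 1%g h) => ->.
  by rewrite mulr0 eq_sym oner_eq0.
by apply: (mulfI u0); rewrite mulr1 -e.
Qed.

(** The tensor product of left multiplication by the unitary of g with the monomial operator delta_h
    |-> u(g, h) delta_(q(g) h). For u = 1 the second factor is the regular representation of H
    pulled back along q; a cocycle u also covers representations induced from a character of the
    kernel. *)
Definition act g a : H -> E := fun k =>
  u g ((q g)^-1 * k)%g *: (iota (gdelta g) * a ((q g)^-1 * k)%g).

Lemma act1 a : act 1%g a = a.
Proof.
apply/funext => k; rewrite /act u1 scale1r gdelta1 rmorph1 mul1r.
by rewrite q1 invg1 mul1g.
Qed.

Lemma actM g g' a : act (g * g')%g a = act g (act g' a).
Proof.
apply/funext => k; rewrite /act qM invgM -gdeltaM rmorphM -scalerAr scalerA.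
by rewrite u_cocycle -!mulgA mulVKg mulrA.
Qed.

Lemma finsupp_act g a : finsupp a -> finsupp (act g a).
Proof.
move=> [d hd]; exists [fset (q g * h)%g | h in d]%fset => k kd.
rewrite /act hd ?mulr0 ?scaler0 //; apply: contra kd => kd.
by apply/imfsetP; exists ((q g)^-1 * k)%g => //; rewrite mulVKg.
Qed.

Lemma ip_act g a b : ip (act g a) (act g b) = ip a b.
Proof.
rewrite /ip (reindex_fsbigT (fun h => (q g * h)%g)); last first.
  by exists (fun h => ((q g)^-1 * h)%g) => h; rewrite ?mulKg ?mulVKg.
apply: eq_fsbigr => h _; rewrite /act mulKg starZ starM -scalerAl -scalerAr.
rewrite scalerA u_norm scale1r mulrA -(mulrA _ (star _)) -(env_star full).
by rewrite gdelta_star -rmorphM gdeltaM mulVg gdelta1 rmorph1 mulr1.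
Qed.

Lemma ip_actl g a b : ip (act g a) b = ip a (act g^-1 b).
Proof. by rewrite -(ip_act g^-1) -actM mulVg act1. Qed.

Lemma mn_act g a : mn (act g a) = mn a.
Proof. by rewrite /mn ip_act. Qed.

Definition actf f a : H -> E := \sum_(g <- msupp f) f@_g *: act g a.

Lemma actfw (d : {fset G}) f a : (msupp f `<=` d)%fset ->
  actf f a = \sum_(g <- d) f@_g *: act g a.
Proof.
move=> le; apply/big_fset_incl => // g _ /mcoeff_outdom ->.
by rewrite scale0r.
Qed.

Lemma actfD f f' a : actf (f + f') a = actf f a + actf f' a.
Proof.
rewrite (@actfw (msupp f `|` msupp f')%fset) ?msuppD_le //.
rewrite (@actfw (msupp f `|` msupp f')%fset f) ?fsubsetUl //.
rewrite (@actfw (msupp f `|` msupp f')%fset f') ?fsubsetUr //.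
rewrite -big_split /=; apply: eq_bigr => g _.
by rewrite mcoeffD scalerDl.
Qed.

Lemma actfZ c f a : actf (c *: f) a = c *: actf f a.
Proof.
rewrite (@actfw (msupp f)) ?msuppZ_le // /actf scaler_sumr.
by apply: eq_bigr => g _; rewrite mcoeffZ scalerA.
Qed.

Lemma actf_term c g a : actf (gterm c g) a = c *: act g a.
Proof. by rewrite (actfw _ msuppU_le) big_seq_fset1 mcoeffUU. Qed.

Lemma actf1 a : actf 1 a = a.
Proof. by rewrite -gdelta1 actf_term act1 scale1r. Qed.

Lemma finsupp_actf f a : finsupp a -> finsupp (actf f a).
Proof.
by move=> fa; apply: finsupp_sum => g; apply: finsuppZ; exact: finsupp_act.
Qed.

Lemma actDr g a b : act g (a + b) = act g a + act g b.
Proof. by apply/funext => k; rewrite /act !fctE mulrDr scalerDr. Qed.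

Lemma actZr g c a : act g (c *: a) = c *: act g a.
Proof.
by apply/funext => k; rewrite /act !fctE -scalerAr !scalerA mulrC.
Qed.

Lemma actfZr f c a : actf f (c *: a) = c *: actf f a.
Proof.
rewrite /actf scaler_sumr; apply: eq_bigr => g _.
by rewrite actZr !scalerA mulrC.
Qed.

Lemma actfM f f' a : actf (f * f') a = actf f (actf f' a).
Proof.
have act_sum c g : c *: act g (actf f' a) = actf (gterm c g * f') a.
  move: f'; apply: ga_ind => [c' g'|f1 f2 h1 h2].
    by rewrite gtermM !actf_term actZr actM scalerA.
  by rewrite mulrDr !actfD actDr scalerDr h1 h2.
move: f; apply: ga_ind => [c g|f1 f2 h1 h2].
  by rewrite actf_term act_sum.
by rewrite mulrDl !actfD h1 h2.
Qed.

Lemma ip_actfl f a b : finsupp a -> finsupp b ->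
  ip (actf f a) b = ip a (actf (star f) b).
Proof.
move=> fa fb; move: f; apply: ga_ind => [c g|f1 f2 h1 h2].
  rewrite gterm_star !actf_term ipZr; last exact: finsupp_act.
  rewrite -[LHS]starK ip_star //; last exact/finsuppZ/finsupp_act.
  rewrite ipZr; last exact: finsupp_act.
  by rewrite starZ ip_star ?ip_actl //; exact: finsupp_act.
rewrite starD !actfD ipDr; try exact: finsupp_actf.
rewrite -h1 -h2 -[LHS]starK ip_star //; last by apply: finsuppD; exact: finsupp_actf.
by rewrite ipDr ?starD ?ip_star //; exact: finsupp_actf.
Qed.

Lemma nm_gaE f : nm f = \sum_(g <- msupp f) normc f@_g.
Proof.
apply: (@complexI R); rewrite -anormE -[anorm f]/(ga_norm f) /ga_norm.
by rewrite (rmorph_sum (real_complex R)).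
Qed.

Lemma mn_actf f a : finsupp a -> mn (actf f a) <= nm f * mn a.
Proof.
move=> fa; rewrite nm_gaE mulr_suml.
apply: (le_trans (mn_sum _ _)) => [g|]; first exact/finsuppZ/finsupp_act.
by apply: ler_sum => g _; rewrite mnZ ?mn_act //; exact: finsupp_act.
Qed.

Let unit_ball f := [set r | exists a, [/\ finsupp a, mn a <= 1 & r = mn (actf f a)]]%classic.

Definition act_norm f : R := sup (unit_ball f).

Let unit_ball_sup f : has_sup (unit_ball f).
Proof.
split; first by exists (mn (actf f 0)), 0; split; rewrite ?mn0 //; exact: finsupp0.
exists (nm f) => _ [a [fa a1 ->]]; rewrite (le_trans (mn_actf f fa)) //.
by rewrite ler_piMr ?nm_ge0.
Qed.

Lemma act_norm_ub f a : finsupp a -> mn (actf f a) <= act_norm f * mn a.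
Proof.
move=> fa; have [a0|aN0] := eqVneq (mn a) 0.
  by rewrite a0 mulr0 (le_trans (mn_actf f fa)) // a0 mulr0.
have agt : 0 < mn a by rewrite lt_def aN0 mn_ge0.
rewrite -ler_pdivrMr //; apply: sup_upper_bound => //.
exists ((mn a)^-1%:C *: a); split.
- exact: finsuppZ.
- by rewrite mnZ // normcR ger0_norm ?invr_ge0 ?mn_ge0 // mulVf.
- rewrite actfZr mnZ ?normcR ?ger0_norm ?invr_ge0 ?mn_ge0 // 1?mulrC //.
  exact: finsupp_actf.
Qed.

Lemma act_norm_lub f K :
  (forall a, finsupp a -> mn (actf f a) <= K * mn a) -> 0 <= K -> act_norm f <= K.
Proof.
move=> h K0; apply: ge_sup; first by case: (unit_ball_sup f).
move=> _ [a [fa a1 ->]]; rewrite (le_trans (h a fa)) //.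
by rewrite ler_piMr.
Qed.

Lemma act_norm_ge0 f : 0 <= act_norm f.
Proof.
apply: le_trans (mn_ge0 (actf f 0)) _; apply: sup_upper_bound => //.
by exists 0; split; rewrite ?mn0 //; exact: finsupp0.
Qed.

Lemma act_norm_le f : act_norm f <= nm f.
Proof. by apply: act_norm_lub => [a|]; [exact: mn_actf | exact: nm_ge0]. Qed.

Lemma act_normD f f' : act_norm (f + f') <= act_norm f + act_norm f'.
Proof.
apply: act_norm_lub => [a fa|]; last by rewrite addr_ge0 ?act_norm_ge0.
rewrite actfD mulrDl (le_trans (mnD _ _)) ?lerD ?act_norm_ub //;
  exact: finsupp_actf.
Qed.

Lemma act_normZ c f : act_norm (c *: f) = normc c * act_norm f.
Proof.
have c0 (c' : R[i]) : 0 <= normc c'.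
  by rewrite -ler0c; exact: (@normr_ge0 _ _ c').
have le c' f' : act_norm (c' *: f') <= normc c' * act_norm f'.
  apply: act_norm_lub => [a fa|]; last by rewrite mulr_ge0 ?c0 ?act_norm_ge0.
  rewrite actfZ mnZ -?mulrA ?ler_wpM2l ?act_norm_ub //; exact: finsupp_actf.
apply/eqP; rewrite eq_le le /=; have [->|cN0] := eqVneq c 0.
  by rewrite normc0 mul0r act_norm_ge0.
have nc0 : 0 < normc c.
  by rewrite lt_def c0 andbT; apply: contra cN0 => /eqP/eq0_normc ->.
rewrite -ler_pdivlMl // -normcV; apply: le_trans (le _ _).
by rewrite scalerA mulVf // scale1r.
Qed.

Lemma act_normM f f' : act_norm (f * f') <= act_norm f * act_norm f'.
Proof.
apply: act_norm_lub => [a fa|]; last by rewrite mulr_ge0 ?act_norm_ge0.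
rewrite actfM (le_trans (act_norm_ub f (finsupp_actf f' fa))) //.
by rewrite -mulrA ler_wpM2l ?act_norm_ge0 ?act_norm_ub.
Qed.

Let mn_sqr_le f a : finsupp a ->
  mn (actf f a) ^+ 2 <= mn a * mn (actf (star f * f) a).
Proof.
move=> fa; rewrite sqr_mn ip_actfl //; last exact: finsupp_actf.
by rewrite -actfM nm_ip //; exact: finsupp_actf.
Qed.

(** From ||f^* a||^2 <= ||a|| ||f f^* a|| <= ||a|| ||f|| ||f^* a|| one factor cancels. *)
Lemma act_norm_star f : act_norm (star f) = act_norm f.
Proof.
have le f' : act_norm (star f') <= act_norm f'.
  apply: act_norm_lub => [a fa|]; last exact: act_norm_ge0.
  have [m0|mN0] := eqVneq (mn (actf (star f') a)) 0.
    by rewrite m0 mulr_ge0 ?act_norm_ge0 ?mn_ge0.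
  have m0 : 0 < mn (actf (star f') a) by rewrite lt_def mN0 mn_ge0.
  rewrite -(ler_pM2r m0) -expr2 (le_trans (mn_sqr_le _ fa)) // starK actfM.
  rewrite mulrAC mulrC ler_wpM2r ?mn_ge0 //; apply: act_norm_ub.
  exact: finsupp_actf.
by apply/eqP; rewrite eq_le le -{1}(starK f) le.
Qed.

Lemma act_norm_starM f : act_norm (star f * f) = act_norm f ^+ 2.
Proof.
apply/eqP; rewrite eq_le; apply/andP; split.
  by rewrite (le_trans (act_normM _ _)) // act_norm_star expr2.
rewrite -[leRHS]sqr_sqrtr ?act_norm_ge0 //; apply: lerXn2r.
- by rewrite nnegrE act_norm_ge0.
- by rewrite nnegrE sqrtr_ge0.
apply: act_norm_lub => [a fa|]; last exact: sqrtr_ge0.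
rewrite -(@ler_pXn2r _ 2) ?nnegrE ?mulr_ge0 ?mn_ge0 ?sqrtr_ge0 //.
apply: (le_trans (mn_sqr_le f fa)).
rewrite exprMn (sqr_sqrtr (act_norm_ge0 _)).
rewrite expr2 mulrA [leRHS]mulrC ler_wpM2l ?mn_ge0 //; exact: act_norm_ub.
Qed.

Lemma act_norm1 : act_norm 1 = 1.
Proof.
apply/eqP; rewrite eq_le; apply/andP; split.
  apply: act_norm_lub => [a fa|]; last exact: ler01.
  by rewrite actf1 mul1r.
pose a (h : H) : E := if h == 1%g then 1 else 0.
have fa : finsupp a.
  by exists [fset 1%g]%fset => h; rewrite in_fset1 /a => /negbTE ->.
have a1 : mn a = 1.
  rewrite /mn (ipE (d := [fset 1%g]%fset)) => [|h]; last first.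
    by rewrite in_fset1 /a => /negbTE ->.
  by rewrite /ipd big_seq_fset1 /a eqxx star1 mulr1 nm1 sqrtr1.
by have := act_norm_ub 1 fa; rewrite actf1 a1 mulr1.
Qed.

Definition act_seminorm : cstar_seminorm CG :=
  CstarSeminorm act_normD act_normZ act_normM act_norm_star act_norm_starM
    act_norm1.

(** The operator norm is a C*-seminorm below the l^1-norm, hence below the norm of C*(G). This is
    what lets compressions of the representation extend from the group algebra to E. *)
Lemma act_norm_iota f : act_norm f <= nm (iota f).
Proof. exact: (full_seminorm_le full (N := act_seminorm) act_norm_le). Qed.

End MonomialRepresentation.

(** * Multipliers of C*(G) as compressions *)

Section Multiplier.
Context (R : realType) (G H : groupType) (E : cstarAlgType R[i]).
Context (iota : {lrmorphism group_algebra R[i] G -> E}).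
Context (q : G -> H) (u : G -> H -> R[i]) (xi : H -> R[i]) (d : {fset H}).
Hypothesis full : is_full_group_cstar iota.
Hypothesis qM : {morph q : x y / (x * y)%g}.
Hypothesis u_norm : forall g h, Num.conj (u g h) * u g h = 1.
Hypothesis u_cocycle : forall g g' h, u (g * g')%g h = u g (q g' * h)%g * u g' h.
Hypothesis xi_supp : forall h, h \notin d -> xi h = 0.
Hypothesis xi_norm : \sum_(h <- d) Num.conj (xi h) * xi h = 1.
Local Notation CG := (group_algebra R[i] G).

(** The matrix coefficient of the monomial representation at the vector xi. *)
Definition coefficient g : R[i] :=
  \sum_(h <- d) Num.conj (xi h) * (u g ((q g)^-1 * h)%g * xi ((q g)^-1 * h)%g).

Let vec (h : H) : E := xi h *: 1.

Let fvec : finsupp vec.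
Proof. by exists d => h /xi_supp; rewrite /vec => ->; rewrite scale0r. Qed.

Let ip_vec (b : H -> E) : finsupp b ->
  ip vec b = \sum_(h <- d) Num.conj (xi h) *: b h.
Proof.
move=> fb; rewrite -[LHS]starK ip_star // (ipE (d := d)); last first.
  by move=> h /xi_supp; rewrite /vec => ->; rewrite scale0r.
rewrite /ipd star_sum; apply: eq_bigr => h _.
by rewrite starM starK /vec starZ star1 -scalerAl mul1r.
Qed.

Let mn_vec : mn vec = 1.
Proof.
rewrite /mn ip_vec // (_ : \sum_(h <- d) _ = 1) ?nm1 ?sqrtr1 //.
rewrite -[RHS]scale1r -xi_norm scaler_suml; apply: eq_bigr => h _.
by rewrite /vec scalerA.
Qed.

Local Notation actf := (actf iota q u).
Let M0 (f : CG) : E := ip vec (actf f vec).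

Let factf f a : finsupp a -> finsupp (actf f a).
Proof. exact: finsupp_actf. Qed.

Let M0_linear : linear M0.
Proof.
by move=> c f f'; rewrite /M0 actfD actfZ ipDr ?ipZr //;
  try apply: finsuppZ; exact: factf.
Qed.

Let M0_starM f f' : M0 (star f * f') = ip (actf f vec) (actf f' vec).
Proof.
by rewrite /M0 actfM // (ip_actfl full qM u_norm u_cocycle f fvec (factf f' fvec)).
Qed.

Let M0_bound f : nm (M0 f) <= 1 * nm (iota f).
Proof.
rewrite mul1r (le_trans (nm_ip fvec (factf f fvec))) // mn_vec mul1r.
apply: le_trans (act_norm_iota full qM u_norm u_cocycle f).
by have := act_norm_ub q full u_norm f fvec; rewrite mn_vec mulr1.
Qed.

Let M0_delta g : M0 (gdelta g) = coefficient g *: iota (gdelta g).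
Proof.
rewrite /M0 actf_term scale1r ip_vec; last exact: finsupp_act.
rewrite /coefficient scaler_suml; apply: eq_bigr => h _.
by rewrite /act /vec -scalerAr mulr1 !scalerA mulrA.
Qed.

(* The compression of x |-> x (x) 1 in the tensor product with the monomial   *)
(* representation of G on l^2(H) to the unit vector xi.                       *)
Theorem multiplier_exists : exists M : {linear E -> E},
  [/\ forall x, nm (M x) <= nm x,
      forall g, M (iota (gdelta g)) = coefficient g *: iota (gdelta g),
      forall x, pos (M (star x * x)) &
      forall x y, nm (M (star x * y)) ^+ 2 <=
        nm (M (star x * x)) * nm (M (star y * y))].
Proof.
pose m0 : {linear CG -> E} := HB.pack M0
  (GRing.isLinear.Build R[i] CG E *:%R M0 M0_linear).
have [M [Mi Mb]] := @dense_extension _ _ _ _ iota m0 1 ler01 (full_dense full) M0_bound.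
have M1 x : nm (M x) <= nm x by rewrite -[leRHS]mul1r.
have MD x y : M x - M y = M (x - y) by rewrite linearB.
have cvM (v : nat -> E) l : conv v l -> conv (fun n => M (v n)) (M l).
  by move=> hv; apply: (conv_map (K := 1) hv) => x y; rewrite MD mul1r.
have app x : exists2 v : nat -> CG, conv (fun n => iota (v n)) x & True.
  have /choice[v hv] n : exists a, nm (x - iota a) <= n.+1%:R^-1.
    by apply: (full_dense full); rewrite invr_gt0.
  exists v => // e e0; have [n0 hn] := ltr_add_invr (y := 0) e0.
  exists n0 => n hn'; rewrite add0r in hn; rewrite nm_subC.
  apply: le_trans (hv n) _; apply: le_trans (ltW hn).
  by rewrite lef_pV2 ?posrE // ler_nat.
(* M (x^* y) is a limit of inner products of vectors in the Hilbert module; positivity and the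
   Cauchy-Schwarz inequality are inherited from there. *)
have Mcv (v w : nat -> CG) x y : conv (fun n => iota (v n)) x ->
    conv (fun n => iota (w n)) y ->
    conv (fun n => ip (actf (v n) vec) (actf (w n) vec)) (M (star x * y)).
  move=> hv hw; have := cvM _ _ (convM (conv_star hv) hw).
  apply: conv_eq => n.
  by rewrite -(env_star full) -rmorphM -M0_starM; exact: Mi.
exists M; split=> //.
- by move=> g; rewrite -M0_delta; exact: Mi.
- move=> x; have [v hv _] := app x.
  by apply: pos_conv (Mcv _ _ _ _ hv hv) _ => n; apply: ip_pos; exact: factf.
- move=> x y; have [v hv _] := app x; have [w hw _] := app y.
  have cnm (z : nat -> E) l : conv z l -> ((nm (z n)) @[n --> \oo] --> nm l)%classic.
    move=> hz; apply/tozero_cvg => e /hz[n0 hn]; exists n0 => n /hn.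
    move=> /(le_trans _); apply; rewrite ler_norml.
    have := nmD (l - z n) (z n); have := nmD (z n - l) l.
    by rewrite !subrK (nm_subC l); move=> ? ?; apply/andP; split; lra.
  have c1 := cnm _ _ (Mcv _ _ _ _ hv hw).
  have c2 := cnm _ _ (Mcv _ _ _ _ hv hv); have c3 := cnm _ _ (Mcv _ _ _ _ hw hw).
  rewrite expr2; apply: (ler_cvg_to (cvgM c1 c1) (cvgM c2 c3)).
  by exists 0%N => // n _ /=; rewrite -expr2; apply: ip_cs; exact: factf.
Qed.

End Multiplier.

(** * Amenability *)

Section HahnBanach.
Context (R : realType) (V : lmodType R).
Implicit Types (p q : V -> R) (x y : V).

Definition sublinear p := (forall x y, p (x + y) <= p x + p y) /\
  (forall t x, 0 < t -> p (t *: x) = t * p x).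

Lemma sublinear0 p : sublinear p -> p 0 = 0.
Proof.
by move=> [_ pZ]; have := pZ 2 0 (ltr0Sn _ _); rewrite scaler0; lra.
Qed.

Section Infimum.
Context (J : Type) (j0 : J) (F : J -> V -> R).
Hypothesis F_lb : forall x, exists b, forall j, b <= F j x.
Hypothesis F_add : forall j j', exists k, forall x y,
  F k (x + y) <= F j x + F j' y.
Hypothesis F_scale : forall t j, 0 < t -> exists k, forall x,
  F k (t *: x) <= t * F j x.

(** The hypotheses on F are what three families have in common: a chain of sublinear functionals,
    the translates used to regularize a minimal one, and the gauge that separates in Reiter's
    condition. *)
Definition infimum x : R := inf (range (F ^~ x)).

Lemma infimum_le j x : infimum x <= F j x.
Proof.
apply: ge_inf; last by exists j.
by have [b hb] := F_lb x; exists b => _ [k _ <-].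
Qed.

Lemma le_infimum x b : (forall j, b <= F j x) -> b <= infimum x.
Proof.
move=> h; apply: lb_le_inf; first by exists (F j0 x), j0.
by move=> _ [j _ <-].
Qed.

Lemma infimum_sublinear : sublinear infimum.
Proof.
have sc t x : 0 < t -> infimum (t *: x) <= t * infimum x.
  move=> t0; rewrite mulrC -ler_pdivrMr //; apply: le_infimum => j.
  rewrite ler_pdivrMr // mulrC; have [k hk] := F_scale j t0.
  exact: le_trans (infimum_le k _) (hk x).
split=> [x y|t x t0].
  rewrite -lerBlDr; apply: le_infimum => j; rewrite lerBlDr -lerBlDl.
  apply: le_infimum => j'; rewrite lerBlDl; have [k hk] := F_add j j'.
  exact: le_trans (infimum_le k _) (hk x y).
apply/eqP; rewrite eq_le sc //= mulrC -ler_pdivlMr //.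
rewrite -{1}[x]scale1r -(mulVf (lt0r_neq0 t0)) -scalerA mulrC.
by apply: sc; rewrite invr_gt0.
Qed.

End Infimum.

Lemma sublinear_lb p q x : sublinear q -> (forall y, q y <= p y) ->
  - p (- x) <= q x.
Proof.
move=> qs qp; have q0 := sublinear0 qs; have [qD _] := qs.
by have := qD x (- x); rewrite subrr q0; have := qp (- x); lra.
Qed.

(* A minimal sublinear functional q is linear: q is at least its own          *)
(* regularization inf_(t >= 0) (q (x + t a) - t (q a)).                       *)
Theorem hahn_banach p : sublinear p ->
  exists L : V -> R, linear_for *%R L /\ forall x, L x <= p x.
Proof.
move=> ps; pose T := {q : V -> R | sublinear q /\ forall x, q x <= p x}.
pose mkT q (h1 : sublinear q) (h2 : forall x, q x <= p x) : T :=
  exist _ q (conj h1 h2).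
(* The order is reversed, so that a maximal element for Zorn's lemma is a minimal functional. *)
pose S (q q' : T) := `[< forall x, sval q' x <= sval q x >].
have lb (q : T) x : - p (- x) <= sval q x.
  by case: q => q [qs qp]; exact: sublinear_lb.
have [||||[q [[qD qZ] qp]] qmin] := @Zorn T S.
- by move=> q; apply/asboolP.
- by move=> q1 q2 q3 /asboolP h12 /asboolP h23; apply/asboolP => x;
    exact: le_trans (h23 x) (h12 x).
- move=> [q1 h1] [q2 h2] /asboolP /= h12 /asboolP /= h21; apply: eq_exist.
  by apply/funext => x; apply/eqP; rewrite eq_le h12 h21.
- move=> A totA; have [[q0 Aq0]|nA] := pselect (exists q : T, A q); last first.
    exists (mkT p ps (fun=> lexx _)) => q Aq.
    by case: nA; exists q.
  pose J := {q : T | A q}; pose F (j : J) := sval (sval j).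
  pose j0 : J := exist _ q0 Aq0.
  have Flb x : exists b, forall j, b <= F j x.
    by exists (- p (- x)) => j; exact: lb.
  have Fadd j j' : exists k, forall x y, F k (x + y) <= F j x + F j' y.
    have [/asboolP h|/asboolP h] := totA _ _ (svalP j) (svalP j').
    - exists j' => x y; have [[jD _] _] := svalP (sval j').
      by rewrite (le_trans (jD x y)) // lerD2r; exact: h.
    - exists j => x y; have [[jD _] _] := svalP (sval j).
      by rewrite (le_trans (jD x y)) // lerD2l; exact: h.
  have Fsc t j : 0 < t -> exists k, forall x, F k (t *: x) <= t * F j x.
    by move=> t0; exists j => x; have [[_ jZ] _] := svalP (sval j); rewrite /F jZ.
  have infp x : infimum F x <= p x.
    by apply: le_trans (infimum_le Flb j0 x) _; have [_] := svalP q0; exact.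
  exists (mkT _ (infimum_sublinear j0 Flb Fadd Fsc) infp) => q Aq.
  by apply/asboolP => x /=; exact: (infimum_le Flb (exist _ q Aq)).
have q0 : q 0 = 0 by exact: sublinear0.
have sup a x : q x + q a <= q (x + a).
  pose mkt (t : R) (t0 : 0 <= t) : {t : R | 0 <= t} := exist _ t t0.
  pose F (t : {t : R | 0 <= t}) x := q (x + sval t *: a) - sval t * q a.
  have qZ' t y : 0 <= t -> q (t *: y) = t * q y.
    rewrite le_eqVlt => /orP[/eqP <-|]; last exact: qZ.
    by rewrite scale0r mul0r.
  have Flb y : exists b, forall t, b <= F t y.
    exists (- q (- y)) => -[t t0] /=; rewrite /F /=.
    have := qD (y + t *: a) (- y); rewrite addrC addKr qZ' //; lra.
  have Fadd j j' : exists k, forall x y, F k (x + y) <= F j x + F j' y.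
    case: j j' => [t t0] [t' t0']; exists (mkt _ (addr_ge0 t0 t0')) => y z.
    rewrite /F /= scalerDl addrACA mulrDl.
    have := qD (y + t *: a) (z + t' *: a); lra.
  have Fsc t j : 0 < t -> exists k, forall x, F k (t *: x) <= t * F j x.
    move=> t0; case: j => [t' t0'].
    exists (mkt _ (mulr_ge0 (ltW t0) t0')) => y; rewrite /F /=.
    by rewrite -scalerA -scalerDr qZ // mulrBr mulrA.
  have j0 : {t : R | 0 <= t} by exists 0.
  have leq y : infimum F y <= q y.
    apply: le_trans (infimum_le Flb (mkt _ (lexx 0)) y) _.
    by rewrite /F /= scale0r addr0 mul0r subr0.
  have lep y : infimum F y <= p y by exact: le_trans (leq y) (qp y).
  pose q' : T := mkT _ (infimum_sublinear j0 Flb Fadd Fsc) lep.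
  have /(congr1 sval)/= e : q' = exist _ q (conj (conj qD qZ) qp).
    by apply: qmin; apply/asboolP => y; exact: leq.
  (* By minimality q coincides with its regularization, whose member at t = 1 gives q x <= q (x + a)
     - q a. *)
  rewrite -[X in X + _](congr1 (@^~ x) e).
  have := infimum_le Flb (mkt _ ler01) x.
  by rewrite /F /= scale1r mul1r lerBrDr.
have add x y : q (x + y) = q x + q y.
  by apply/eqP; rewrite eq_le qD sup.
have opp x : q (- x) = - q x.
  by have := add x (- x); rewrite subrr q0; lra.
exists q; split=> // t x y; rewrite add; congr (_ + _).
have [t0|t0|->] := ltgtP t 0; last by rewrite scale0r mul0r.
- have := qZ (- t) x; rewrite oppr_gt0 scaleNr opp => /(_ t0); lra.
- by rewrite qZ.
Qed.

End HahnBanach.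

(** * Finitely supported functions and Reiter's condition *)

Section L1Norm.
Context (R : realType) (K : choiceType).
Implicit Types (v w : {malg R[K]}) (d : {fset K}).

Definition l1norm v : R := \sum_(x <- msupp v) `|v@_x|.

Lemma l1normw d v : (msupp v `<=` d)%fset -> l1norm v = \sum_(x <- d) `|v@_x|.
Proof.
move=> le; apply/big_fset_incl => // x _ /mcoeff_outdom ->.
by rewrite normr0.
Qed.

Lemma l1norm_ge0 v : 0 <= l1norm v.
Proof. exact: sumr_ge0. Qed.

Lemma l1normD v w : l1norm (v + w) <= l1norm v + l1norm w.
Proof.
rewrite (@l1normw (msupp v `|` msupp w)%fset) ?msuppD_le //.
rewrite (@l1normw (msupp v `|` msupp w)%fset v) ?fsubsetUl //.
rewrite (@l1normw (msupp v `|` msupp w)%fset w) ?fsubsetUr //.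
rewrite -big_split /=; apply: ler_sum => x _.
by rewrite mcoeffD ler_normD.
Qed.

Lemma l1normZ (t : R) v : l1norm (t *: v) = `|t| * l1norm v.
Proof.
rewrite (@l1normw (msupp v)) ?msuppZ_le // /l1norm mulr_sumr.
by apply/eq_bigr => x _; rewrite mcoeffZ normrM.
Qed.

Lemma l1norm0 : l1norm 0 = 0.
Proof. by rewrite /l1norm msupp0 big_seq_fset0. Qed.

Lemma l1normN v : l1norm (- v) = l1norm v.
Proof. by rewrite -scaleN1r l1normZ normrN1 mul1r. Qed.

Lemma l1normU x : l1norm (mkmalgU x 1) = 1.
Proof. by rewrite (l1normw msuppU_le) big_seq_fset1 mcoeffUU normr1. Qed.

Lemma sum_coef_le (I : choiceType) (f : I -> K) (d : {fset I}) v :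
  injective f -> \sum_(h <- d) `|v@_(f h)| <= l1norm v.
Proof.
move=> finj; pose e := [fset f h | h in d]%fset.
rewrite (@l1normw (msupp v `|` e)%fset) ?fsubsetUl //.
have -> : \sum_(h <- d) `|v@_(f h)| = \sum_(x <- e) `|v@_x|.
  by rewrite /e big_imfset //= => x y _ _; exact: finj.
rewrite [leRHS](big_fsetID _ (fun x => x \in e)) /=.
have -> : [fset x in (msupp v `|` e)%fset | x \in e]%fset = e.
  apply/fsetP => x; rewrite !inE; case: (boolP (x \in e)) => xe /=.
    by rewrite orbT.
  by rewrite andbF.
by rewrite lerDl sumr_ge0.
Qed.

End L1Norm.

Section Reiter.
Context (R : realType) (H : groupType).

Let bounded_funP (f : H -> R) (K : R) : (forall x, `|f x| <= K) -> bounded_fun f.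
Proof.
move=> h; exists K; split; first exact: num_real.
by move=> M KM x _; exact: le_trans (h x) (ltW KM).
Qed.

Lemma mean_ge (m : (H -> R) -> R) (f : H -> R) (e K : R) : invariant_mean m ->
  (forall x, `|f x| <= K) -> (forall x, e <= f x) -> e <= m f.
Proof.
move=> mm fK ef.
have bf := bounded_funP fK.
have b1 : bounded_fun (fun _ : H => 1 : R).
  by apply: (bounded_funP (K := 1)) => x; rewrite normr1.
have := mean_ge0 mm (f := fun x => (- e) * 1 + f x).
rewrite (mean_linear mm) // (mean1 mm) mulr1 addrC subr_ge0; apply=> [|x].
  apply: (bounded_funP (K := `|e| + K)) => x.
  by rewrite (le_trans (ler_normD _ _)) // normrN lerD2l.
by rewrite addrC subr_ge0.
Qed.

Lemma mean_coboundary (m : (H -> R) -> R) (s : seq H) (u : H -> H -> R) (K : R) :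
  invariant_mean m -> (forall g h, `|u g h| <= K) ->
  m (fun k => \sum_(g <- s) (u g (g * k)%g - u g k)) = 0.
Proof.
move=> mm uK; elim: s => [|g s IH].
  have b0 : bounded_fun (fun _ : H => 0 : R).
    by apply: (bounded_funP (K := 0)) => x; rewrite normr0.
  under eq_fun do rewrite big_nil.
  have := mean_linear mm 1 b0 b0.
  under eq_fun do rewrite mulr0 addr0.
  by lra.
have bu : bounded_fun (u g) by exact: bounded_funP (uK g).
have bug : bounded_fun (fun k => u g (g * k)%g).
  by apply: (bounded_funP (K := K)) => k; exact: uK.
pose f k := \sum_(g <- s) (u g (g * k)%g - u g k).
have bf : bounded_fun f.
  apply: (bounded_funP (K := \sum_(g <- s) (K + K))) => k.
  apply: (le_trans (ler_norm_sum _ _ _)); apply: ler_sum => g' _.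
  by rewrite (le_trans (ler_normB _ _)) // lerD.
have bh : bounded_fun (fun k => 1 * u g (g * k)%g + f k).
  apply: (bounded_funP (K := K + \sum_(g <- s) (K + K))) => k.
  rewrite mul1r (le_trans (ler_normD _ _)) // lerD //.
  apply: (le_trans (ler_norm_sum _ _ _)); apply: ler_sum => g' _.
  by rewrite (le_trans (ler_normB _ _)) // lerD.
have -> : (fun k => \sum_(g' <- g :: s) (u g' (g' * k)%g - u g' k)) =
    (fun k => (- 1) * u g k + (1 * u g (g * k)%g + f k)).
  by apply/funext => k; rewrite big_cons mul1r mulN1r addrA [- _ + _]addrC.
rewrite (mean_linear mm) // (mean_linear mm) // (mean_invariant mm) // IH.
by rewrite addr0 mul1r mulN1r addNr.
Qed.

(** A positive combination nu of points of H has a coboundary D nu in l^1(H x H), the first factor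
    recording g so that all of s is treated at once. If ||D nu|| is small relative to the mass of
    nu, normalizing nu gives mu. Otherwise Hahn-Banach gives L <= ||.|| with L (x k) >= e for all k;
    then k |-> L (x k) is a sum of coboundaries of bounded functions, so its mean is 0, although it
    is at least e. *)
Theorem reiter (s : seq H) (e : R) : amenable R H -> 0 < e -> uniq s ->
  exists (d : {fset H}) (mu : H -> R),
  [/\ forall h, 0 <= mu h, forall h, h \notin d -> mu h = 0,
      \sum_(h <- d) mu h = 1 &
      forall g, g \in s -> forall d' : {fset H},
        \sum_(h <- d') `|mu (g^-1 * h)%g - mu h| <= e].
Proof.
move=> [m mm] e0 us.
pose dl (g h : H) : {malg R[(H * H)%type]} := mkmalgU (g, h) 1.
pose x k := \sum_(g <- s) (dl g (g * k)%g - dl g k).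
pose D (nu : seq (R * H)%type) := \sum_(tk <- nu) tk.1 *: x tk.2.
pose mass (nu : seq (R * H)%type) := \sum_(tk <- nu) tk.1.
pose nneg (nu : seq (R * H)%type) := forall tk, tk \in nu -> 0 <= tk.1.
have [[nu [nu0 nuD]]|noapp] := pselect (exists nu, nneg nu /\ l1norm (D nu) < e * mass nu).
  have M0 : 0 < mass nu.
    by have := le_lt_trans (l1norm_ge0 _) nuD; rewrite pmulr_rgt0.
  pose mu h := (mass nu)^-1 * \sum_(tk <- nu) tk.1 * (tk.2 == h)%:R.
  exists [fset h | h in map snd nu]%fset, mu; split.
  - move=> h; rewrite /mu mulr_ge0 ?invr_ge0 ?(ltW M0) //.
    by rewrite big_seq sumr_ge0 // => tk tkn; rewrite mulr_ge0 // nu0.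
  - move=> h hn; rewrite /mu big_seq big1 ?mulr0 // => tk tkn.
    case: eqP => [E|]; last by rewrite mulr0.
    case/negP: hn; apply/imfsetP; exists h => //=; rewrite -E.
    by apply/mapP; exists tk.
  - rewrite /mu -mulr_sumr exchange_big /= (_ : \sum_(tk <- nu) _ = mass nu).
      by rewrite mulVf ?gt_eqF.
    rewrite /mass big_seq [RHS]big_seq; apply: eq_bigr => tk tkn.
    rewrite -mulr_sumr (big_fsetD1 tk.2) /=; last first.
      by apply/imfsetP; exists tk.2 => //=; apply/mapP; exists tk.
    rewrite eqxx big1_fset ?addr0 ?mulr1 // => h; rewrite in_fsetD1 => /andP[].
    by rewrite eq_sym => /negbTE -> _ _.
  - move=> g gs d'.
    have coefE h : (D nu)@_(g, h) = mass nu * (mu (g^-1 * h)%g - mu h).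
      rewrite /D raddf_sum /= /mu -mulrBr mulrA divff ?gt_eqF // mul1r -sumrB.
      apply: eq_bigr => tk _; rewrite mcoeffZ -mulrBr; congr (_ * _).
      rewrite /x raddf_sum /= (bigD1_seq g) //= big1 ?addr0 => [|g' g'g].
        rewrite mcoeffB !mcoeffU !xpair_eqE eqxx /=.
        by rewrite (can2_eq (mulKg g) (mulVKg g)).
      rewrite mcoeffB !mcoeffU !xpair_eqE (negbTE g'g) /=.
      by rewrite subrr.
    rewrite -(ler_pM2l M0) mulr_sumr.
    rewrite (eq_bigr (fun h => `|(D nu)@_(g, h)|)) => [|h _]; last first.
      by rewrite coefE normrM (gtr0_norm M0).
    apply: le_trans (sum_coef_le _ _ _) _; first by move=> h h' [].
    by rewrite mulrC ltW.
exfalso.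
pose J := {nu : seq (R * H)%type | nneg nu}.
(* The assumed inequality e mass(nu) <= ||D nu|| is what bounds this family below by - ||v||. *)
pose F (j : J) v := l1norm (v + D (sval j)) - e * mass (sval j).
have Dcat nu nu' : D (nu ++ nu') = D nu + D nu' by rewrite /D big_cat.
have Mcat nu nu' : mass (nu ++ nu') = mass nu + mass nu' by rewrite /mass big_cat.
pose sc t (nu : seq (R * H)%type) := [seq (t * tk.1, tk.2) | tk <- nu].
have Dsc t nu : D (sc t nu) = t *: D nu.
  by rewrite /D big_map scaler_sumr; apply: eq_bigr => tk _; rewrite scalerA.
have Msc t nu : mass (sc t nu) = t * mass nu.
  by rewrite /mass big_map mulr_sumr.
have nil0 : nneg [::] by [].
pose j0 : J := exist _ [::] nil0.
have Flb v : exists b, forall j, b <= F j v.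
  exists (- l1norm v) => -[nu nu0]; rewrite /F /=.
  have : e * mass nu <= l1norm (D nu).
    by rewrite leNgt; apply/negP => h; apply: noapp; exists nu.
  have := l1normD (v + D nu) (- v); rewrite addrAC subrr add0r l1normN; lra.
have Fadd j j' : exists k, forall v w, F k (v + w) <= F j v + F j' w.
  case: j j' => [nu n0] [nu' n0'].
  have nn : nneg (nu ++ nu').
    by move=> tk; rewrite mem_cat => /orP[/n0|/n0'].
  exists (exist _ _ nn) => v w; rewrite /F /= Dcat Mcat addrACA.
  have := l1normD (v + D nu) (w + D nu'); rewrite mulrDr; lra.
have Fsc t j : 0 < t -> exists k, forall v, F k (t *: v) <= t * F j v.
  move=> t0; case: j => [nu n0].
  have nn : nneg (sc t nu).
    by move=> _ /mapP[tk /n0 h ->] /=; rewrite mulr_ge0 // ltW.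
  exists (exist _ _ nn) => v; rewrite /F /= Dsc Msc -scalerDr l1normZ.
  by rewrite (gtr0_norm t0) mulrBr mulrCA.
have [L [Llin Lle]] := hahn_banach (infimum_sublinear j0 Flb Fadd Fsc).
have LD v w : L (v + w) = L v + L w.
  by have := Llin 1 v w; rewrite scale1r mul1r.
have L0 : L 0 = 0 by have := LD 0 0; rewrite addr0; lra.
have LN v : L (- v) = - L v by have := LD v (- v); rewrite subrr L0; lra.
have Ln v : L v <= l1norm v.
  apply: le_trans (Lle v) _; apply: le_trans (infimum_le Flb j0 v) _.
  by rewrite /F /D /mass /= !big_nil addr0 mulr0 subr0.
have Lx k : e <= L (x k).
  have nn : nneg [:: (1, k)] by move=> tk; rewrite inE => /eqP ->; exact: ler01.
  have := le_trans (Lle (- x k)) (infimum_le Flb (exist _ _ nn) (- x k)).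
  rewrite /F /D /mass /= !big_seq1 /= scale1r addNr l1norm0 mulr1 sub0r LN.
  by rewrite lerN2.
pose u g h := L (dl g h).
have uK g h : `|u g h| <= 1.
  rewrite ler_norml; apply/andP; split.
    by rewrite lerNl -LN (le_trans (Ln _)) // l1normN l1normU.
  by rewrite (le_trans (Ln _)) // l1normU.
have LxE k : L (x k) = \sum_(g <- s) (u g (g * k)%g - u g k).
  rewrite /x; elim: (s) => [|g s' IH]; first by rewrite !big_nil.
  by rewrite !big_cons LD IH LD LN.
have : e <= 0.
  rewrite -(mean_coboundary s mm uK).
  apply: (mean_ge (K := \sum_(g <- s) (1 + 1)) mm) => k; last by rewrite -LxE.
  apply: (le_trans (ler_norm_sum _ _ _)); apply: ler_sum => g' _.
  by rewrite (le_trans (ler_normB _ _)) // lerD.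
by rewrite leNgt e0.
Qed.

End Reiter.

(** Take xi = sqrt mu: then |sqrt a - sqrt b|^2 <= |a - b| passes from l^1 to l^2, and ||g xi -
    xi||^2 = 2 (1 - <xi, g xi>) for a real unit vector. *)
Lemma almost_invariant_vector (R : realType) (H : groupType) (s : seq H) (e : R) :
  amenable R H -> 0 < e -> exists (d : {fset H}) (xi : H -> R),
  [/\ forall h, h \notin d -> xi h = 0, \sum_(h <- d) xi h ^+ 2 = 1 &
      forall g, g \in s ->
        `|1 - \sum_(h <- d) xi h * xi (g^-1 * h)%g| <= e].
Proof.
move=> am e0; have [d [mu [mu0 mud mu1 mus]]] := reiter am e0 (undup_uniq s).
pose xi h := Num.sqrt (mu h).
have xi2 h : xi h ^+ 2 = mu h by rewrite sqr_sqrtr.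
have xid h : h \notin d -> xi h = 0 by move=> /mud hd; rewrite /xi hd sqrtr0.
exists d, xi; split=> // [|g gs]; first by under eq_bigr do rewrite xi2.
pose gd := [fset (g * h)%g | h in d]%fset.
pose d' := (d `|` gd)%fset.
have gdN h : h \notin gd -> xi (g^-1 * h)%g = 0.
  move=> hd; apply: xid; apply: contra hd => hd.
  by apply/imfsetP; exists (g^-1 * h)%g => //=; rewrite mulVKg.
have s1 : \sum_(h <- d') xi h ^+ 2 = 1.
  rewrite -mu1 (eq_bigr mu) => [|h _]; last exact: xi2.
  apply/esym/big_fset_incl => [|h _ /mud //]; exact: fsubsetUl.
have s2 : \sum_(h <- d') xi (g^-1 * h)%g ^+ 2 = 1.
  rewrite -mu1; transitivity (\sum_(h <- gd) xi (g^-1 * h)%g ^+ 2).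
    apply/esym/big_fset_incl => [|h _ /gdN ->]; first exact: fsubsetUr.
    by rewrite expr0n.
  rewrite big_imfset /=; last by move=> x y _ _; exact: mulgI.
  by apply: eq_bigr => h _; rewrite mulKg xi2.
have -> : \sum_(h <- d) xi h * xi (g^-1 * h)%g = \sum_(h <- d') xi h * xi (g^-1 * h)%g.
  apply: big_fset_incl => [|h _ /xid ->]; first exact: fsubsetUl.
  by rewrite mul0r.
set S := \sum_(h <- d') _.
have E : \sum_(h <- d') (xi (g^-1 * h)%g - xi h) ^+ 2 = 2 * (1 - S).
  transitivity (\sum_(h <- d') xi (g^-1 * h)%g ^+ 2 + \sum_(h <- d') xi h ^+ 2 - 2 * S).
    rewrite /S mulr_sumr -big_split -sumrB /=; apply: eq_bigr => h _; ring.
  by rewrite s1 s2; ring.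
have S0 : 0 <= 2 * (1 - S) by rewrite -E sumr_ge0 // => h _; exact: sqr_ge0.
rewrite ger0_norm; last lra.
suff : 2 * (1 - S) <= e by move: S0; lra.
have gs' : g \in undup s by rewrite mem_undup.
apply: le_trans (mus g gs' d'); rewrite -E; apply: ler_sum => h _.
rewrite -!xi2 subr_sqr normrM -[leLHS]ger0_norm ?sqr_ge0 // expr2 normrM.
apply: ler_wpM2l => //; rewrite (le_trans (ler_normB _ _)) //.
by rewrite !ger0_norm ?addr_ge0 ?sqrtr_ge0.
Qed.

(** * Characters of torsion-free abelian groups *)

Section RealCharacters.
Context (R : realType) (N : groupType).
Hypothesis mulNC : forall x y : N, (x * y = y * x)%g.
Hypothesis tfN : torsion_free N.
Implicit Types (x y : N) (r s : R).

Let graph := N -> R -> Prop.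

(** A homomorphism from a subgroup of N to R, encoded as a subgroup of N x R; meeting 1 x R
    trivially suffices for it to be single-valued. *)
Definition partial_hom (P : graph) := [/\ P 1%g 0,
  forall x r y s, P x r -> P y s -> P (x * y^-1)%g (r - s) &
  forall r, P 1%g r -> r = 0].

Lemma partial_homX (P : graph) x r k : partial_hom P -> P x r ->
  P (x ^+ k)%g (k%:R * r).
Proof.
move=> [P1 PB _] Pxr; elim: k => [|k IH]; first by rewrite expg0 mul0r.
have := PB _ _ _ _ IH (PB _ _ _ _ P1 Pxr).
by rewrite mul1g invgK sub0r opprK expgSr mulrSr mulrDl mul1r.
Qed.

Lemma partial_hom_uniq (P : graph) x r s : partial_hom P -> P x r -> P x s -> r = s.
Proof.
move=> [_ PB P0] Pr Ps; apply/eqP; rewrite -subr_eq0; apply/eqP/P0.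
by rewrite -(mulgV x); exact: PB.
Qed.

(** The extended graph consists of the (y x^(a-b), s + (a - b) r) with (y, s) in P; a pair of
    natural exponents stands for the integer a - b. The hypothesis settles the value at 1, where a
    power of x lies in the domain of P. *)
Lemma partial_hom_extend (P : graph) x r : partial_hom P ->
  (forall k v, (0 < k)%N -> P (x ^+ k)%g v -> v = k%:R * r) ->
  exists2 Q : graph, partial_hom Q & (forall y s, P y s -> Q y s) /\ Q x r.
Proof.
move=> ph hx; have [P1 PB P0] := ph.
exists (fun z t => exists y s a b, [/\ P y s, (z * x ^+ b = y * x ^+ a)%g &
    t = s + (a%:R - b%:R) * r]).
  split.
  - by exists 1%g, 0, 0%N, 0%N; split=> //; rewrite subrr mul0r addr0.
  - move=> z1 t1 z2 t2 [y1 [s1 [a1 [b1 [p1 e1 ->]]]]] [y2 [s2 [a2 [b2 [p2 e2 ->]]]]].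
    exists (y1 * y2^-1)%g, (s1 - s2), (a1 + b2)%N, (b1 + a2)%N; split.
    + exact: PB.
    + have z2E : (z2 = y2 * x ^+ a2 * (x ^+ b2)^-1)%g by rewrite -e2 mulgK.
      have z1E : (z1 = y1 * x ^+ a1 * (x ^+ b1)^-1)%g by rewrite -e1 mulgK.
      rewrite z1E z2E !invgM invgK !expgnDr -!mulgA; congr (y1 * _)%g.
      move: (x ^+ a1)%g (x ^+ a2)%g (x ^+ b1)%g (x ^+ b2)%g => A1 A2 B1 B2.
      have CA (u v w : N) : (u * (v * w) = v * (u * w))%g.
        by rewrite !mulgA (mulNC u).
      rewrite (CA A2^-1%g) (CA B2 y2^-1%g) (CA B1^-1%g y2^-1%g) (CA A1 y2^-1%g).
      congr (_ * (_ * _))%g.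
      by rewrite (CA A2^-1%g) mulVg mulg1 (mulNC B2) mulKg.
    + by rewrite !natrD; ring.
  - move=> t [y [s [a [b [p]]]]]; rewrite mul1g => e ->.
    have [ab|ab|ab] := ltngtP a b.
    + have yE : (y = x ^+ (b - a))%g.
        by rewrite -(mulgK (x ^+ a)%g y) -e -{1}(subnK (ltnW ab)) expgnDr mulgK.
      move: p; rewrite yE => /hx; rewrite subn_gt0 => /(_ ab) ->.
      by rewrite natrB ?(ltnW ab) //; ring.
    + have yE : (1 * y^-1 = x ^+ (a - b))%g.
        apply: (mulIg (x ^+ b)%g); rewrite -expgnDr subnK ?(ltnW ab) // mul1g.
        by rewrite e mulKg.
      have := PB _ _ _ _ P1 p; rewrite yE sub0r => /hx; rewrite subn_gt0 => /(_ ab).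
      rewrite natrB ?(ltnW ab) // => E; have -> : s = - ((a%:R - b%:R) * r).
        by rewrite -E opprK.
      by ring.
    + move: e p; rewrite ab -[X in X = _]mul1g => /mulIg <- /P0 ->.
      by rewrite subrr mul0r addr0.
split=> [y s p|].
  by exists y, s, 0%N, 0%N; split=> //; rewrite subrr mul0r addr0.
exists 1%g, 0, 1%N, 0%N; split=> //.
by rewrite subr0 mul1r add0r.
Qed.

(** Divisibility of R: if P has a value v at some x^k, then r = v / k is consistent with all other
    powers of x; if there is none, any r does. *)
Lemma partial_hom_extend_any (P : graph) x : partial_hom P ->
  exists2 Q : graph, partial_hom Q & (forall y s, P y s -> Q y s) /\ exists r, Q x r.
Proof.
move=> ph; suff [r hr] : exists r, forall k v, (0 < k)%N -> P (x ^+ k)%g v -> v = k%:R * r.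
  by have [Q hQ [PQ Qx]] := partial_hom_extend ph hr; exists Q => //; split=> //; exists r.
have [[k [v [k0 Pkv]]]|no] := pselect (exists k v, (0 < k)%N /\ P (x ^+ k)%g v).
  exists (v / k%:R) => k' v' k'0 Pkv'.
  have k0' : k%:R != 0 :> R by rewrite pnatr_eq0 -lt0n.
  have := partial_homX k ph Pkv'; rewrite -expgnA mulnC expgnA => h.
  have := partial_hom_uniq ph h (partial_homX k' ph Pkv) => E.
  by apply: (mulfI k0'); rewrite E; field.
by exists 0 => k v k0 Pkv; case: no; exists k, v.
Qed.

Theorem real_character (n : N) : n <> 1%g ->
  exists phi : N -> R, (forall x y, phi (x * y)%g = phi x + phi y) /\ phi n = 1.
Proof.
move=> n1; pose T := {P : graph | partial_hom P /\ P n 1}.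
pose S (P Q : T) := `[< forall x r, sval P x r -> sval Q x r >].
(* The homomorphism on the trivial group extends to n with value 1, since n^k = 1 never happens for
   k > 0. *)
have [P0 hP0 [_ P0n]] : exists2 Q : graph, partial_hom Q &
    (forall y s, (y = 1%g /\ s = 0) -> Q y s) /\ Q n 1.
  apply: partial_hom_extend.
    split=> // [x r y s [-> ->] [-> ->]|r []//].
    by rewrite mulgV subrr.
  by move=> k v k0 [/(tfN k0)].
have [||||[P [ph Pn]] Pmax] := @Zorn T S.
- by move=> P; apply/asboolP.
- by move=> P Q U /asboolP h1 /asboolP h2; apply/asboolP => x r /h1/h2.
- move=> [P hP] [Q hQ] /asboolP /= h1 /asboolP /= h2; apply: eq_exist.
  by apply/funext => x; apply/funext => r; apply/propext; split=> [/h1|/h2].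
- move=> A totA; have [[Q0 AQ0]|nA] := pselect (exists Q : T, A Q); last first.
    exists (exist _ P0 (conj hP0 P0n)) => Q AQ.
    by case: nA; exists Q.
  pose U x r := exists2 Q : T, A Q & sval Q x r.
  have Uh : partial_hom U.
    split.
    + by exists Q0 => //; case: (svalP Q0) => -[].
    + move=> x r y s [Q1 A1 h1] [Q2 A2 h2].
      have [/asboolP h|/asboolP h] := totA _ _ A1 A2.
        exists Q2 => //; case: (svalP Q2) => -[_ QB _] _; apply: QB => //; exact: h.
      exists Q1 => //; case: (svalP Q1) => -[_ QB _] _; apply: QB => //; exact: h.
    + by move=> r [Q _ h]; case: (svalP Q) => -[_ _ Q0'] _; exact: Q0'.
  have Un : U n 1 by exists Q0 => //; case: (svalP Q0).
  exists (exist _ U (conj Uh Un)) => Q AQ.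
  by apply/asboolP => x r h; exists Q.
have tot x : exists r, P x r.
  have [Q hQ [PQ [r Qr]]] := partial_hom_extend_any x ph.
  have : exist _ Q (conj hQ (PQ _ _ Pn)) = exist _ P (conj ph Pn) :> T.
    by apply: Pmax; apply/asboolP.
  by move=> /(congr1 sval)/= QP; exists r; rewrite -QP.
have [phi hphi] := choice tot; exists phi; split.
  move=> x y; have [P1 PB _] := ph; apply: (partial_hom_uniq ph (hphi _)).
  have := PB _ _ _ _ (hphi x) (PB _ _ _ _ P1 (hphi y)).
  by rewrite mul1g invgK sub0r opprK.
exact: (partial_hom_uniq ph (hphi n)).
Qed.

End RealCharacters.

(** * Expectations *)

Section BoundedLinear.
Context (R : realType).

(** A predicate on bare functions rather than a structure, so that maps such as
    [fun x => T (a * x * b)] need no packing. *)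
Definition blin (A B : normedStarAlgType R[i]) (f : A -> B) :=
  [/\ forall x y, f (x + y) = f x + f y,
      forall c x, f (c *: x) = c *: f x &
      exists2 K : R, 0 <= K & forall x, nm (f x) <= K * nm x].

Context (A B D : normedStarAlgType R[i]).
Implicit Types (f g : A -> B).

Lemma blin_id : blin (@id A).
Proof. by split=> //; exists 1 => // x; rewrite mul1r. Qed.

Lemma blin_linear (f : {linear A -> B}) (K : R) : 0 <= K ->
  (forall x, nm (f x) <= K * nm x) -> blin f.
Proof. by move=> K0 fK; split=> [x y|c x|]; rewrite ?linearD ?linearZ //; exists K. Qed.

Lemma blin_comp f (g : B -> D) : blin f -> blin g -> blin (g \o f).
Proof.
move=> [fD fZ [K K0 fK]] [gD gZ [L L0 gL]]; split=> [x y|c x|] /=.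
- by rewrite fD gD.
- by rewrite fZ gZ.
- exists (L * K) => [|x]; first exact: mulr_ge0.
  by rewrite (le_trans (gL _)) // -mulrA ler_wpM2l.
Qed.

Lemma blin_mull f a : blin f -> blin (fun x => a * f x).
Proof.
move=> [fD fZ [K K0 fK]]; split=> [x y|c x|].
- by rewrite fD mulrDr.
- by rewrite fZ scalerAr.
- exists (nm a * K) => [|x]; first by rewrite mulr_ge0 ?nm_ge0.
  by rewrite (le_trans (nmM _ _)) // -mulrA ler_wpM2l ?nm_ge0.
Qed.

Lemma blin_mulr f a : blin f -> blin (fun x => f x * a).
Proof.
move=> [fD fZ [K K0 fK]]; split=> [x y|c x|].
- by rewrite fD mulrDl.
- by rewrite fZ scalerAl.
- exists (nm a * K) => [|x]; first by rewrite mulr_ge0 ?nm_ge0.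
  by rewrite (le_trans (nmM _ _)) // mulrC -mulrA ler_wpM2l ?nm_ge0.
Qed.

Lemma blin_scale f (c : R[i]) : blin f -> blin (fun x => c *: f x).
Proof.
move=> [fD fZ [K K0 fK]]; split=> [x y|c' x|].
- by rewrite fD scalerDr.
- by rewrite fZ !scalerA mulrC.
- have c0 : 0 <= normc c by rewrite -ler0c; exact: (@normr_ge0 _ _ c).
  exists (normc c * K) => [|x]; first exact: mulr_ge0.
  by rewrite nmZ -mulrA ler_wpM2l.
Qed.

Lemma blin_add f g : blin f -> blin g -> blin (fun x => f x + g x).
Proof.
move=> [fD fZ [K K0 fK]] [gD gZ [L L0 gL]]; split=> [x y|c x|].
- by rewrite fD gD addrACA.
- by rewrite fZ gZ scalerDr.
- exists (K + L) => [|x]; first exact: addr_ge0.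
  by rewrite (le_trans (nmD _ _)) // mulrDl lerD.
Qed.

Lemma blin0 : blin (fun _ : A => 0 : B).
Proof.
split=> [x y|c x|]; rewrite ?addr0 ?scaler0 //.
by exists 0 => // x; rewrite nm0 mul0r.
Qed.

Lemma blin_sum (I : Type) (s : seq I) (F : I -> A -> B) :
  (forall i, blin (F i)) -> blin (fun x => \sum_(i <- s) F i x).
Proof.
move=> h; elim: s => [|i s IH].
  by under eq_fun do rewrite big_nil; exact: blin0.
by under eq_fun do rewrite big_cons; exact: blin_add.
Qed.

Lemma blin_star f : blin f -> blin (fun x => star (f (star x))).
Proof.
move=> [fD fZ [K K0 fK]]; split=> [x y|c x|].
- by rewrite starD fD starD.
- by rewrite starZ fZ starZ conjCK.
- by exists K => // x; rewrite nm_star -(nm_star x).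
Qed.

Lemma blinB f x y : blin f -> f (x - y) = f x - f y.
Proof. by move=> [fD fZ _]; rewrite fD -scaleN1r fZ scaleN1r. Qed.

Lemma blin_at0 f : blin f -> f 0 = 0.
Proof. by move=> [_ fZ _]; rewrite -(scale0r 0) fZ scale0r. Qed.

Lemma blin_conv f (u : nat -> A) l : blin f -> conv u l ->
  conv (fun n => f (u n)) (f l).
Proof.
move=> bf hu; have [_ _ [K K0 fK]] := bf.
by apply: (conv_map (K := K) hu) => x y; rewrite -(blinB _ _ bf).
Qed.

End BoundedLinear.

Lemma linear_gterm (C : numClosedFieldType) (G : groupType) (V : lmodType C)
    (f : {linear group_algebra C G -> V}) c g :
  f (gterm c g) = c *: f (gdelta g).
Proof. by rewrite gtermZ linearZ. Qed.

Section Generators.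
Context (R : realType) (G : groupType) (E : cstarAlgType R[i]).
Context (iota : {lrmorphism group_algebra R[i] G -> E}).
Hypothesis full : is_full_group_cstar iota.

Definition gen (g : G) : E := iota (gdelta g).

Lemma genM g h : gen (g * h)%g = gen g * gen h.
Proof. by rewrite /gen -gdeltaM rmorphM. Qed.

Lemma gen1 : gen 1%g = 1.
Proof. by rewrite /gen gdelta1 rmorph1. Qed.

Lemma gen_star g : star (gen g) = gen (g^-1)%g.
Proof. by rewrite /gen -(env_star full) gdelta_star. Qed.

Lemma nm_gen g : nm (gen g) = 1.
Proof. by apply: unitary_nm; rewrite gen_star -genM mulVg gen1. Qed.

Lemma blin_term (B : cstarAlgType R[i]) (f : E -> B) (a : group_algebra R[i] G) :
  blin f -> f (iota a) = \sum_(g <- msupp a) a@_g *: f (gen g).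
Proof.
move=> [fD fZ _]; have f0 : f 0 = 0 by rewrite -(scale0r 0) fZ scale0r.
rewrite {1}[a]ga_expand.
have -> : \sum_(g <- msupp a) mkmalgU g a@_g = \sum_(g <- msupp a) gterm a@_g g by [].
rewrite (raddf_sum iota) (big_morph f fD f0); apply: eq_bigr => g _.
by rewrite -fZ; congr f; exact: (linear_gterm iota).
Qed.

Lemma full_conv x : exists u : nat -> group_algebra R[i] G,
  conv (fun n => iota (u n)) x.
Proof.
have /choice[v hv] n : exists a, nm (x - iota a) <= n.+1%:R^-1.
  by apply: (full_dense full); rewrite invr_gt0.
exists v => // e e0; have [n0 hn] := ltr_add_invr (y := 0) e0.
exists n0 => n hn'; rewrite add0r in hn; rewrite nm_subC.
apply: le_trans (hv n) _; apply: le_trans (ltW hn).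
by rewrite lef_pV2 ?posrE // ler_nat.
Qed.

(** The span of the group elements is dense. Identities between expectations are checked on
    generators by means of this lemma. *)
Lemma blin_eq (B : cstarAlgType R[i]) (f f' : E -> B) : blin f -> blin f' ->
  (forall g, f (gen g) = f' (gen g)) -> forall x, f x = f' x.
Proof.
move=> bf bf' h x; have [u hu] := full_conv x.
apply: (conv_uniq (blin_conv bf hu)).
apply: conv_eq (blin_conv bf' hu) => n.
by rewrite !blin_term //; apply: eq_bigr => g _; rewrite h.
Qed.

End Generators.

(** * Functoriality of C*(G) in the group *)

Section PushForward.
Context (C : numClosedFieldType) (G H : groupType) (q : G -> H).
Hypothesis qM : {morph q : x y / (x * y)%g}.
Local Notation CG := (group_algebra C G).
Local Notation CH := (group_algebra C H).

Let q1 : q 1%g = 1%g.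
Proof. by apply: (mulgI (q 1%g)); rewrite -qM !mulg1. Qed.

Let qV g : q (g^-1)%g = ((q g)^-1)%g.
Proof. by apply: (mulgI (q g)); rewrite -qM !mulgV. Qed.

Definition push (f : CG) : CH := \sum_(g <- msupp f) gterm f@_g (q g).

Let pushw (d : {fset G}) f : (msupp f `<=` d)%fset ->
  push f = \sum_(g <- d) gterm f@_g (q g).
Proof.
move=> le; apply/big_fset_incl => // g _ /mcoeff_outdom ->.
exact: monalgU0.
Qed.

Let pushD f f' : push (f + f') = push f + push f'.
Proof.
rewrite (@pushw (msupp f `|` msupp f')%fset) ?msuppD_le //.
rewrite (@pushw (msupp f `|` msupp f')%fset f) ?fsubsetUl //.
rewrite (@pushw (msupp f `|` msupp f')%fset f') ?fsubsetUr //.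
rewrite -big_split /=; apply: eq_bigr => g _.
by rewrite mcoeffD /gterm monalgUD.
Qed.

Let pushZ c f : push (c *: f) = c *: push f.
Proof.
rewrite (@pushw (msupp f)) ?msuppZ_le // /push scaler_sumr.
by apply: eq_bigr => g _; rewrite mcoeffZ /gterm ga_scaleU.
Qed.

Lemma push_term c g : push (gterm c g) = gterm c (q g).
Proof. by rewrite (pushw msuppU_le) big_seq_fset1 mcoeffUU. Qed.

Let pushM f f' : push (f * f') = push f * push f'.
Proof.
move: f; apply: ga_ind => [c g|f1 f2 h1 h2]; last first.
  by rewrite mulrDl !pushD h1 h2 mulrDl.
move: f'; apply: ga_ind => [c' g'|f1 f2 h1 h2]; last first.
  by rewrite mulrDr !pushD h1 h2 mulrDr.
by rewrite gtermM !push_term gtermM qM.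
Qed.

Lemma push_star f : push (star f) = star (push f).
Proof.
move: f; apply: ga_ind => [c g|f1 f2 h1 h2].
  by rewrite gterm_star !push_term gterm_star qV.
by rewrite starD !pushD h1 h2 starD.
Qed.

Lemma push_norm f : anorm (push f) <= anorm f.
Proof.
apply: (le_trans (ga_norm_sum _ _)); apply: ler_sum => g _.
by rewrite ga_normU.
Qed.

Lemma push_lrmorphism : exists P : {lrmorphism CG -> CH}, P =1 push.
Proof.
have lin : linear push by move=> c f f'; rewrite pushD pushZ.
have mon : monoid_morphism push.
  by split=> [|f f']; [rewrite -gdelta1 push_term q1 | exact: pushM].
pose P : {lrmorphism CG -> CH} := HB.pack push
  (GRing.isLinear.Build C CG CH *:%R push lin)
  (GRing.isMonoidMorphism.Build CG CH push mon).
by exists P.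
Qed.

End PushForward.

Lemma full_push (R : realType) (G H : groupType) (E F : cstarAlgType R[i])
    (iG : {lrmorphism group_algebra R[i] G -> E})
    (iH : {lrmorphism group_algebra R[i] H -> F}) (q : G -> H) :
  is_full_group_cstar iG -> is_full_group_cstar iH ->
  {morph q : x y / (x * y)%g} ->
  exists P : {lrmorphism E -> F}, star_morphism P /\
    forall g, P (gen iG g) = gen iH (q g).
Proof.
move=> fG fH qM; have [Q QE] := push_lrmorphism R[i] qM.
pose f : {lrmorphism group_algebra R[i] G -> F} := iH \o Q.
have fs : star_morphism f.
  by move=> x /=; rewrite !QE push_star // (env_star fH).
have fc : contractive f.
  move=> x /=; rewrite QE; apply: le_trans (env_contractive fH _) _.
  exact: push_norm.
have [P [Ps Pf]] := env_ex fG fs fc.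
exists P; split=> // g; have := Pf (gdelta g) => /= ->.
by rewrite QE push_term.
Qed.

(* Compression to the unit vector at 1 of the monomial representation.        *)
Lemma expectation_exists (R : realType) (G H : groupType) (E : cstarAlgType R[i])
    (iota : {lrmorphism group_algebra R[i] G -> E}) (q : G -> H)
    (u : G -> H -> R[i]) :
  is_full_group_cstar iota -> {morph q : x y / (x * y)%g} ->
  (forall g h, Num.conj (u g h) * u g h = 1) ->
  (forall g g' h, u (g * g')%g h = u g (q g' * h)%g * u g' h) ->
  exists M : {linear E -> E},
  [/\ forall x, nm (M x) <= nm x,
      forall g, M (gen iota g) = (if q g == 1%g then u g 1%g else 0) *: gen iota g,
      forall x, pos (M (star x * x)) &
      forall x y, nm (M (star x * y)) ^+ 2 <=
        nm (M (star x * x)) * nm (M (star y * y))].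
Proof.
move=> full qM un uc; pose xi (h : H) : R[i] := (h == 1%g)%:R.
have xs h : h \notin [fset 1%g : H]%fset -> xi h = 0.
  by rewrite in_fset1 /xi => /negbTE ->.
have xn : \sum_(h <- [fset 1%g : H]%fset) Num.conj (xi h) * xi h = 1.
  by rewrite big_seq_fset1 /xi eqxx mulr1 rmorph1.
have [M [M1 M2 M3 M4]] := multiplier_exists full qM un uc xs xn.
exists M; split=> // g; rewrite /gen M2 /coefficient big_seq_fset1 /xi eqxx.
rewrite rmorph1 mul1r mulg1 invg_eq1; case: eqP => [->|_]; last by rewrite mulr0.
by rewrite invg1 mulr1.
Qed.

(** * Expectations attached to the characters of N *)

Section CentralExtension.
Context (R : realType) (N G H : groupType).
Context (i : {multiplicative N -> G}) (q : {multiplicative G -> H}).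
Context (E : cstarAlgType R[i]) (iota : {lrmorphism group_algebra R[i] G -> E}).
Hypothesis full : is_full_group_cstar iota.
Hypothesis ext : central_extension i q.
Local Notation gen := (gen iota).
Implicit Types (chi : N -> R[i]) (x y : E) (g h : G) (n : N).

Definition is_char chi := (forall m n, chi (m * n)%g = chi m * chi n) /\
  (forall n, Num.conj (chi n) * chi n = 1).

Lemma is_char1 : is_char (fun=> 1).
Proof. by split=> *; rewrite ?mulr1 ?rmorph1. Qed.

Lemma char1 chi : is_char chi -> chi 1%g = 1.
Proof.
move=> [cM cN]; have c0 : chi 1%g != 0.
  apply: contra_eq_neq (cN 1%g) => ->; by rewrite mulr0 eq_sym oner_eq0.
by apply: (mulfI c0); rewrite mulr1 -cM mulg1.
Qed.

Lemma charV chi n : is_char chi -> chi (n^-1)%g = Num.conj (chi n).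
Proof.
move=> ch; have [cM cN] := ch.
have c0 : chi n != 0.
  apply: contra_eq_neq (cN n) => ->; by rewrite mulr0 eq_sym oner_eq0.
by apply: (mulIf c0); rewrite cN -cM mulVg char1.
Qed.

Lemma ext_q1 : q 1%g = 1%g.
Proof. by apply: (mulgI (q 1%g)); rewrite -gmulfM !mulg1. Qed.

Lemma ext_i1 : i 1%g = 1%g.
Proof. by apply: (mulgI (i 1%g)); rewrite -gmulfM !mulg1. Qed.

Lemma ext_iV n : i (n^-1)%g = ((i n)^-1)%g.
Proof. by apply: (mulgI (i n)); rewrite -gmulfM !mulgV ext_i1. Qed.

Lemma ext_qV g : q (g^-1)%g = ((q g)^-1)%g.
Proof. by apply: (mulgI (q g)); rewrite -gmulfM !mulgV ext_q1. Qed.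

Lemma ext_qi n : q (i n) = 1%g.
Proof. by apply/(central_ext_exact ext); exists n. Qed.

Lemma ext_case g : (exists n, g = i n) \/ q g <> 1%g.
Proof.
have [/(central_ext_exact ext)[n <-]|] := eqVneq (q g) 1%g; last by move/eqP; right.
by left; exists n.
Qed.

(** The conditional expectation onto the closed span of N, followed by the dual action delta_n |->
    chi(n) delta_n. For chi = 1 it is the conditional expectation itself. *)
Record expectation chi (T : E -> E) : Prop := {
  exp_blin : blin T;
  exp_nm : forall x, nm (T x) <= nm x;
  exp_in : forall n, T (gen (i n)) = chi n *: gen (i n);
  exp_out : forall g, q g <> 1%g -> T (gen g) = 0;
  exp_pos : forall x, pos (T (star x * x));
  exp_cs : forall x y, nm (T (star x * y)) ^+ 2 <=
    nm (T (star x * x)) * nm (T (star y * y))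
}.

(* The representation of G induced from chi, written on l^2(H) by means of a  *)
(* section s : H -> G; the cocycle nn compares g * s h with s (q g * h).      *)
Lemma expectation_ex chi : is_char chi -> exists T, expectation chi T.
Proof.
move=> ch; have [cM cN] := ch; have [s hs] := choice (central_ext_surj ext).
have nnP g (h : H) : exists n, i n = ((s (q g * h))^-1 * (g * s h))%g.
  apply/(central_ext_exact ext); rewrite gmulfM gmulfM ext_qV !hs.
  by rewrite mulVg.
have [nn hnn] := choice (fun gh : (G * H)%type => nnP gh.1 gh.2).
pose u g (h : H) := chi (nn (g, h)).
have uc g g' (h : H) : u (g * g')%g h = u g (q g' * h)%g * u g' h.
  rewrite /u -cM; congr chi; apply: (central_ext_inj ext).
  by rewrite gmulfM !hnn /= gmulfM !mulgA mulgK.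
have [M [M1 M2 M3 M4]] := expectation_exists full (@gmulfM _ _ q)
  (fun g (h : H) => cN (nn (g, h))) uc.
exists M; split=> //.
- by apply: (blin_linear (K := 1)) => // x; rewrite mul1r.
- move=> n; rewrite M2 ext_qi eqxx /u; congr (chi _ *: _).
  apply: (central_ext_inj ext).
  by rewrite hnn /= ext_qi mul1g (central_ext_central ext) mulgA mulVg mul1g.
- by move=> g /eqP/negbTE gN; rewrite M2 gN scale0r.
Qed.

Context (T0 : E -> E).
Hypothesis T0P : expectation (fun=> 1) T0.

Let b0 : blin T0. Proof. exact: exp_blin T0P. Qed.

Let T0_in n : T0 (gen (i n)) = gen (i n).
Proof. by rewrite (exp_in T0P) scale1r. Qed.

Let T0_out g : q g <> 1%g -> T0 (gen g) = 0.
Proof. exact: exp_out T0P g. Qed.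

Let q_mul_in n g : q (i n * g)%g = q g.
Proof. by rewrite gmulfM ext_qi mul1g. Qed.

(** As chi is multiplicative, T acts as a homomorphism on the range of T0; thus it carries
    projections fixed by T0 to projections. *)
Lemma exp_mul chi T x y : is_char chi -> expectation chi T ->
  T (T0 x * T0 y) = T x * T y.
Proof.
move=> [cM _] TP; have bT := exp_blin TP; move: x y.
have step g y : T (T0 (gen g) * T0 y) = T (gen g) * T y.
  apply: (blin_eq full (f := fun y => T (T0 (gen g) * T0 y))
                       (f' := fun y => T (gen g) * T y)).
  - exact: (blin_comp (blin_mull _ b0) bT).
  - exact: blin_mull.
  move=> h; have [[n ->]|gN] := ext_case g; last first.
    by rewrite T0_out // mul0r (exp_out TP) // mul0r blin_at0.
  have [[m ->]|hN] := ext_case h; last first.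
    by rewrite [T0 (gen h)]T0_out // mulr0 (exp_out TP hN) // mulr0 blin_at0.
  by rewrite !T0_in -genM -gmulfM !(exp_in TP) gmulfM genM cM -scalerAl -scalerAr scalerA.
move=> x y; apply: (blin_eq full (f := fun x => T (T0 x * T0 y))
                       (f' := fun x => T x * T y)) => //.
- exact: (blin_comp (blin_mulr _ b0) bT).
- exact: blin_mulr.
Qed.

Lemma exp_idem chi T x : expectation chi T -> T (T0 x) = T x.
Proof.
move=> TP; have bT := exp_blin TP; apply: (blin_eq full (f := T \o T0)) => //.
  exact: blin_comp.
move=> g /=; have [[n ->]|gN] := ext_case g; first by rewrite T0_in.
by rewrite T0_out // (exp_out TP) // blin_at0.
Qed.

Lemma T0_module x y : T0 (T0 x * y) = T0 x * T0 y.
Proof.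
move: x y; have step g y : T0 (T0 (gen g) * y) = T0 (gen g) * T0 y.
  apply: (blin_eq full (f := fun y => T0 (T0 (gen g) * y))
                       (f' := fun y => T0 (gen g) * T0 y)).
  - exact: (blin_comp (blin_mull _ (blin_id E)) b0).
  - exact: blin_mull.
  move=> h; have [[n ->]|gN] := ext_case g; last first.
    by rewrite T0_out // !mul0r blin_at0.
  rewrite T0_in -genM; have [[m ->]|hN] := ext_case h.
    by rewrite -gmulfM !T0_in gmulfM genM.
  by rewrite !T0_out ?mulr0 // q_mul_in.
move=> x y; apply: (blin_eq full (f := fun x => T0 (T0 x * y))
                       (f' := fun x => T0 x * T0 y)) => //.
- exact: (blin_comp (blin_mulr _ b0) b0).
- exact: blin_mulr.
Qed.

Lemma exp_central chi T x y : expectation chi T -> GRing.comm (T x) y.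
Proof.
move=> TP; have bT := exp_blin TP; move: x y.
have step g y : T (gen g) * y = y * T (gen g).
  apply: (blin_eq full (f := fun y => T (gen g) * y) (f' := fun y => y * T (gen g))).
  - exact: (blin_mull _ (blin_id E)).
  - exact: (blin_mulr _ (blin_id E)).
  move=> h; have [[n ->]|gN] := ext_case g; last first.
    by rewrite (exp_out TP) // mul0r mulr0.
  by rewrite (exp_in TP) -scalerAl -scalerAr -!genM (central_ext_central ext).
move=> x y; apply: (blin_eq full (f := fun x => T x * y) (f' := fun x => y * T x)) => //.
- exact: blin_mulr.
- exact: blin_mull.
Qed.

Lemma exp_star chi T x : is_char chi -> expectation chi T ->
  T (star x) = star (T x).
Proof.
move=> ch TP; have bT := exp_blin TP; rewrite -[LHS]starK; congr star.
apply: (blin_eq full (f := fun x => star (T (star x)))) => //; first exact: blin_star.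
move=> g; rewrite (gen_star full).
have [[n ->]|gN] := ext_case g.
  by rewrite -ext_iV !(exp_in TP) starZ (gen_star full) ext_iV invgK charV // conjCK.
rewrite !(exp_out TP) ?star0 // ext_qV => e; apply: gN.
by rewrite -[q g]invgK e invg1.
Qed.

(** Conjugation fixes the central elements of N and permutes the group elements outside N. Hence all
    s_k^-1 p s_k have the same expectation as p. *)
Lemma T0_conj g x : T0 (gen (g^-1)%g * x * gen g) = T0 x.
Proof.
apply: (blin_eq full (f := fun x => T0 (gen (g^-1)%g * x * gen g))) => //.
  exact: (blin_comp (blin_mulr _ (blin_mull _ (blin_id E))) b0).
move=> h; rewrite -!genM; have [[n ->]|hN] := ext_case h.
  by rewrite -mulgA (central_ext_central ext) mulKg.
rewrite !T0_out // !gmulfM ext_qV => e; apply: hN.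
apply: (mulgI (q g)^-1%g); apply: (mulIg (q g)); rewrite e mulg1 mulVg.
by [].
Qed.

Lemma T0_1 : T0 1 = 1.
Proof. by rewrite -(gen1 iota) -ext_i1 T0_in. Qed.

End CentralExtension.

Section UnitCircle.
Context (R : realType).
Implicit Types (x y : R).

Definition cis x : R[i] := cos x +i* sin x.

Lemma cisD x y : cis (x + y) = cis x * cis y.
Proof.
rewrite /cis cosD sinD; apply/eqP; rewrite eq_complex /= eqxx /=.
by apply/eqP; ring.
Qed.

Lemma cis0 : cis 0 = 1.
Proof. by rewrite /cis cos0 sin0. Qed.

Lemma cis_pi : cis pi = -1.
Proof. by rewrite /cis cospi sinpi; apply/eqP; rewrite eq_complex /= oppr0 !eqxx. Qed.

Lemma normc_cis x : normc (cis x) = 1.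
Proof. by rewrite /cis /= cos2Dsin2 sqrtr1. Qed.

Lemma conj_cis x : Num.conj (cis x) * cis x = 1.
Proof.
rewrite mulrC -normCK (_ : `|cis x| = (normc (cis x))%:C) //.
by rewrite normc_cis expr1n.
Qed.

Lemma cis_near0 (e : R) : 0 < e ->
  exists2 d : R, 0 < d & forall y, `|y| <= d -> normc (cis y - 1) <= e.
Proof.
move=> e0; have e20 : 0 < e / 2 by rewrite divr_gt0.
have /cvgrPdist_le /(_ _ e20) [d1 /= d10 h1] := @continuous_cos R 0.
have /cvgrPdist_le /(_ _ e20) [d2 /= d20 h2] := @continuous_sin R 0.
exists (Num.min d1 d2 / 2); first by rewrite divr_gt0 // lt_min d10.
move=> y hy.
have m0 : 0 < Num.min d1 d2 by rewrite lt_min d10.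
have yd : `|y| < Num.min d1 d2 by apply: le_lt_trans hy _; lra.
move: yd; rewrite lt_min => /andP[y1 y2].
have c1 := h1 y; have c2 := h2 y; rewrite /ball_ /= sub0r normrN in c1 c2.
have {}c1 := c1 y1; have {}c2 := c2 y2; rewrite cos0 in c1; rewrite sin0 in c2.
change (normc (cis y - 1) <= e).
have -> : cis y - 1 = (cos y - 1)%:C + 'i%C * (sin y)%:C.
  rewrite /cis; apply/eqP; rewrite eq_complex /=; apply/andP; split; apply/eqP; ring.
apply: (le_trans (le_normcD _ _)); rewrite normcM !normcR.
rewrite (_ : normc 'i = 1); last by rewrite /= expr0n expr1n add0r sqrtr1.
by rewrite distrC in c1; rewrite sub0r normrN in c2; lra.
Qed.

End UnitCircle.

(** * Projections of the fixed-point algebra *)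

Section Projections.
Context (R : realType) (E : cstarAlgType R[i]).
Implicit Types x y : E.

Lemma projection_nm x : projection x -> nm x = 0 \/ nm x = 1.
Proof.
move=> [xs xx]; have := nm_starM x; rewrite xs xx => h.
have : nm x * (nm x - 1) = 0 by rewrite mulrBr mulr1 -expr2 -h subrr.
by move/eqP; rewrite mulf_eq0 subr_eq0 => /orP[]/eqP; [left | right].
Qed.

Lemma projection_nm_le1 x : projection x -> nm x <= 1.
Proof. by move=> /projection_nm[] ->; rewrite ?ler01. Qed.

Lemma projection_nm_lt1 x : projection x -> nm x < 1 -> x = 0.
Proof.
by move=> /projection_nm[/nm0_eq0 //|->]; rewrite ltxx.
Qed.

Lemma projection1B x : projection x -> projection (1 - x).
Proof.
move=> [xs xx]; split; first by rewrite starB star1 xs.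
by rewrite mulrBl mul1r mulrBr mulr1 xx subrr subr0.
Qed.

(** For commuting projections a - a b = a (a - b) is a projection of norm at most ||a - b|| < 1,
    hence 0; by symmetry x = x y = y. *)
Lemma close_projections x y : projection x -> projection y -> GRing.comm x y ->
  nm (x - y) < 1 -> x = y.
Proof.
suff main (a b : E) : projection a -> projection b -> GRing.comm a b ->
    nm (a - b) < 1 -> a = a * b.
  move=> px py xy h; rewrite (main x y px py xy h) xy.
  by rewrite -(main y x py px (commr_sym xy)) // nm_subC.
move=> pa pb ab h; apply/eqP; rewrite -subr_eq0; apply/eqP.
have [as_ aa] := pa; have [bs bb] := pb.
have abE : a - a * b = a * (a - b) by rewrite mulrBr aa.
apply: projection_nm_lt1.
  split; first by rewrite starB starM as_ bs ab.
  rewrite mulrBl !mulrBr aa mulrA aa -!mulrA (mulrA b a) -ab -(mulrA a b b) bb.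
  by rewrite mulrA aa subrr subr0.
rewrite abE; apply: le_lt_trans (nmM _ _) _; apply: le_lt_trans h.
by rewrite ler_piMl ?nm_ge0 // projection_nm_le1.
Qed.

(** If x <> 0, then ||x|| = 1 and (x - c) x = (1 - c) x give |1 - c| <= 1/4, so the projection 1 - x
    has norm at most 1/2. *)
Lemma near_scalar_projection x (c : R[i]) : projection x ->
  nm (x - c *: 1) <= 4^-1 -> x = 0 \/ x = 1.
Proof.
move=> px h; have [x0|xN0] := eqVneq x 0; [by left | right].
have p1x := projection1B px; have [_ xx] := px.
apply/eqP; rewrite eq_sym -subr_eq0; apply/eqP; apply: projection_nm_lt1 => //.
have n1 : nm x = 1 by have [/nm0_eq0 e|//] := projection_nm px; rewrite e eqxx in xN0.
have h1 : normc (1 - c) <= 4^-1.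
  have : nm ((x - c *: 1) * x) <= 4^-1.
    by rewrite (le_trans (nmM _ _)) // n1 mulr1.
  by rewrite mulrBl xx -scalerAl mul1r -{1}[x]scale1r -scalerBl nmZ n1 mulr1.
have -> : 1 - x = (1 - c) *: 1 - (x - c *: 1).
  by rewrite scalerBl scale1r opprB addrA subrK.
apply: le_lt_trans (nmB _ _) _; rewrite nmZ nm1 mulr1; lra.
Qed.

End Projections.

(** * Connectedness of the dual of N *)

Section Connectedness.
Context (R : realType) (N G H : groupType).
Context (i : {multiplicative N -> G}) (q : {multiplicative G -> H}).
Context (E : cstarAlgType R[i]) (iota : {lrmorphism group_algebra R[i] G -> E}).
Hypothesis full : is_full_group_cstar iota.
Hypothesis ext : central_extension i q.
Hypothesis mulNC : forall x y : N, (x * y = y * x)%g.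
Hypothesis tfN : torsion_free N.
Local Notation gen := (gen iota).
Context (T0 : E -> E).
Hypothesis T0P : expectation i q iota (fun=> 1) T0.
Context (e : E).
Hypothesis pe : projection e.
Hypothesis T0e : T0 e = e.

Let left_inverse_i : exists j : G -> N, forall n, j (i n) = n.
Proof.
suff /choice[j hj] g : exists m, forall n, i n = g -> m = n.
  by exists j => n; exact: hj.
have [[m hm]|no] := pselect (exists m, i m = g).
  by exists m => n hn; apply: (central_ext_inj ext); rewrite hm hn.
by exists 1%g => n hn; case: no; exists n.
Qed.

(** Only the values of the characters on the finite support of f matter, and group elements have
    norm 1. This gives norm continuity in the character. *)
Lemma expectation_dist chi chi' T T' (f : group_algebra R[i] G) (d : R) : 0 <= d ->
  expectation i q iota chi T -> expectation i q iota chi' T' ->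
  (forall n, i n \in msupp f -> normc (chi n - chi' n) <= d) ->
  nm (T (iota f) - T' (iota f)) <= nm f * d.
Proof.
move=> d0 TP TP' h; have bT := exp_blin TP; have bT' := exp_blin TP'.
rewrite !blin_term //.
rewrite -sumrB (le_trans (nm_sum _ _ _)) // nm_gaE mulr_suml.
rewrite big_seq [leRHS]big_seq; apply: ler_sum => g gf.
rewrite -scalerBr nmZ ler_wpM2l //.
  by rewrite -ler0c; exact: (@normr_ge0 _ _ f@_g).
have [[n gE]|gN] := ext_case ext g; last first.
  by rewrite (exp_out TP) // (exp_out TP') // subrr nm0.
rewrite gE (exp_in TP) (exp_in TP') -scalerBl nmZ (nm_gen full) mulr1.
by apply: h; rewrite -gE.
Qed.

Lemma expectation_projection chi T : is_char chi -> expectation i q iota chi T ->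
  projection (T e).
Proof.
move=> ch TP; have [es ee] := pe; split; first by rewrite -(exp_star full ext _ ch TP) es.
by rewrite -(exp_mul full ext T0P _ _ ch TP) !T0e ee.
Qed.

(* The expectations of e for the characters exp(i pi t phi) form a norm       *)
(* continuous path of commuting projections, hence a constant one.            *)
Lemma expectation_fix (phi : N -> R) T :
  (forall x y, phi (x * y)%g = phi x + phi y) ->
  expectation i q iota (fun n => cis (pi * phi n)) T -> T e = e.
Proof.
move=> phiD TP; have [j hj] := left_inverse_i.
pose chi (t : R) n := cis (pi * t * phi n).
have chiC t : is_char (chi t).
  split=> [m n|n]; last exact: conj_cis.
  by rewrite /chi phiD mulrDr cisD.
have [S SP] := choice (fun t => expectation_ex full ext (chiC t)).
(* Three errors of 1/4 stay below the threshold 1 of [close_projections]: two from replacing e by f,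
   one from moving the character by a step on the support of f. *)
have [f hf] : exists f, nm (e - iota f) <= 4^-1.
  by apply: (full_dense full); rewrite invr_gt0.
have f1 : 0 < nm f + 1 by rewrite ltr_wpDl // nm_ge0.
have d0 : 0 < (4 * (nm f + 1))^-1 :> R by rewrite invr_gt0 mulr_gt0.
have [eta eta0 heta] := cis_near0 d0.
pose B := \sum_(g <- msupp f) `|pi * phi (j g)|.
have B0 : 0 <= B by exact: sumr_ge0.
(* A step of 1 / K changes the phase at each point of N in the support of f by at most B / K <=
   eta. *)
pose K := (Num.bound (B / eta)).+1.
have K0 : 0 < K%:R :> R by rewrite ltr0n.
have BK : B / K%:R <= eta.
  rewrite ler_pdivrMr // mulrC -ler_pdivrMr // ltW // /K.
  apply: lt_trans (archi_boundP (divr_ge0 B0 (ltW eta0))) _.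
  by rewrite ltr_nat.
have step (t : R) : S (t + K%:R^-1) e = S t e.
  apply: close_projections; try exact: expectation_projection (SP _).
    exact: (exp_central full ext _ _ (SP _)).
  have b1 := exp_blin (SP (t + K%:R^-1)); have b2 := exp_blin (SP t).
  have h1 : nm (S (t + K%:R^-1) e - S (t + K%:R^-1) (iota f)) <= 4^-1.
    by rewrite -blinB // (le_trans (exp_nm (SP _) _)).
  have h2 : nm (S t (iota f) - S t e) <= 4^-1.
    by rewrite -blinB // (le_trans (exp_nm (SP _) _)) // nm_subC.
  have h3 : nm (S (t + K%:R^-1) (iota f) - S t (iota f)) <= 4^-1.
    apply: le_trans (expectation_dist (ltW d0) (SP _) (SP _) _) _; last first.
      rewrite invfM mulrCA ler_piMr ?invr_ge0 // ler_pdivrMr // mul1r.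
      by rewrite lerDl.
    move=> n nf; rewrite /chi.
    have -> : pi * (t + K%:R^-1) * phi n = pi * t * phi n + pi * phi n / K%:R.
      by rewrite mulrDr mulrDl; congr (_ + _); rewrite mulrAC.
    rewrite cisD -{2}[cis (pi * t * phi n)]mulr1 -mulrBr normcM normc_cis mul1r.
    apply: heta; apply: le_trans BK; rewrite normrM normfV (gtr0_norm K0).
    rewrite ler_wpM2r ?invr_ge0 ?ler0n // /B (big_fsetD1 (i n)) //= hj.
    by rewrite lerDl sumr_ge0.
  have := nm_dist (S (t + K%:R^-1) e) (S (t + K%:R^-1) (iota f)) (S t e).
  have := nm_dist (S (t + K%:R^-1) (iota f)) (S t (iota f)) (S t e).
  by move: h1 h2 h3; lra.
have iter k : S (k%:R / K%:R) e = S 0 e.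
  elim: k => [|k IH]; first by rewrite mul0r.
  have -> : k.+1%:R / K%:R = k%:R / K%:R + K%:R^-1 :> R.
    by rewrite -[k.+1]addn1 natrD mulrDl mul1r.
  by rewrite step.
have TE : T e = S 1 e.
  apply: (blin_eq full (exp_blin TP) (exp_blin (SP 1))) => g.
  have [[n ->]|gN] := ext_case ext g; last by rewrite (exp_out TP) // (exp_out (SP 1)).
  by rewrite (exp_in TP) (exp_in (SP 1)) /chi mulr1.
have T0E : S 0 e = T0 e.
  apply: (blin_eq full (exp_blin (SP 0)) (exp_blin T0P)) => g.
  have [[n ->]|gN] := ext_case ext g; last by rewrite (exp_out T0P) // (exp_out (SP 0)).
  by rewrite (exp_in T0P) (exp_in (SP 0)) /chi mulr0 mul0r cis0.
by rewrite TE -[RHS]T0e -T0E -(iter K) divff // gt_eqF.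
Qed.

(* If phi n = 1, then averaging the expectations for the trivial character and *)
(* for exp(i pi phi), whose value at n is -1, kills the coefficient at i n.    *)
Lemma kill_coefficients (s : seq G) : exists (S : E -> E) (t : G -> R[i]),
  [/\ blin S, forall x, nm (S x) <= nm x, S e = e,
      forall g, S (gen g) = t g *: gen g &
      forall g, g \in s -> g <> 1%g -> t g = 0].
Proof.
elim: s => [|g s [S [t [bS nS Se St ts]]]].
  exists id, (fun=> 1); split=> //; first exact: blin_id.
  by move=> g; rewrite scale1r.
have [j hj] := left_inverse_i.
have b0 := exp_blin T0P.
have T0g h : T0 (gen h) = (q h == 1%g)%:R *: gen h.
  have [[n ->]|gN] := ext_case ext h; first by rewrite (exp_in T0P) (ext_qi ext) eqxx.
  by rewrite (exp_out T0P) // (negbTE (introN eqP gN)) scale0r.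
(* One more element g is handled by a map U: [T0] if g lies outside N, the identity if g = 1, and
   the average of two expectations otherwise. *)
suff [U [v [bU nU Ue Uv vg]]] : exists (U : E -> E) (v : G -> R[i]),
    [/\ blin U, forall x, nm (U x) <= nm x, U e = e,
      forall h, U (gen h) = v h *: gen h & g <> 1%g -> v g = 0].
  exists (U \o S), (fun h => t h * v h); split=> //=.
  - exact: blin_comp.
  - by move=> x; exact: le_trans (nU _) (nS _).
  - by rewrite Se.
  - by move=> h; rewrite St; case: (bU) => _ -> _; rewrite Uv scalerA.
  - move=> h; rewrite inE => /orP[/eqP -> g1|hs h1]; first by rewrite vg // mulr0.
    by rewrite ts // mul0r.
have [[n gE]|gN] := ext_case ext g; last first.
  exists T0, (fun h => (q h == 1%g)%:R); split=> //; first exact: exp_nm T0P.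
  by rewrite (negbTE (introN eqP gN)).
have [n1|/eqP nN1] := eqVneq n 1%g.
  exists id, (fun=> 1); split=> //; [exact: blin_id | by move=> h; rewrite scale1r |].
  by case; rewrite gE n1 (ext_i1 i).
have [phi [phiD phi1]] := real_character R mulNC tfN nN1.
have ch : is_char (fun m => cis (pi * phi m)).
  split=> [a b|a]; last exact: conj_cis.
  by rewrite phiD mulrDr cisD.
have [T TP] := expectation_ex full ext ch; have bT := exp_blin TP.
have Te := expectation_fix phiD TP.
have half : (2^-1)%:C + (2^-1)%:C = 1 :> R[i].
  by rewrite -rmorphD (_ : 2^-1 + 2^-1 = 1 :> R); [rewrite rmorph1 | lra].
exists (fun x => (2^-1)%:C *: (T0 x + T x)), (fun h => (2^-1)%:C * ((q h == 1%g)%:R +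
  (if q h == 1%g then cis (pi * phi (j h)) else 0))); split.
- exact/blin_scale/blin_add.
- move=> x; rewrite nmZr ger0_norm ?invr_ge0 //.
  have := nmD (T0 x) (T x); have := exp_nm T0P x; have := exp_nm TP x; lra.
- by rewrite T0e Te scalerDr -scalerDl half scale1r.
- move=> h; rewrite T0g -scalerA scalerDl; congr (_ *: (_ + _)).
  have [[m ->]|hN] := ext_case ext h; first by rewrite (exp_in TP) (ext_qi ext) eqxx hj.
  by rewrite (exp_out TP) // (negbTE (introN eqP hN)) scale0r.
- move=> _; rewrite gE (ext_qi ext) eqxx hj phi1 mulr1 cis_pi.
  by rewrite addrN mulr0.
Qed.

(** Killing every coefficient of an approximant f except that at 1 leaves a scalar, while e is
    fixed; so e lies within 1/4 of a scalar. *)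
Theorem central_projection_trivial : e = 0 \/ e = 1.
Proof.
have [f hf] : exists f, nm (e - iota f) <= 4^-1.
  by apply: (full_dense full); rewrite invr_gt0.
have [S [t [bS nS Se St ts]]] := kill_coefficients (msupp f).
suff [c hc] : exists c : R[i], S (iota f) = c *: 1.
  apply: (@near_scalar_projection _ _ e c pe).
  by rewrite -hc -{1}Se -blinB // (le_trans (nS _)).
rewrite blin_term // big_seq.
elim/big_ind: _ => [|x y [a ->] [b ->]|g gf].
- by exists 0; rewrite scale0r.
- by exists (a + b); rewrite scalerDl.
- have [->|/eqP g1] := eqVneq g 1%g.
    by exists (f@_1%g * t 1%g); rewrite St gen1 scalerA.
  by exists 0; rewrite St ts // !scale0r scaler0.
Qed.

End Connectedness.

(** * Powers of 1 - c *)

Section OneMinusPowers.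
Context (R : realType) (E : cstarAlgType R[i]) (c : E).
Hypothesis c0 : pos c.
Hypothesis c1 : pos (1 - c).
Local Notation d := (1 - c).

Let cd : GRing.comm d c.
Proof. by apply/commr_sym/commrB; [exact: commr1 | exact: commr_refl]. Qed.

Let dX k : pos (d ^+ k).
Proof.
elim: k => [|k IH]; last by rewrite exprS; apply: pos_mul => //; exact: commrX.
by rewrite expr0 -(mulr1 1) -{1}star1; exact: pos_starM.
Qed.

Let dXc k : pos (d ^+ k * c).
Proof. by apply: pos_mul => //; apply/commr_sym/commrX/commr_sym. Qed.

Lemma nm_exp1B_mul_le k : k%:R * nm (d ^+ k * c) <= 1.
Proof.
have E1 : (1 : R)%:C%:A = 1 :> E by rewrite scale1r.
(* d^j c >= d^k c for j < k, while the d^j c with j < k sum up to 1 - d^k. *)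
have main : pos (1 - d ^+ k - k%:R%:C *: (d ^+ k * c)).
  elim: k => [|k IH]; first by rewrite expr0 subrr scale0r subr0; exact: pos0.
  have -> : 1 - d ^+ k.+1 - k.+1%:R%:C *: (d ^+ k.+1 * c) =
      (1 - d ^+ k - k%:R%:C *: (d ^+ k * c)) +
      k.+1%:R%:C *: (d ^+ k * c * c).
    have -> : d ^+ k * c * c = d ^+ k * c - d ^+ k.+1 * c.
      by rewrite exprSr -mulrA -[in RHS]mulrA -mulrBr mulrBl mul1r subKr mulrA.
    rewrite scalerBr -[k.+1 in LHS]addn1 -[k.+1 in RHS]addn1 natrD rmorphD /=.
    rewrite addrA; congr (_ - _); rewrite scalerDl scale1r addrA subrK.
    by rewrite addn1 exprSr mulrBr mulr1 opprB addrA addrAC.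
  apply: posD => //; apply: posZ => //; apply: pos_mul => //.
  by apply/commr_sym/commrM; [apply/commrX/commr_sym | exact: commr_refl].
have h : pos ((1 : R)%:C%:A - k%:R%:C *: (d ^+ k * c)).
  rewrite E1; have := posD main (dX k).
  by rewrite [_ - d ^+ k - _ + _]addrAC subrK.
have := pos_ge1B ler01 (posZ (ler0n R k) (dXc k)) h.
by rewrite nmZr normr_nat.
Qed.

Lemma contraction_1B : nm d <= 1.
Proof.
apply: pos_ge1B => //; rewrite scale1r opprB addrC subrK.
exact: c0.
Qed.

End OneMinusPowers.

(** * Smallness of d^m p by amenability *)

Section AmenableApproximation.
Context (R : realType) (N G H : groupType).
Context (i : {multiplicative N -> G}) (q : {multiplicative G -> H}).
Context (E : cstarAlgType R[i]) (iota : {lrmorphism group_algebra R[i] G -> E}).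
Hypothesis full : is_full_group_cstar iota.
Hypothesis ext : central_extension i q.
Local Notation gen := (gen iota).
Context (T0 : E -> E).
Hypothesis T0P : expectation i q iota (fun=> 1) T0.
Let b0 : blin T0 := exp_blin T0P.

(** M multiplies delta_g by the coefficient of an almost invariant vector of l^2(H), which is near 1
    on the support of an approximant f of x; as M is contractive, the error x - f costs only two of
    the three parts of e. *)
Lemma amenable_multiplier (x : E) (e : R) : amenable R H -> 0 < e ->
  exists (d : {fset H}) (xi : H -> R) (M : E -> E),
  [/\ blin M, nm (x - M x) <= e, forall h, h \notin d -> xi h = 0 &
      forall g, M (gen g) =
        (\sum_(h <- d) xi h * xi ((q g)^-1 * h)%g)%:C *: gen g].
Proof.
move=> am e0; have e3 : 0 < e / 3 by rewrite divr_gt0.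
have [f hf] := full_dense full x e3.
have f1 : 0 < 3 * (nm f + 1) by rewrite mulr_gt0 // ltr_wpDl // nm_ge0.
have [t t0 tE] : exists2 t : R, 0 < t & e / 3 = (nm f + 1) * t.
  exists (e / (3 * (nm f + 1))); first exact: divr_gt0.
  by field; rewrite gt_eqF // ltr_wpDl // nm_ge0.
have [d [xi [xid xi1 xis]]] :=
  almost_invariant_vector [seq q g | g <- msupp f] am t0.
pose xiC h := (xi h)%:C.
have xCd h : h \notin d -> xiC h = 0 by move=> /xid h0; rewrite /xiC h0.
have conjR (r : R) : Num.conj r%:C = r%:C by rewrite conj_Creal // complex_real.
have xC1 : \sum_(h <- d) Num.conj (xiC h) * xiC h = 1.
  rewrite -[RHS](rmorph1 (real_complex R)) -xi1 rmorph_sum; apply: eq_bigr => h _.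
  by rewrite /xiC conjR -rmorphM expr2.
have u1 (g : G) (h : H) : Num.conj (1 : R[i]) * 1 = 1 by rewrite mulr1 rmorph1.
have uc (g g' : G) (h : H) : 1 = 1 * 1 :> R[i] by rewrite mulr1.
have [M [M1 M2 _ _]] := multiplier_exists (u := fun _ _ => 1) full
  (@gmulfM _ _ q) u1 uc xCd xC1.
have bM : blin M by apply: (blin_linear (K := 1)) => // y; rewrite mul1r.
have Mg g : M (gen g) =
    (\sum_(h <- d) xi h * xi ((q g)^-1 * h)%g)%:C *: gen g.
  rewrite /gen M2 /coefficient rmorph_sum; congr (_ *: _); apply: eq_bigr => h _.
  by rewrite mul1r /xiC conjR -rmorphM.
exists d, xi, M; split=> //.
have h1 : nm (M (iota f) - M x) <= e / 3.
  by rewrite -blinB // (le_trans (M1 _)) // nm_subC.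
have h2 : nm (iota f - M (iota f)) <= e / 3.
  have iE : iota f = \sum_(g <- msupp f) f@_g *: gen g.
    exact: (blin_term iota f (blin_id E)).
  have ME : M (iota f) = \sum_(g <- msupp f) f@_g *: M (gen g).
    exact: (blin_term iota f bM).
  rewrite ME iE -sumrB.
  apply: (le_trans (nm_sum _ _ _)).
  rewrite tE; apply: (@le_trans _ _ (nm f * t)); last first.
    by rewrite ler_wpM2r ?lerDl // ltW.
  rewrite nm_gaE mulr_suml big_seq [leRHS]big_seq; apply: ler_sum => g gf.
  rewrite -scalerBr nmZ ler_wpM2l //.
    by rewrite -ler0c; exact: (@normr_ge0 _ _ f@_g).
  rewrite Mg -{1}[gen g]scale1r -scalerBl nmZ (nm_gen full) mulr1.
  rewrite -(rmorph1 (real_complex R)) -rmorphB normcR; apply: xis.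
  by apply/mapP; exists g.
have := nm_dist x (iota f) (M x); have := nm_dist (iota f) (M (iota f)) (M x).
by move: hf h1 h2; lra.
Qed.

(** At x = delta_g the term (k, l) survives T0 only if s_k^-1 g s_l lies in N, that is l = q(g)^-1
    k, and it then gives back delta_g; the remaining sum over k is the coefficient of M. *)
Lemma amenable_expansion (d : {fset H}) (xi : H -> R) (s : H -> G) (M : E -> E) :
  (forall h, q (s h) = h) -> blin M -> (forall h, h \notin d -> xi h = 0) ->
  (forall g, M (gen g) = (\sum_(h <- d) xi h * xi ((q g)^-1 * h)%g)%:C *: gen g) ->
  forall x, M x = \sum_(k <- d) \sum_(l <- d) (xi k * xi l)%:C *:
    (gen (s k) * T0 (gen ((s k)^-1)%g * x * gen (s l)) * gen ((s l)^-1)%g).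
Proof.
move=> qs bM xid Mg; apply: (blin_eq full bM) => [|g].
  apply: blin_sum => k; apply: blin_sum => l; apply: blin_scale.
  apply: blin_mulr; apply: blin_mull.
  exact: (blin_comp (blin_mulr _ (blin_mull _ (blin_id E))) b0).
have T0gen k l : gen (s k) * T0 (gen ((s k)^-1)%g * gen g * gen (s l)) *
    gen ((s l)^-1)%g = (l == (q g)^-1 * k)%g%:R *: gen g.
  rewrite -!genM; have [lE|lN] := eqVneq l ((q g)^-1 * k)%g.
    have /(central_ext_exact ext)[n hn] : q ((s k)^-1 * g * s l)%g = 1%g.
      by rewrite !gmulfM (ext_qV q) !qs lE -mulgA mulVKg mulVg.
    rewrite -hn (exp_in T0P) scale1r -!genM hn scale1r -!mulgA mulVKg.
    by rewrite mulgV mulg1.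
  rewrite (exp_out T0P) ?mulr0 ?mul0r ?scale0r // !gmulfM (ext_qV q) !qs.
  move=> e; case/eqP: lN; apply: (mulgI (k^-1 * q g)%g).
  by rewrite e -mulgA mulVKg mulVg.
rewrite Mg rmorph_sum scaler_suml; apply: eq_bigr => k _.
under eq_bigr do rewrite T0gen scalerA.
rewrite -scaler_suml; congr (_ *: _).
set m := ((q g)^-1 * k)%g; have [md|mN] := boolP (m \in d).
  rewrite (big_fsetD1 m) //= eqxx mulr1 big1_fset ?addr0 // => l.
  by rewrite in_fsetD1 => /andP[/negbTE -> _] _; rewrite mulr0.
rewrite (xid m mN) mulr0 rmorph0 big1_seq // => l /= ld.
by rewrite (_ : (l == m) = false) ?mulr0 //; apply: contraNF mN => /eqP <-.
Qed.

Context (p : E).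
Hypothesis pp : projection p.
Local Notation c := (T0 p).
Local Notation d := (1 - c).

Lemma T0_pos : pos c.
Proof. by have := exp_pos T0P p; case: pp => -> ->. Qed.

Lemma T0_1B_pos : pos d.
Proof.
have [ps ppE] := projection1B pp; have := exp_pos T0P (1 - p).
by rewrite ps ppE blinB // (T0_1 T0P).
Qed.

Lemma T0_1B : T0 d = d.
Proof. by rewrite blinB // (T0_1 T0P) (exp_idem full ext T0P p T0P). Qed.

Lemma T0_exp1B_mul k x : T0 (d ^+ k * x) = d ^+ k * T0 x.
Proof.
elim: k x => [|k IH] x; first by rewrite expr0 !mul1r.
by rewrite exprS -!mulrA -{1}T0_1B (T0_module full ext T0P) IH T0_1B.
Qed.

Lemma exp1B_comm k x : GRing.comm (d ^+ k) x.
Proof.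
apply/commr_sym/commrX/commr_sym; rewrite -T0_1B.
exact: (exp_central full ext _ _ T0P).
Qed.

Lemma exp1B_expectation_small : amenable R H -> exists2 m, (0 < m)%N & nm (d ^+ m * p) <= 2^-1.
Proof.
move=> am; have q4 : 0 < 4^-1 :> R by rewrite invr_gt0.
have [s qs] := choice (central_ext_surj ext).
have [F [xi [M [bM pM xid Mg]]]] := amenable_multiplier p am q4.
have [ps ppE] := pp.
(* C is the total weight of the expansion of M p. The choices give C eta <= 1/4 and ||d^(2m) c|| <=
   1 / (2m) <= eta^2, so that M p and p - M p contribute 1/4 each. *)
pose C := \sum_(k <- F) \sum_(l <- F) `|xi k * xi l|.
have C0 : 0 <= C by apply: sumr_ge0 => k _; exact: sumr_ge0.
pose eta := (4 * (C + 1))^-1.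
have eta0 : 0 < eta by rewrite invr_gt0 mulr_gt0 // ltr_wpDl.
have eta20 : 0 <= (eta ^+ 2)^-1 by rewrite invr_ge0 exprn_ge0 // ltW.
pose m := (Num.bound (eta ^+ 2)^-1).+1.
have mE : (eta ^+ 2)^-1 <= m%:R.
  by rewrite (le_trans (ltW (archi_boundP eta20))) // ler_nat.
exists m => //; pose z := d ^+ m.
have dsa : sa d by case: T0_1B_pos.
have zs : star z = z by exact: saX.
have zc x : z * x = x * z by exact: exp1B_comm.
have z1 : nm z <= 1.
  apply: le_trans (nmX_le _ _) _; rewrite exprn_ile1 ?nm_ge0 //.
  exact: (contraction_1B T0_pos T0_1B_pos).
have nc : nm c <= 1.
  apply: le_trans (exp_nm T0P p) _; exact: projection_nm_le1.
have zzc : nm (z * (z * c)) <= eta ^+ 2.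
  rewrite mulrA /z -exprD; set k := (m + m)%N.
  have k0 : 0 < k%:R :> R by rewrite ltr0n.
  have := nm_exp1B_mul_le T0_pos T0_1B_pos k; rewrite -ler_pdivlMl // mulr1 => h.
  apply: le_trans h _; rewrite -[leRHS]invrK lef_pV2 ?posrE ?invr_gt0 ?exprn_gt0 //.
  by rewrite (le_trans mE) // ler_nat leq_addr.
have Tz x : T0 (z * x) = z * T0 x by exact: T0_exp1B_mul.
rewrite -/z; clearbody z.
(* Cauchy-Schwarz for T0 and star (p s_k z) * (p s_k z) = z^2 s_k^-1 p s_k, *)
(* whose expectation is z^2 c. *)
have Y k l : nm (z * T0 (gen ((s k)^-1)%g * p * gen (s l))) <= eta.
  rewrite -Tz.
  have -> : z * (gen ((s k)^-1)%g * p * gen (s l)) =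
      star (p * gen (s k) * z) * (p * gen (s l)).
    by rewrite !starM zs ps (gen_star full) -!mulrA (mulrA p p) ppE.
  rewrite -(@ler_pXn2r _ 2) ?nnegrE ?nm_ge0 ?(ltW eta0) //.
  apply: le_trans (exp_cs T0P _ _) _; rewrite -[leRHS]mulr1.
  apply: ler_pM; rewrite ?nm_ge0 //.
    have -> : star (p * gen (s k) * z) * (p * gen (s k) * z) =
        z * (z * (gen ((s k)^-1)%g * p * gen (s k))).
      rewrite !starM zs ps (gen_star full) [in RHS](zc (_ * _)) -!mulrA.
      by rewrite (mulrA p p) ppE.
    by rewrite !Tz (T0_conj full ext T0P).
  have -> : star (p * gen (s l)) * (p * gen (s l)) = gen ((s l)^-1)%g * p * gen (s l).
    by rewrite starM ps (gen_star full) -!mulrA (mulrA p p) ppE.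
  by rewrite (T0_conj full ext T0P).
have zM : nm (z * M p) <= 4^-1.
  rewrite (amenable_expansion qs bM xid Mg) mulr_sumr.
  apply: le_trans (nm_sum _ _ _) _.
  apply: (@le_trans _ _ (C * eta)); last first.
    by rewrite /eta invfM mulrCA ler_piMr ?invr_ge0 // ler_pdivrMr ?mul1r ?lerDl // ltr_wpDl.
  rewrite /C mulr_suml; apply: ler_sum => k _; rewrite mulr_sumr.
  apply: le_trans (nm_sum _ _ _) _; rewrite mulr_suml; apply: ler_sum => l _.
  have := Y k l; set W := T0 _ => YW.
  rewrite -scalerAr nmZr ler_wpM2l // !mulrA zc -!mulrA.
  apply: le_trans (nmM _ _) _; rewrite (nm_gen full) mul1r mulrA.
  by apply: le_trans (nmM _ _) _; rewrite (nm_gen full) mulr1.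
have -> : z * p = z * (p - M p) + z * M p by rewrite mulrBr subrK.
have := nmD (z * (p - M p)) (z * M p).
have := nmM z (p - M p); have := ler_wpM2r (nm_ge0 (p - M p)) z1; rewrite mul1r.
by move: pM zM; lra.
Qed.

End AmenableApproximation.

(** Consecutive powers differ by b^j (1 - b) = b^j w r, of norm at most 2^-j ||r||; the dominating
    sequence consists of the partial sums of this geometric series. *)
Lemma geometric_conv (R : realType) (E : cstarAlgType R[i]) (b w r : E) :
  1 - b = w * r ->
  (forall j, nm (b ^+ j * w) <= 2^-1 ^+ j) -> exists e, conv (fun j => b ^+ j) e.
Proof.
move=> br hb; apply: nm_complete.
pose a j : R := nm r * 2 * (1 - 2^-1 ^+ j).
apply: (dominated_cauchy (a := a) (K := nm r * 2)) => j.
  rewrite /a ler_piMr ?mulr_ge0 ?nm_ge0 // lerBlDr lerDl.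
have -> : a j.+1 - a j = 2^-1 ^+ j * nm r.
  by rewrite /a exprS; field.
have -> : nm (b ^+ j.+1 - b ^+ j) = nm (b ^+ j * w * r).
  by rewrite nm_subC exprSr -mulrA -br mulrBr mulr1.
by rewrite (le_trans (nmM _ _)) // ler_wpM2r ?nm_ge0.
Qed.

(** * Projections in the kernel of C*(G) -> C*(H) *)

Section Kernel.
Context (R : realType) (N G H : groupType).
Context (i : {multiplicative N -> G}) (q : {multiplicative G -> H}).
Context (AH AG : cstarAlgType R[i]).
Context (iotaH : {lrmorphism group_algebra R[i] H -> AH}).
Context (iotaG : {lrmorphism group_algebra R[i] G -> AG}).
Hypothesis tfN : torsion_free N.
Hypothesis mulNC : forall x y : N, (x * y = y * x)%g.
Hypothesis am : amenable R H.
Hypothesis ext : central_extension i q.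
Hypothesis fullH : is_full_group_cstar iotaH.
Hypothesis fullG : is_full_group_cstar iotaG.
Context (P : {lrmorphism AG -> AH}).
Hypothesis Pstar : star_morphism P.
Hypothesis Pgen : forall g, P (gen iotaG g) = gen iotaH (q g).

(** S sends delta_h to 1 if h = 1 and to 0 otherwise: it is the canonical trace of C*(H) times the
    unit, and q(g) = 1 holds exactly on N. *)
Lemma expectation_push (T0 : AG -> AG) :
  expectation i q iotaG (fun=> 1) T0 ->
  exists2 S : AH -> AH, blin S & forall x, P (T0 x) = S (P x).
Proof.
move=> T0P; have idM : {morph (@id H) : x y / (x * y)%g} by [].
have u1 (g h : H) : Num.conj (1 : R[i]) * 1 = 1 by rewrite mulr1 rmorph1.
have uc (g g' h : H) : 1 = 1 * 1 :> R[i] by rewrite mulr1.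
have [S [S1 S2 _ _]] := expectation_exists (u := fun _ _ => 1) fullH idM u1 uc.
have bS : blin S by apply: (blin_linear (K := 1)) => // x; rewrite mul1r.
have bP : blin P.
  by apply: (blin_linear (K := 1)) => // x; rewrite mul1r star_morphism_nm.
exists S => //; apply: (blin_eq fullG (f := P \o T0) (f' := S \o P)) => [||g] /=.
- exact: blin_comp (exp_blin T0P) bP.
- exact: blin_comp.
rewrite Pgen S2; have [[n ->]|gN] := ext_case ext g.
  by rewrite (exp_in T0P) !scale1r Pgen (ext_qi ext) eqxx scale1r.
by rewrite (exp_out T0P) // rmorph0 (negbTE (introN eqP gN)) scale0r.
Qed.

Theorem projection_kernel p : projection p -> P p = 0 -> p = 0.
Proof.
move=> pp Pp; have [ps ppE] := pp.
have [T0 T0P] := expectation_ex fullG ext (is_char1 R N).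
have b0 := exp_blin T0P.
have c0 := T0_pos T0P pp; have d0 := T0_1B_pos T0P pp.
have [m m0 hm] := exp1B_expectation_small fullG ext T0P pp am.
set c := T0 p in c0 d0; set d := 1 - c in d0; pose b := d ^+ m.
have bC x : GRing.comm b x by exact: (exp1B_comm fullG ext T0P).
have TbX j x : T0 (b ^+ j * x) = b ^+ j * T0 x.
  by rewrite /b -exprM; exact: (T0_exp1B_mul fullG ext T0P).
have bpX j : (b * p) ^+ j.+1 = b ^+ j.+1 * p.
  elim: j => [|j IH]; first by rewrite !expr1.
  have pC : GRing.comm p (b ^+ j.+1) by apply/commrX/commr_sym/bC.
  by rewrite exprS IH -mulrA (mulrA p) pC -(mulrA _ p) ppE mulrA -exprS.
have nbp j : nm (b ^+ j * p) <= 2^-1 ^+ j.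
  (* The identity b^j p = (b p)^j fails at j = 0, where ||p|| <= 1 is used instead. *)
  case: j => [|j]; first by rewrite !expr0 mul1r projection_nm_le1.
  rewrite -bpX; apply: le_trans (nmX_le _ _) _.
  by apply: lerXn2r; rewrite ?nnegrE ?nm_ge0 ?invr_ge0.
have nbc j : nm (b ^+ j * c) <= 2^-1 ^+ j.
  by rewrite -TbX (le_trans (exp_nm T0P _)).
have br : 1 - b = c * \sum_(k < m) d ^+ k.
  by rewrite -opprB subrX1 -mulNr opprB /d opprB addrC subrK.
have [e he] := geometric_conv br nbc.
have dsa : sa d by case: d0.
have pe : projection e.
  split; first by apply: sa_conv he _ => j; apply/saX/saX.
  apply: (@conv_uniq _ _ (fun j => b ^+ j * b ^+ j)); first exact: convM.
  move=> eps /he[n0 hn]; exists n0 => n n0n; rewrite -exprD; apply: hn.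
  exact: leq_trans n0n (leq_addr _ _).
have T0e : T0 e = e.
  apply: (conv_uniq (blin_conv b0 he)); apply: conv_eq he => j.
  by rewrite -[RHS]/(T0 (b ^+ j)) -[X in T0 X]mulr1 TbX (T0_1 T0P) mulr1.
have be : b * e = e.
  apply: (conv_uniq (convMl b he)) => eps /he[n0 hn]; exists n0 => n n0n.
  by rewrite -exprS; apply/hn/leqW.
(* As b e = e and p commutes with e, one has e p = (b p) (e p), where ||b p|| <= 1/2. *)
have ep : e * p = 0.
  have E : e * p = (b * p) * (e * p).
    rewrite -{1}be -{1}ppE -!mulrA; congr (b * _); rewrite !mulrA; congr (_ * p).
    apply: commr_sym; apply: (comm_conv he) => j.
    exact/commrX/commr_sym/bC.
  apply: nm_le0; have := nmM (b * p) (e * p); rewrite -E.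
  have := ler_wpM2r (nm_ge0 (e * p)) hm; rewrite -/b; lra.
have [e0|e1] := central_projection_trivial fullG ext mulNC tfN T0P pe T0e; last first.
  by rewrite e1 mul1r in ep.
have [S [_ SZ _] PS] := expectation_push T0P.
have Pc : P c = 0 by rewrite /c PS Pp -(scale0r 0) SZ !scale0r.
have Pb j : P (b ^+ j) = 1.
  by rewrite /b /d !rmorphXn rmorphB /= rmorph1 Pc subr0 !expr1n.
(* If e = 0, then some power of b has norm at most 1/2, although its image under the contraction P
   is 1. *)
have h2 : 0 < 2^-1 :> R by rewrite invr_gt0.
have [n0 hn] := he _ h2; have := hn _ (leqnn _); rewrite e0 subr0 => h.
have := le_trans (star_morphism_nm Pstar (b ^+ n0)) h.
by rewrite Pb nm1 invf_ge1 // lern1.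
Qed.

End Kernel.

Theorem lemma4p1 (R : realType) (N H G : groupType)
  (i : {multiplicative N -> G}) (q : {multiplicative G -> H})
  (AH AG : cstarAlgType R[i])
  (iotaH : {lrmorphism group_algebra R[i] H -> AH})
  (iotaG : {lrmorphism group_algebra R[i] G -> AG}) :
  torsion_free N -> torsion_free H ->
  countable [set: N] -> countable [set: H] ->
  (forall x y : N, (x * y = y * x)%g) ->
  amenable R H ->
  central_extension i q ->
  is_full_group_cstar iotaH ->
  is_full_group_cstar iotaG ->
  no_nontrivial_projections AH ->
  no_nontrivial_projections AG.
Proof.
move=> tfN _ _ _ mulNC am ext fullH fullG noH p pp.
have [P [Ps Pg]] := full_push fullG fullH (@gmulfM _ _ q).
have ker := projection_kernel tfN mulNC am ext fullH fullG Ps Pg.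
have PP : projection (P p).
  by case: pp => ps ppE; split; rewrite -?Ps -?rmorphM ?ps ?ppE.
have [P0|P1] := noH _ PP; [left | right]; first exact: ker.
apply/esym/eqP; rewrite -subr_eq0; apply/eqP/ker; first exact: projection1B.
by rewrite rmorphB /= rmorph1 P1 subrr.
Qed.
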